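(* Let $N\ge1$, $Z_N=Z(\mathrm U(\mathfrak q_N))$, let $c_{2r-1}$ ($r\ge1$) be Sergeev's odd cyclic elements, $b_r=c_{2r-1}$, and $\Delta_N=\det(b_{i+j-1})_{1\le i,j\le N}\in Z_N$. Let $\chi,\chi':Z_N\to\mathbb C$ be central characters, that is, unital $\mathbb C$-algebra homomorphisms. Suppose that $\chi(\Delta_N)\ne0$. If $\chi(c_{2r-1})=\chi'(c_{2r-1})$ for $1\le r\le2N$, then $\chi=\chi'$. In particular, for $\lambda\in\mathbb C^N$, consider the Harish-Chandra evaluation character $\chi_\lambda:Z_N\to\mathbb C$, $\chi_\lambda(z)=\mathrm{HC}(z)(\lambda)$. Then $\chi_\lambda(\Delta_N)\ne0$ if and only if $\lambda$ is strongly typical and $\lambda_i-\lambda_j\ne1$ for all $i\ne j$.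
   Context: Ground field $\mathbb C$. Queer Lie superalgebra: fix $N\ge1$, $I_N=\{-N,\dots,-1,1,\dots,N\}$, $\bar i=0$ if $i>0$ and $\bar i=1$ if $i<0$. Let $E_{ij}$ ($i,j\in I_N$) be the matrix units of $\mathfrak{gl}(N|N)$, of parity $\bar i+\bar j$ mod $2$. $\mathfrak q_N\subset\mathfrak{gl}(N|N)$ is the Lie sub-superalgebra spanned by $F_{ij}=E_{ij}+E_{-i,-j}$ (so $F_{-i,-j}=F_{ij}$). $\mathrm U(\mathfrak q_N)$ is its universal enveloping algebra and $Z_N=Z(\mathrm U(\mathfrak q_N))$ its center (in the superalgebra sense; all central elements are even). Harish-Chandra map: $\mathfrak h_{\bar0}=\bigoplus_{i=1}^N\mathbb C F_{ii}$, $\mathfrak h_{\bar 1}=\bigoplus_{i=1}^N\mathbb C F_{i,-i}$, $\mathfrak n_+$ (resp. $\mathfrak n_-$) is the span of $F_{ij},F_{i,-j}$ with $1\le i<j\le N$ (resp. $1\le j<i\le N$). For $z\in Z_N$, $\mathrm{HC}(z)\in\mathbb C[\lambda_1,\dots,\lambda_N]$ is the polynomial with $z\equiv \mathrm{HC}(z)|_{\lambda_i=F_{ii}}$ modulo $\mathfrak n_-\mathrm U(\mathfrak q_N)+\mathrm U(\mathfrak q_N)\mathfrak n_+$ (no $\rho$-shift). It is known that $\mathrm{HC}$ is an algebra isomorphism of $Z_N$ onto $\Gamma_N$, the algebra of symmetric polynomials $f\in\mathbb C[\lambda_1,\dots,\lambda_N]$ such that $f(t,-t,\lambda_3,\dots,\lambda_N)$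 is independent of $t$ (no condition if $N=1$). Cyclic elements: for $r\ge1$, $$c_r=\sum_{i_1,\dots,i_r\in I_N}(-1)^{\bar i_2+\cdots+\bar i_r}F_{i_1i_2}F_{i_2i_3}\cdots F_{i_ri_1}\in \mathrm U(\mathfrak q_N);$$ these are known to be central. A weight $\lambda=(\lambda_1,\dots,\lambda_N)\in\mathbb C^N$ is strongly typical if $\lambda_i+\lambda_j\ne0$ for all $1\le i,j\le N$ (including $i=j$). *)

(* Defs.v *)
From HB Require Import structures.
From mathcomp Require Import all_boot all_order all_algebra.
From mathcomp Require Import boolp classical_sets reals.
From mathcomp Require Import ring.
From mathcomp Require Import complex.
From mathcomp Require Import finmap mpoly monalg.

Set Implicit Arguments.
Unset Strict Implicit.
Unset Printing Implicit Defensive.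

Import Order.TTheory GRing.Theory Num.Theory.
Local Open Scope ring_scope.
Local Open Scope quotient_scope.

(* I_N is encoded as 'I_N + 'I_N: inl k stands for k+1, inr k for -(k+1). *)

Definition idx (N : nat) : finType := ('I_N + 'I_N)%type.

Definition pos N (k : 'I_N) : idx N := inl k.
Definition neg N (k : 'I_N) : idx N := inr k.

Definition par N (i : idx N) : bool := if i is inr _ then true else false.

Definition opp N (i : idx N) : idx N :=
  match i with inl k => inr k | inr k => inl k end.

Section QueerLieSuperalgebra.
Variables (K : fieldType) (N : nat).

(* gl(N|N), with rows and columns ordered as 1, .., N, -1, .., -N. *)
Definition ent (A : 'M[K]_(N + N)) (i j : idx N) : K :=
  A (unsplit i) (unsplit j).

Definition Emx (i j : idx N) : 'M[K]_(N + N) :=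
  delta_mx (unsplit i) (unsplit j).

Definition gl_homog (p : bool) (A : 'M[K]_(N + N)) : Prop :=
  forall i j : idx N, ent A i j != 0 -> par i (+) par j = p.

(* The superbracket of A and B, homogeneous of respective parities p, q. *)
Definition sbracket (p q : bool) (A B : 'M[K]_(N + N)) : 'M[K]_(N + N) :=
  A *m B - (-1) ^+ (p && q) *: (B *m A).

Definition Fmx (i j : idx N) : 'M[K]_(N + N) := Emx i j + Emx (opp i) (opp j).

Definition qN : {vspace 'M[K]_(N + N)} :=
  span [seq Fmx ij.1 ij.2 | ij : (idx N * idx N)%type].

Definition npos : {vspace 'M[K]_(N + N)} :=
  (span [seq Fmx (pos ij.1) (pos ij.2)
           | ij : ('I_N * 'I_N)%type in [pred ij : 'I_N * 'I_N | (ij.1 < ij.2)%N]]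
   + span [seq Fmx (pos ij.1) (neg ij.2)
           | ij : ('I_N * 'I_N)%type in [pred ij : 'I_N * 'I_N | (ij.1 < ij.2)%N]])%VS.

Definition nneg : {vspace 'M[K]_(N + N)} :=
  (span [seq Fmx (pos ij.1) (pos ij.2)
           | ij : ('I_N * 'I_N)%type in [pred ij : 'I_N * 'I_N | (ij.2 < ij.1)%N]]
   + span [seq Fmx (pos ij.1) (neg ij.2)
           | ij : ('I_N * 'I_N)%type in [pred ij : 'I_N * 'I_N | (ij.2 < ij.1)%N]])%VS.

Lemma oppK : involutive (@opp N).
Proof. by case. Qed.

Lemma par_opp (i : idx N) : par (opp i) = ~~ par i.
Proof. by case: i. Qed.

Lemma opp_eq (i j : idx N) : (opp i == opp j) = (i == j).
Proof. exact: inj_eq (inv_inj oppK) _ _. Qed.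

Lemma eq_opp (i j : idx N) : (opp i == j) = (i == opp j).
Proof. exact: can2_eq oppK oppK _ _. Qed.

Lemma unsplitKI : injective (@unsplit N N).
Proof. exact: can_inj unsplitK. Qed.

Lemma big_idx (G : 'I_(N + N) -> K) :
  \sum_k G k = \sum_(i : idx N) G (unsplit i).
Proof.
rewrite (reindex (@unsplit N N)) //=.
by exists (@split N N) => i _; [apply: unsplitK | apply: splitK].
Qed.

Lemma entP (A B : 'M[K]_(N + N)) :
  (forall i j, ent A i j = ent B i j) -> A = B.
Proof.
move=> eqAB; apply/matrixP=> i j.
by rewrite -(splitK i) -(splitK j); apply: eqAB.
Qed.

Lemma ent_mul (A B : 'M[K]_(N + N)) i j :
  ent (A *m B) i j = \sum_(k : idx N) ent A i k * ent B k j.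
Proof. by rewrite /ent mxE big_idx. Qed.

Lemma entE i j k l : ent (Emx i j) k l = ((k == i) && (l == j))%:R.
Proof. by rewrite /ent mxE !(inj_eq unsplitKI). Qed.

Lemma entF i j k l :
  ent (Fmx i j) k l = ((k == i) && (l == j))%:R
                      + ((k == opp i) && (l == opp j))%:R.
Proof. by rewrite /ent mxE -!/(ent _ _ _) !entE. Qed.

Lemma entZ a A i j : ent (a *: A) i j = a * ent A i j.
Proof. by rewrite /ent mxE. Qed.

Lemma entD A B i j : ent (A + B) i j = ent A i j + ent B i j.
Proof. by rewrite /ent mxE. Qed.

Lemma entN A i j : ent (- A) i j = - ent A i j.
Proof. by rewrite /ent mxE. Qed.

Lemma ent_sum (T : finType) (G : T -> 'M[K]_(N + N)) i j :
  ent (\sum_t G t) i j = \sum_t ent (G t) i j.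
Proof. by rewrite /ent summxE. Qed.

Lemma Fmx_in i j : Fmx i j \in qN.
Proof. by apply: memv_span; apply/mapP; exists (i, j); rewrite ?mem_enum. Qed.

Lemma span_sym (s : seq 'M[K]_(N + N)) :
    (forall B, B \in s -> forall i j, ent B (opp i) (opp j) = ent B i j) ->
  forall A, A \in span s -> forall i j, ent A (opp i) (opp j) = ent A i j.
Proof.
move=> symF A A_s i j.
rewrite (coord_span (A_s : A \in span (in_tuple s))) /ent !summxE.
apply: eq_bigr => k _; rewrite !mxE; congr (_ * _).
by apply: symF; rewrite mem_nth.
Qed.

Lemma sym_expand A : (forall i j, ent A (opp i) (opp j) = ent A i j) ->
  A = \sum_(k : 'I_N) \sum_(j : idx N) ent A (pos k) j *: Fmx (pos k) j.
Proof.
move=> symA.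
apply: entP => i j; rewrite ent_sum.
under eq_bigr => k _.
  rewrite ent_sum; under eq_bigr => l _ do rewrite entZ entF.
  over.
case: i => i.
  rewrite (bigD1 i) //= (bigD1 j) //= !eqxx addr0 mulr1 !big1 ?addr0 //.
    move=> k ki; rewrite big1 // => l _.
    rewrite [inl i == _](_ : _ = false) ?addr0 ?mulr0 //.
    by apply/negbTE; apply: contra ki => /eqP[->].
  by move=> k ki; rewrite eq_sym (negbTE ki) andbF addr0 mulr0.
rewrite (bigD1 i) //= (bigD1 (opp j)) //= oppK !eqxx add0r mulr1.
rewrite !big1 ?addr0; first by rewrite -symA.
  move=> k ki; rewrite big1 // => l _.
  rewrite [inr i == _](_ : _ = false) ?addr0 ?mulr0 //.
  by apply/negbTE; apply: contra ki => /eqP[->].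
by move=> k ki; rewrite -eq_opp eq_sym (negbTE ki) andbF addr0 mulr0.
Qed.

(* q_N consists of the block matrices [A B; B A]. *)
Lemma mem_qN A :
  A \in qN <-> forall i j, ent A (opp i) (opp j) = ent A i j.
Proof.
split=> [|symA].
  apply: span_sym => _ /mapP[[k l] _ ->] i j /=.
  by rewrite !entF !opp_eq !eq_opp addrC.
rewrite (sym_expand symA).
by apply: memv_suml => k _; apply: memv_suml => j _; apply/memvZ/Fmx_in.
Qed.

Lemma sbracket_in p q A B : A \in qN -> B \in qN -> sbracket p q A B \in qN.
Proof.
move=> /mem_qN symA /mem_qN symB; apply: memvB; last apply: memvZ;
  apply/mem_qN => i j; rewrite !ent_mul (reindex_inj (inv_inj oppK)) /=;
  by apply: eq_bigr => k _; rewrite symA symB.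
Qed.

Lemma gl_homogF i j : gl_homog (par i (+) par j) (Fmx i j).
Proof.
move=> k l; rewrite entF.
case: andP => [[/eqP-> /eqP->] //|_]; case: andP => [[/eqP-> /eqP->] _|_].
  by rewrite !par_opp addNb addbN negbK.
by rewrite addr0 eqxx.
Qed.


Lemma mul_Emx i j k l : Emx i j *m Emx k l = (j == k)%:R *: Emx i l.
Proof.
rewrite /Emx mul_delta_mx_cond (inj_eq unsplitKI).
by case: eqP; rewrite ?scale1r ?scale0r.
Qed.

Lemma Fmx_opp i j : Fmx (opp i) (opp j) = Fmx i j.
Proof. by rewrite /Fmx !oppK addrC. Qed.

Lemma mul_Fmx i j k l :
  Fmx i j *m Fmx k l =
    (j == k)%:R *: Fmx i l + (opp j == k)%:R *: Fmx (opp i) l.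
Proof.
rewrite {1 2}/Fmx mulmxDl !mulmxDr !mul_Emx opp_eq -eq_opp.
rewrite /Fmx oppK !scalerDr [X in _ + X]addrC addrACA.
by congr (_ + _); apply: addrC.
Qed.

Lemma sbracketF p q i j k l :
  sbracket p q (Fmx i j) (Fmx k l) =
    (j == k)%:R *: Fmx i l + (opp j == k)%:R *: Fmx (opp i) l
    - (-1) ^+ (p && q) *:
      ((l == i)%:R *: Fmx k j + (opp l == i)%:R *: Fmx k (opp j)).
Proof. by rewrite /sbracket !mul_Fmx -[Fmx k (opp j)]Fmx_opp oppK. Qed.

End QueerLieSuperalgebra.

Section CyclicSums.
Variables (K : fieldType) (N : nat) (A : algType K) (f : idx N -> idx N -> A).

Local Notation eps i := ((-1) ^+ par i : K).
Local Notation sg i j k l :=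
  ((-1) ^+ ((par i (+) par j) && (par k (+) par l)) : K).

(* The value of [F_ij, y_kl], both for y = F and for the partial sums y = xs n
   of the cyclic elements. *)
Definition DF (y : idx N -> idx N -> A) i j k l : A :=
  (j == k)%:R *: y i l + (opp j == k)%:R *: y (opp i) l
  - sg i j k l *: ((l == i)%:R *: y k j + (opp l == i)%:R *: y k (opp j)).

Hypothesis fR : forall i j k l,
  f i j * f k l - sg i j k l *: (f k l * f i j) = DF f i j k l.

Fixpoint xs (n : nat) (k l : idx N) : A :=
  if n is n'.+1 then \sum_m eps m *: (f k m * xs n' m l) else f k l.

Lemma sum_delta (G : idx N -> A) i : \sum_m (m == i)%:R *: G m = G i.
Proof.
rewrite (bigD1 i) //= eqxx scale1r big1 ?addr0 // => m /negbTE ->.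
by rewrite scale0r.
Qed.

Lemma xs_comm n i j k l :
  f i j * xs n k l = sg i j k l *: (xs n k l * f i j) + DF (xs n) i j k l.
Proof.
elim: n k l => [|n IHn] k l; first by rewrite -fR addrC subrK.
have fR' i' j' k' l' : f i' j' * f k' l'
    = sg i' j' k' l' *: (f k' l' * f i' j') + DF f i' j' k' l'.
  by rewrite -fR addrC subrK.
rewrite [xs n.+1 k l]/= mulr_sumr mulr_suml scaler_sumr.
pose y := xs n.
have Hs (m : idx N) : sg i j k m * sg i j m l = sg i j k l.
  rewrite -signr_addb; congr (_ ^+ nat_of_bool _).
  by case: (par i) (par j) (par k) (par m) (par l) => [] [] [] [] [].
have step m : f i j * (eps m *: (f k m * y m l))
    = sg i j k l *: (eps m *: (f k m * y m l) * f i j)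
      + (eps m *: (sg i j k m *: (f k m * DF y i j m l))
         + eps m *: (DF f i j k m * y m l)).
  rewrite -scalerAr mulrA fR' mulrDl -scalerAl -mulrA IHn -/y mulrDr.
  rewrite -scalerAr !scalerDr addrA -!scalerAl !scalerA !mulrA.
  congr (_ *: _ + _ + _).
  by rewrite -(Hs m); ring.
rewrite (eq_bigr _ (fun m _ => step m)) big_split /=; congr (_ + _).
rewrite big_split /=.
have S1 : \sum_m eps m *: (sg i j k m *: (f k m * DF y i j m l))
   = (eps j * sg i j k j) *: (f k j * y i l)
     + (eps (opp j) * sg i j k (opp j)) *: (f k (opp j) * y (opp i) l)
     - sg i j k l *: ((l == i)%:R *: xs n.+1 k j
                      + (opp l == i)%:R *: xs n.+1 k (opp j)).
  rewrite -(sum_delta (fun m => (eps m * sg i j k m) *: (f k m * y i l))).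
  rewrite -(sum_delta
    (fun m => (eps m * sg i j k m) *: (f k m * y (opp i) l)) (opp j)).
  rewrite /= !scaler_sumr -!big_split /= scaler_sumr -sumrB.
  apply: eq_bigr => m _; rewrite /DF -/y !mulrBr !mulrDr.
  rewrite -!scalerAr !mulrDr -!scalerAr !scalerBr !scalerDr !scalerA.
  rewrite [j == m]eq_sym [opp j == m]eq_sym.
  congr (_ *: _ + _ *: _ - (_ *: _ + _ *: _)); try ring.
  - by rewrite -(Hs m); ring.
  - by rewrite -(Hs m); ring.
have S2 : \sum_m eps m *: (DF f i j k m * y m l)
   = (j == k)%:R *: xs n.+1 i l + (opp j == k)%:R *: xs n.+1 (opp i) l
     - ((eps i * sg i j k i) *: (f k j * y i l)
        + (eps (opp i) * sg i j k (opp i)) *: (f k (opp j) * y (opp i) l)).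
  rewrite -(sum_delta (fun m => (eps m * sg i j k m) *: (f k j * y m l))).
  rewrite -(sum_delta
    (fun m => (eps m * sg i j k m) *: (f k (opp j) * y m l)) (opp i)).
  rewrite /= !scaler_sumr -!big_split /= -sumrB.
  apply: eq_bigr => m _; rewrite /DF -/y !mulrBl !mulrDl.
  rewrite -!scalerAl !mulrDl -!scalerAl !scalerBr !scalerDr !scalerA.
  rewrite (eq_opp m i).
  by congr (_ *: _ + _ *: _ - (_ *: _ + _ *: _));ring.
rewrite S1 S2 /DF.
have -> : eps j * sg i j k j = eps i * sg i j k i.
  by rewrite -!signr_addb; case: (par i) (par j) (par k) => [] [] [].
have -> : eps (opp j) * sg i j k (opp j) = eps (opp i) * sg i j k (opp i).
  by rewrite -!signr_addb !par_opp; case: (par i) (par j) (par k) => [] [] [].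
by rewrite addrC addrA subrK.
Qed.

Lemma trace_xs_comm n i j :
  f i j * (\sum_k xs n k k) = (\sum_k xs n k k) * f i j.
Proof.
rewrite mulr_sumr mulr_suml.
have step k : f i j * xs n k k = xs n k k * f i j
    + ((k == j)%:R *: xs n i k + (k == opp j)%:R *: xs n (opp i) k
       - ((k == i)%:R *: xs n k j + (k == opp i)%:R *: xs n k (opp j))).
  rewrite xs_comm /DF addbb andbF expr0 !scale1r.
  by rewrite [j == k]eq_sym [opp j == k]eq_sym (eq_opp k i).
rewrite (eq_bigr _ (fun k _ => step k)) big_split sumrB !big_split /=.
rewrite (sum_delta (fun k => xs n k j) i) (sum_delta (fun k => xs n i k) j).
rewrite (sum_delta (fun k => xs n k (opp j)) (opp i)).
rewrite (sum_delta (fun k => xs n (opp i) k) (opp j)).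
by rewrite subrr addr0.
Qed.

(* ordS is the cyclic successor, so the last factor is f i_r i_1. *)
Definition csum (r : nat) : A :=
  \sum_(i : r.-tuple (idx N))
    (-1) ^+ (\sum_(k < r | (0 < k)%N) par (tnth i k))
      *: \prod_(k < r) f (tnth i k) (tnth i (ordS k)).

Lemma sum_tuple_cons n (G : n.+1.-tuple (idx N) -> A) :
  \sum_i G i = \sum_a \sum_(g : n.-tuple (idx N)) G [tuple of a :: g].
Proof.
rewrite pair_big /= (reindex (fun p : idx N * n.-tuple (idx N) =>
  [tuple of p.1 :: p.2])) //=.
exists (fun i : n.+1.-tuple (idx N) => (thead i, [tuple of behead i])) => p _.
  by case: p => a g; congr (_, _); apply: val_inj.
by rewrite -tuple_eta.
Qed.

Lemma xs_paths n a b :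
  xs n a b = \sum_(g : n.-tuple (idx N))
    (-1) ^+ (\sum_(k < n) par (tnth g k)) *:
    \prod_(k < n.+1) f (nth a (a :: rcons g b) k) (nth a (a :: rcons g b) k.+1).
Proof.
have dflt (s : seq (idx N)) x y m : (m < size s)%N -> nth x s m = nth y s m.
  exact: set_nth_default.
elim: n a => [|n IHn] a.
  rewrite (big_pred1 [tuple]) => [|g]; last by apply/esym/eqP; exact: tuple0.
  by rewrite !big_ord0 big_ord_recl big_ord0 mulr1 scale1r.
rewrite sum_tuple_cons /=; apply: eq_bigr => m _.
rewrite IHn mulr_sumr scaler_sumr; apply: eq_bigr => g _.
rewrite -scalerAr scalerA [in RHS]big_ord_recl /= -exprD.
rewrite [in X in _ = _ *: X]big_ord_recl /=.
congr (_ ^+ (_ + _)%N *: (_ * _)).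
  by apply: eq_bigr => k _; rewrite !(tnth_nth m) /= .
apply: eq_bigr => k _ /=; congr (f _ _); apply: dflt => //=.
  by rewrite size_rcons size_tuple ltnS ltnW // ltnS ltn_ord.
by rewrite size_rcons size_tuple ltn_ord.
Qed.

Lemma csum_xs n : csum n.+1 = \sum_k xs n k k.
Proof.
rewrite /csum sum_tuple_cons; apply: eq_bigr => a _; rewrite xs_paths.
apply: eq_bigr => g _; congr (_ ^+ _ *: _).
  rewrite big_mkcond big_ord_recl /= add0n.
  by apply: eq_bigr => k _; rewrite !(tnth_nth a).
apply: eq_bigr => k _; rewrite !(tnth_nth a) /=.
have [kn|nk] := ltnP k n.
  rewrite modn_small ?ltnS //=; congr (f _ _); last first.
    by rewrite nth_rcons size_tuple kn.
  case: (k : nat) kn => //= k' kn.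
  by rewrite nth_rcons size_tuple ltnW.
have -> : nat_of_ord k = n by apply/eqP; rewrite eqn_leq nk -ltnS ltn_ord.
rewrite modnn /= nth_rcons size_tuple ltnn eqxx; congr (f _ _).
case: (n) g {nk k} => //= m g.
by rewrite nth_rcons size_tuple ltnSn.
Qed.

End CyclicSums.

Section FreeAlgebra.
Variables (K : fieldType) (V : choiceType).
Implicit Types (u v : {malg K[{fmonom V}]}).

Lemma free_scalerAr (a : K) u v : a *: (u * v) = u * (a *: v).
Proof.
rewrite [u * v]malgME scaler_sumr [RHS](@malgMEw _ _ (msupp u) (msupp v)).
- apply: eq_bigr => k _; rewrite scaler_sumr; apply: eq_bigr => l _.
  apply/malgP => m; rewrite mcoeffZ.
  rewrite (mcoeffU _ (mcoeff k u * mcoeff l v)).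
  by rewrite (mcoeffU _ (mcoeff k u * _)) (mcoeffZ a v) mulrnAr mulrCA.
- exact: fsubset_refl.
- exact: msuppZ_le.
Qed.

Definition counit u : K := mcoeff (@mone _) u.

Lemma counitD u v : counit (u + v) = counit u + counit v.
Proof. exact: mcoeffD. Qed.
Lemma counitB u v : counit (u - v) = counit u - counit v.
Proof. exact: mcoeffB. Qed.
Lemma counitZ a u : counit (a *: u) = a * counit u.
Proof. exact: mcoeffZ. Qed.
Lemma counitM u v : counit (u * v) = counit u * counit v.
Proof. by rewrite /counit rmorphM. Qed.
Lemma counit1 : counit 1 = 1.
Proof. by rewrite /counit mcoeff1 eqxx. Qed.

Definition free_gen (x : V) : {malg K[{fmonom V}]} := locked << fmu x >>.

Lemma counit_gen x : counit (free_gen x) = 0.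
Proof. by rewrite /free_gen -lock /counit mcoeffU1 fmP fm1 fmuE. Qed.

Lemma counit_linear a x y z :
  counit (free_gen z - (a *: free_gen x + free_gen y)) = 0.
Proof. by rewrite counitB counitD counitZ 3!counit_gen mulr0 addr0 subr0. Qed.

Lemma counit_lin a u v w :
  counit u = 0 -> counit v = 0 -> counit w = 0 -> counit (u - a *: v - w) = 0.
Proof.
by move=> u0 v0 w0; rewrite !counitB counitZ u0 v0 w0 mulr0 !subr0.
Qed.

Lemma counit_mull u v : counit v = 0 -> counit (u * v) = 0.
Proof. by move=> v0; rewrite counitM v0 mulr0. Qed.

Lemma counit_mulr u v : counit u = 0 -> counit (u * v) = 0.
Proof. by move=> u0; rewrite counitM u0 mul0r. Qed.

End FreeAlgebra.

Section EnvelopingAlgebra.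
Variables (K : fieldType) (N : nat).

Local Notation q_ := (subvs_of (qN K N)).

(* K<q_N>, the free algebra on the underlying set of q_N; the linear
   relations of U_ideal turn it into the tensor algebra of q_N. *)
Local Notation T_ := {malg K[{fmonom q_}]}.

Definition gen (x : q_) : T_ := free_gen K x.

Inductive U_ideal : T_ -> Prop :=
  | UI_linear a x y : U_ideal (gen (a *: x + y) - (a *: gen x + gen y))
  | UI_bracket p q x y z :
      gl_homog p (vsval x) -> gl_homog q (vsval y) ->
      vsval z = sbracket p q (vsval x) (vsval y) ->
      U_ideal (gen x * gen y - (-1) ^+ (p && q) *: (gen y * gen x) - gen z)
  | UI_0 : U_ideal 0
  | UI_add u v : U_ideal u -> U_ideal v -> U_ideal (u + v)
  | UI_mull u v : U_ideal v -> U_ideal (u * v)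
  | UI_mulr u v : U_ideal u -> U_ideal (u * v).

Definition U_idealb : {pred T_} := fun u => `[< U_ideal u >].

Lemma U_idealP u : reflect (U_ideal u) (u \in U_idealb).
Proof. exact: asboolP. Qed.

Lemma U_ideal_zmod_closed : zmod_closed U_idealb.
Proof.
split=> [|u v /U_idealP Iu /U_idealP Iv]; apply/U_idealP; first exact: UI_0.
by apply: UI_add => //; rewrite -mulN1r; apply: UI_mull.
Qed.

HB.instance Definition _ := GRing.isZmodClosed.Build T_ U_idealb
  U_ideal_zmod_closed.

Definition UqN : Type := Quotient.quot U_idealb.

HB.instance Definition _ := GRing.Zmodule.on UqN.

Definition U_pi (u : T_) : UqN := \pi_UqN u.

Lemma U_pi_eq u v : U_pi u = U_pi v <-> U_ideal (u - v).
Proof.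
by split=> [/eqP|/U_idealP Iuv]; [rewrite -Quotient.idealrBE => /U_idealP
                                 |apply/eqP; rewrite -Quotient.idealrBE].
Qed.

Lemma U_piK u : U_pi (repr u) = u.
Proof. exact: reprK. Qed.

Lemma U_pi_ind (P : UqN -> Prop) : (forall u, P (U_pi u)) -> forall u, P u.
Proof. by move=> Ppi u; rewrite -[u]U_piK. Qed.

Lemma U_piD : {morph U_pi : u v / u + v}.
Proof. exact: raddfD (\pi_UqN) . Qed.

Lemma U_piB : {morph U_pi : u v / u - v}.
Proof. exact: raddfB (\pi_UqN). Qed.

Definition U_one := lift_cst UqN 1.
Definition U_mul := lift_op2 UqN *%R.
Definition U_scale (a : K) := lift_op1 UqN ( *:%R a).

Lemma U_pi1 : U_pi 1 = U_one.
Proof. by rewrite /U_one; unlock. Qed.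

Lemma U_piM u v : U_pi (u * v) = U_mul (U_pi u) (U_pi v).
Proof.
rewrite /U_mul; unlock; apply/U_pi_eq; set u' := repr _; set v' := repr _.
have Iu : U_ideal (u - u') by apply/U_pi_eq; rewrite U_piK.
have Iv : U_ideal (v - v') by apply/U_pi_eq; rewrite U_piK.
rewrite (_ : _ - _ = (u - u') * v + u' * (v - v')).
  by apply: UI_add; [apply: UI_mulr | apply: UI_mull].
by rewrite mulrBl mulrBr addrA subrK.
Qed.

Lemma U_piZ a u : U_pi (a *: u) = U_scale a (U_pi u).
Proof.
rewrite /U_scale; unlock; apply/U_pi_eq; set u' := repr _; rewrite -scalerBr -mul_malgC.
by apply/UI_mull/U_pi_eq; rewrite U_piK.
Qed.

Lemma U_ideal_counit u : U_ideal u -> counit u = 0.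
Proof.
elim=> {u} [a x y|p q x y z _ _ _||u v _ IHu _ IHv|u v _ IHv|u v _ IHu].
- exact: counit_linear.
- by apply: counit_lin (counit_gen K z);
    apply: counit_mull; apply: counit_gen.
- exact: mcoeff0.
- by rewrite counitD IHu IHv addr0.
- exact: counit_mull.
- exact: counit_mulr.
Qed.

Fact U_mulA : associative U_mul.
Proof.
by elim/U_pi_ind=> u; elim/U_pi_ind=> v; elim/U_pi_ind=> w;
  rewrite -!U_piM mulrA.
Qed.
Fact U_mul1l : left_id U_one U_mul.
Proof. by elim/U_pi_ind=> u; rewrite -U_pi1 -U_piM mul1r. Qed.
Fact U_mul1r : right_id U_one U_mul.
Proof. by elim/U_pi_ind=> u; rewrite -U_pi1 -U_piM mulr1. Qed.
Fact U_mulDl : left_distributive U_mul +%R.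
Proof.
by elim/U_pi_ind=> u; elim/U_pi_ind=> v; elim/U_pi_ind=> w;
  rewrite -?U_piD -!U_piM -?U_piD mulrDl.
Qed.
Fact U_mulDr : right_distributive U_mul +%R.
Proof.
by elim/U_pi_ind=> u; elim/U_pi_ind=> v; elim/U_pi_ind=> w;
  rewrite -?U_piD -!U_piM -?U_piD mulrDr.
Qed.
Fact U_one_neq0 : U_one != 0.
Proof.
have U_pi0 : U_pi 0 = 0 by apply: (addrI (U_pi 0)); rewrite -U_piD !addr0.
rewrite -U_pi0 -U_pi1; apply/eqP=> /U_pi_eq; rewrite subr0 => /U_ideal_counit/eqP.
by rewrite counit1 oner_eq0.
Qed.

HB.instance Definition _ := GRing.Zmodule_isNzRing.Build UqN
  U_mulA U_mul1l U_mul1r U_mulDl U_mulDr U_one_neq0.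

Fact U_scalerA a b u : U_scale a (U_scale b u) = U_scale (a * b) u.
Proof. by elim/U_pi_ind: u => u; rewrite -!U_piZ scalerA. Qed.
Fact U_scale1r : left_id 1 U_scale.
Proof. by elim/U_pi_ind=> u; rewrite -U_piZ scale1r. Qed.
Fact U_scalerDr : right_distributive U_scale +%R.
Proof.
by move=> a; elim/U_pi_ind=> u; elim/U_pi_ind=> v;
  rewrite -U_piD -!U_piZ -U_piD scalerDr.
Qed.
Fact U_scalerDl u : {morph U_scale^~ u : a b / a + b}.
Proof. by move=> a b; elim/U_pi_ind: u => u; rewrite -!U_piZ -U_piD scalerDl. Qed.

HB.instance Definition _ := GRing.Zmodule_isLmodule.Build K UqN
  U_scalerA U_scale1r U_scalerDr U_scalerDl.

Fact U_scalerAl (a : K) (u v : UqN) : a *: (u * v) = (a *: u) * v.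
Proof.
elim/U_pi_ind: u => u; elim/U_pi_ind: v => v.
by rewrite -[RHS]/(U_mul (U_scale a _) _) -U_piZ -U_piM
   -[LHS]/(U_scale a (U_mul _ _)) -U_piM -U_piZ scalerAl.
Qed.
HB.instance Definition _ := GRing.Lmodule_isLalgebra.Build K UqN U_scalerAl.

Fact U_scalerAr (a : K) (u v : UqN) : a *: (u * v) = u * (a *: v).
Proof.
elim/U_pi_ind: u => u; elim/U_pi_ind: v => v.
by rewrite -[RHS]/(U_mul _ (U_scale a _)) -U_piZ -U_piM
   -[LHS]/(U_scale a (U_mul _ _)) -U_piM -U_piZ free_scalerAr.
Qed.
HB.instance Definition _ := GRing.Lalgebra_isAlgebra.Build K UqN U_scalerAr.

Definition iota (x : q_) : UqN := U_pi (gen x).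

Fact iota_linear : linear iota.
Proof.
move=> a x y; rewrite /iota; have /U_pi_eq -> := UI_linear a x y.
by rewrite U_piD U_piZ.
Qed.
HB.instance Definition _ := GRing.isLinear.Build K q_ UqN *:%R iota iota_linear.

Lemma iota_bracket p q x y z :
    gl_homog p (vsval x) -> gl_homog q (vsval y) ->
    vsval z = sbracket p q (vsval x) (vsval y) ->
  iota x * iota y - (-1) ^+ (p && q) *: (iota y * iota x) = iota z.
Proof.
move=> hx hy hz; set c := (-1) ^+ _.
have E : U_pi (gen x * gen y - c *: (gen y * gen x))
         = iota x * iota y - c *: (iota y * iota x).
  by rewrite U_piB U_piZ; congr (_ - _ *: _); exact: U_piM.
exact: etrans (esym E) (proj2 (U_pi_eq _ _) (UI_bracket hx hy hz)).
Qed.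

(* U(q_N)_p is spanned by the products of homogeneous elements of q_N whose
   parities add up to p. *)
Inductive U_homog : bool -> UqN -> Prop :=
  | UH_one : U_homog false 1
  | UH_mul p q x u : gl_homog p (vsval x) -> U_homog q u ->
      U_homog (p (+) q) (iota x * u)
  | UH_zero p : U_homog p 0
  | UH_lin p a u v : U_homog p u -> U_homog p v -> U_homog p (a *: u + v).

Definition scentral_homog (p : bool) (z : UqN) : Prop :=
  U_homog p z /\
  forall q u, U_homog q u -> z * u = (-1) ^+ (p && q) *: (u * z).

Definition scentral (z : UqN) : Prop :=
  exists z0 z1, [/\ scentral_homog false z0, scentral_homog true z1 &
                    z = z0 + z1].

Definition scentralb : {pred UqN} := fun z => `[< scentral z >].

Lemma scentralP z : reflect (scentral z) (z \in scentralb).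
Proof. exact: asboolP. Qed.

Lemma U_homogM p q u v : U_homog p u -> U_homog q v -> U_homog (p (+) q) (u * v).
Proof.
move=> hu hv; elim: hu => {p u} [|p p' x u hx _ IH|p|p a u w _ IHu _ IHw].
- by rewrite mul1r.
- by rewrite -mulrA -addbA; apply: UH_mul.
- by rewrite mul0r; apply: UH_zero.
- by rewrite mulrDl -scalerAl; apply: UH_lin.
Qed.

Lemma scentral_homog0 p : scentral_homog p 0.
Proof. by split=> [|q u _]; [apply: UH_zero | rewrite mul0r mulr0 scaler0]. Qed.

Lemma scentral_homog_lin p a z w :
  scentral_homog p z -> scentral_homog p w -> scentral_homog p (a *: z + w).
Proof.
move=> [hz cz] [hw cw]; split=> [|q u hu]; first exact: UH_lin.
rewrite mulrDl mulrDr -scalerAl -scalerAr (cz q) // (cw q) // scalerDr.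
by rewrite !scalerA mulrC.
Qed.

Lemma scentral_homogD p z w :
  scentral_homog p z -> scentral_homog p w -> scentral_homog p (z + w).
Proof. by move=> cz cw; rewrite -[z]scale1r; apply: scentral_homog_lin. Qed.

Lemma scentral_homogM p q z w :
  scentral_homog p z -> scentral_homog q w -> scentral_homog (p (+) q) (z * w).
Proof.
move=> [hz cz] [hw cw]; split=> [|r u hu]; first exact: U_homogM.
rewrite -mulrA (cw r u hu) -scalerAr (mulrA z u w) (cz r u hu) -scalerAl scalerA
  -(mulrA u z w).
by rewrite -signr_addb addbC -andb_addl.
Qed.

Fact scentral_closed : subalg_closed scentralb.
Proof.
split=> [|a z w /scentralP[z0 [z1 [cz0 cz1 ->]]]
        |z w /scentralP[z0 [z1 [cz0 cz1 ->]]]].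
- apply/scentralP; exists 1, 0; split; last by rewrite addr0.
    by split=> [|q u _]; [apply: UH_one | rewrite mul1r mulr1 scale1r].
  exact: scentral_homog0.
- move=> /scentralP[w0 [w1 [cw0 cw1 ->]]]; apply/scentralP.
  exists (a *: z0 + w0), (a *: z1 + w1).
  by split; [exact: scentral_homog_lin..|rewrite scalerDr addrACA].
- move=> /scentralP[w0 [w1 [cw0 cw1 ->]]]; apply/scentralP.
  exists (z0 * w0 + z1 * w1), (z0 * w1 + z1 * w0); split.
  + exact: scentral_homogD (scentral_homogM cz0 cw0) (scentral_homogM cz1 cw1).
  + exact: scentral_homogD (scentral_homogM cz0 cw1) (scentral_homogM cz1 cw0).
  + by rewrite mulrDl !mulrDr [z1 * w0 + _]addrC addrACA.
Qed.

HB.instance Definition _ := GRing.isSubalgClosed.Build K UqN scentralb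
  (GRing.subalg_closed_semi scentral_closed).

(* Z_N, the center of U(q_N) in the sense of superalgebras. *)
Record ZN := MkZN { ZN_val : UqN; ZN_valP : ZN_val \in scentralb }.

HB.instance Definition _ := [isSub for ZN_val].
HB.instance Definition _ := [Choice of ZN by <:].
HB.instance Definition _ := [SubChoice_isSubNzRing of ZN by <:].
HB.instance Definition _ := [SubZmodule_isSubLmodule of ZN by <:].
HB.instance Definition _ := [SubNzRing_SubLmodule_isSubLalgebra of ZN by <:].
HB.instance Definition _ := [SubLalgebra_isSubAlgebra of ZN by <:].

Definition FU (i j : idx N) : UqN := iota (Subvs (Fmx_in K i j)).

Fact lin_comb (V W : lmodType K) (h : {linear V -> W}) 
    (a b s c d : K) (x y z t : V) :
  h (a *: x + b *: y - s *: (c *: z + d *: t))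
  = a *: h x + b *: h y - s *: (c *: h z + d *: h t).
Proof.
have hZ (e : K) (u : V) : h (e *: u) = e *: h u by rewrite linearZ.
have hD (u v : V) : h (u + v) = h u + h v by rewrite linearD.
have hB (u v : V) : h (u - v) = h u - h v by rewrite linearB.
by rewrite hB hD !hZ hD !hZ.
Qed.

Lemma FU_bracket i j k l :
  FU i j * FU k l
    - (-1) ^+ ((par i (+) par j) && (par k (+) par l)) *: (FU k l * FU i j)
  = DF FU i j k l.
Proof.
pose fq (i' j' : idx N) : q_ := Subvs (Fmx_in K i' j').
set s := (-1) ^+ _; pose z : q_ :=
  (j == k)%:R *: fq i l + (opp j == k)%:R *: fq (opp i) l
  - s *: ((l == i)%:R *: fq k j + (opp l == i)%:R *: fq k (opp j)).
rewrite [LHS](@iota_bracket _ _ (fq i j) (fq k l) z) => //.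
- exact: lin_comb.
- exact: gl_homogF.
- exact: gl_homogF.
- by rewrite sbracketF; exact: lin_comb.
Qed.

Definition c_U (r : nat) : UqN := csum FU r.

Lemma U_homog_xs n k l : U_homog (par k (+) par l) (xs FU n k l).
Proof.
have homF i j : U_homog (par i (+) par j) (FU i j).
  rewrite -[FU i j]mulr1 -[_ (+) _]addbF.
  by apply: UH_mul UH_one; apply: gl_homogF.
elim: n k l => [|n IHn] k l //=.
apply: (big_ind (U_homog _)) => [|u v hu hv|m _]; first exact: UH_zero.
  by rewrite -[u]scale1r; apply: UH_lin.
rewrite -[_ *: _]addr0; apply: UH_lin (UH_zero _).
have -> : par k (+) par l = (par k (+) par m) (+) (par m (+) par l).
  by rewrite -addbA addKb.
exact: U_homogM.
Qed.

Lemma comm_homog (z : UqN) : (forall i j, z * FU i j = FU i j * z) ->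
  forall q u, U_homog q u -> z * u = u * z.
Proof.
move=> cz q u; elim=> {q u} [|p q x u _ _ IHu|p|p a u v _ IHu _ IHv].
- by rewrite mulr1 mul1r.
- suff cx : z * iota x = iota x * z by rewrite mulrA cx -mulrA IHu mulrA.
  have -> : x = \sum_(k : 'I_N) \sum_(j : idx N)
                 ent (vsval x) (pos k) j *: (Subvs (Fmx_in K (pos k) j) : q_).
    apply: val_inj; rewrite linear_sum [LHS]sym_expand; last first.
      by apply/mem_qN/subvsP.
    apply: eq_bigr => k _; rewrite linear_sum; apply: eq_bigr => j _.
    by rewrite linearZ.
  rewrite linear_sum mulr_sumr mulr_suml; apply: eq_bigr => k _.
  rewrite linear_sum mulr_sumr mulr_suml; apply: eq_bigr => j _.
  by rewrite linearZ -scalerAr -scalerAl; congr (_ *: _); exact: cz.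
- by rewrite mulr0 mul0r.
- by rewrite mulrDr mulrDl -scalerAr IHu IHv -scalerAl.
Qed.

Lemma c_U_central r : c_U r \in scentralb.
Proof.
apply/scentralP; exists (c_U r), 0.
split; [|exact: scentral_homog0|by rewrite addr0].
case: r => [|n].
  suff -> : c_U 0 = 1 by split=> [|q u _]; [exact: UH_one|rewrite mulr1 mul1r scale1r].
  rewrite /c_U /csum (big_pred1 [tuple]) => [|g]; last first.
    by apply/esym/eqP; exact: tuple0.
  by rewrite !big_ord0 scale1r.
rewrite /c_U csum_xs; split=> [|q u hu].
  apply: (big_ind (U_homog false)) => [|u v hu hv|k _]; first exact: UH_zero.
    by rewrite -[u]scale1r; apply: UH_lin.
  by rewrite -(addbb (par k)); apply: U_homog_xs.
rewrite scale1r; apply: comm_homog hu => i j.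
by apply/esym/trace_xs_comm/FU_bracket.
Qed.

Definition c_ (r : nat) : ZN := MkZN (c_U_central r).

Definition b_ (r : nat) : ZN := c_ (2 * r - 1).

(* det (b_{i+j-1}) with i, j shifted to start at 0. *)
Definition Delta : ZN := \det (\matrix_(i < N, j < N) b_ (i + j).+1).

Inductive HC_null : UqN -> Prop :=
  | HC_nneg y u : vsval y \in nneg K N -> HC_null (iota y * u)
  | HC_npos u x : vsval x \in npos K N -> HC_null (u * iota x)
  | HC_0 : HC_null 0
  | HC_add u v : HC_null u -> HC_null v -> HC_null (u + v).

(* The substitution lambda_i = F_ii. *)
Definition at_F (f : mpoly.mpoly N K) : UqN :=
  mpoly.mmap (fun a : K => a%:A) (fun k => FU (pos k) (pos k)) f.

(* The polynomial congruent to z, whose existence and uniqueness are part of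
   the Harish-Chandra theorem; xget selects it. *)
Definition HC (z : ZN) : mpoly.mpoly N K :=
  xget 0 [set f | HC_null (val z - at_F f)]%classic.

Definition chi_ (lambda : 'I_N -> K) (z : ZN) : K := mpoly.meval lambda (HC z).

Definition strongly_typical (lambda : 'I_N -> K) : Prop :=
  forall i j, lambda i + lambda j != 0.

End EnvelopingAlgebra.

(* Main.v *)
(* The ordered monomials in the F_ij identify U(q_N) with the symmetric
   superalgebra S(q_N) up to terms of lower degree.  The leading part of an even
   central z is invariant under the adjoint action, so it is determined by its
   restriction to the diagonal variables, which is a symmetric polynomial.
   Hence HC is injective on even central elements, and HC(z) is symmetric up to
   lower degree.
   Modulo n_- U + U n_+ the partial sums of c_(2m+1) obey a recursion, by which
   the images b_m = HC(c_(2m+1)) are the moments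
     1 - Q(u) / P(u) = sum_m b_m u^(-m-1)
   of P(u) = prod_k (u - l_k (l_k - 1)) and Q(u) = prod_k (u - l_k (l_k + 1)),
   where l_k stands for lambda_k.  The Hankel determinant delta = HC(Delta) is
   therefore +- prod_k Q(l_k (l_k - 1)) = +- prod_(k, l) (l_k + l_l) (l_k - l_l - 1).
   By Cramer's rule and Newton's identities, any symmetric polynomial times some
   power of delta is a polynomial in b_0, .., b_(2N-1).  Descending on the degree,
   this makes HC(z) symmetric for every even central z and, by injectivity,
   Delta^k z a polynomial in c_1, c_3, .., c_(4N-1) for some k.  Odd central
   elements square to zero, so characters kill them. *)
Require Import Defs.
From HB Require Import structures.
From mathcomp Require Import all_boot all_order perm.
From mathcomp Require Import all_algebra.
From mathcomp Require Import boolp reals complex.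
From mathcomp Require Import ring zify.
From mathcomp Require Import mpoly.
From mathcomp Require monalg.
Import Defs.

Set Implicit Arguments.
Unset Strict Implicit.
Unset Printing Implicit Defensive.

Import GRing.Theory Num.Theory.
Local Open Scope ring_scope.

(** * The universal property of U(q_N) *)

(** The Harish-Chandra theorem is not presupposed: existence, uniqueness and injectivity of HC all
    rest on a basis of U(q_N), and its linear independence on the explicit action of U(q_N) on
    S(q_N). The image of HC is never determined. Symmetric polynomials become polynomials in the
    moments only after multiplication by a power of delta, so a character is controlled only where
    it does not kill Delta. The bound 2N comes from Cramer's rule: the Hankel matrix involves b_0,
    .., b_(2N-2), the right-hand side b_N, .., b_(2N-1). The leading part says nothing about the
    symmetry of the lower terms of HC(z). The descent subtracts the average of HC(z) over the
    symmetric group, which is known to be an image only up to a power of delta; hence it treats all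
    f such that some delta^k f is an image. The factors of delta come from l_k (l_k - 1) - l_l (l_l
    + 1) = (l_k + l_l) (l_k - l_l - 1). For k = l this is -2 l_k, the condition lambda_k <> 0 in
    strong typicality. *)

Section LinearEndomorphisms.
Variables (K : fieldType) (S : lmodType K).

(** Bundled endomorphisms of a possibly infinite-dimensional module, so that they form an algebra in
    which U(q_N) can be represented. Nontriviality depends on the module and is supplied for
    [spoly]. *)
Record lend := Lend { lend_fun :> S -> S; lend_linear : linear lend_fun }.

Lemma lendP (f g : lend) : (forall s, f s = g s) -> f = g.
Proof.
case: f g => [f hf] [g hg] /= /funext efg; rewrite -{}efg in hg *.
by congr Lend; exact: Prop_irrelevance.
Qed.

HB.instance Definition _ := gen_eqMixin lend.
HB.instance Definition _ := gen_choiceMixin lend.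

HB.instance Definition _ (f : lend) :=
  GRing.isLinear.Build K S S *:%R f (lend_linear f).

Fact lend_zero_linear : linear (fun _ : S => 0 : S).
Proof. by move=> a x y; rewrite scaler0 addr0. Qed.
Fact lend_one_linear : linear (@id S).
Proof. by []. Qed.
Fact lend_add_linear (f g : lend) : linear (fun s => f s + g s).
Proof. by move=> a x y; rewrite !linearP scalerDr addrACA. Qed.
Fact lend_opp_linear (f : lend) : linear (fun s => - f s).
Proof. by move=> a x y; rewrite linearP opprD scalerN. Qed.
Fact lend_mul_linear (f g : lend) : linear (fun s => f (g s)).
Proof. by move=> a x y; rewrite !linearP. Qed.
Fact lend_scale_linear (c : K) (f : lend) : linear (fun s => c *: f s).
Proof. by move=> a x y; rewrite linearP scalerDr !scalerA mulrC. Qed.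

Let zero := Lend lend_zero_linear.
Let one := Lend lend_one_linear.
Let add f g := Lend (lend_add_linear f g).
Let oppe f := Lend (lend_opp_linear f).
Let mul f g := Lend (lend_mul_linear f g).
Let scale c f := Lend (lend_scale_linear c f).

Fact lend_addA : associative add.
Proof. by move=> f g h; apply: lendP => s /=; rewrite addrA. Qed.
Fact lend_addC : commutative add.
Proof. by move=> f g; apply: lendP => s /=; rewrite addrC. Qed.
Fact lend_add0 : left_id zero add.
Proof. by move=> f; apply: lendP => s /=; rewrite add0r. Qed.
Fact lend_addN : left_inverse zero oppe add.
Proof. by move=> f; apply: lendP => s /=; rewrite addNr. Qed.

HB.instance Definition _ :=
  GRing.isZmodule.Build lend lend_addA lend_addC lend_add0 lend_addN.

Fact lend_mulA : associative mul.
Proof. by move=> f g h; apply: lendP. Qed.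
Fact lend_mul1 : left_id one mul.
Proof. by move=> f; apply: lendP. Qed.
Fact lend_mulr1 : right_id one mul.
Proof. by move=> f; apply: lendP. Qed.
Fact lend_mulDl : left_distributive mul +%R.
Proof. by move=> f g h; apply: lendP. Qed.
Fact lend_mulDr : right_distributive mul +%R.
Proof. by move=> f g h; apply: lendP => s /=; rewrite linearD. Qed.

HB.instance Definition _ := GRing.Zmodule_isPzRing.Build lend
  lend_mulA lend_mul1 lend_mulr1 lend_mulDl lend_mulDr.

Fact lend_scaleA a b f : scale a (scale b f) = scale (a * b) f.
Proof. by apply: lendP => s /=; rewrite scalerA. Qed.
Fact lend_scale1 : left_id 1 scale.
Proof. by move=> f; apply: lendP => s /=; rewrite scale1r. Qed.
Fact lend_scaleDr : right_distributive scale +%R.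
Proof. by move=> a f g; apply: lendP => s /=; rewrite scalerDr. Qed.
Fact lend_scaleDl f : {morph scale^~ f : a b / a + b}.
Proof. by move=> a b; apply: lendP => s /=; rewrite scalerDl. Qed.

HB.instance Definition _ := GRing.Zmodule_isLmodule.Build K lend
  lend_scaleA lend_scale1 lend_scaleDr lend_scaleDl.

Lemma lendD (f g : lend) s : (f + g) s = f s + g s. Proof. by []. Qed.
Lemma lendN (f : lend) s : (- f) s = - f s. Proof. by []. Qed.
Lemma lendM (f g : lend) s : (f * g) s = f (g s). Proof. by []. Qed.
Lemma lendZ c (f : lend) s : (c *: f) s = c *: f s. Proof. by []. Qed.
Lemma lend1 s : (1 : lend) s = s. Proof. by []. Qed.
Lemma lend0 s : (0 : lend) s = 0. Proof. by []. Qed.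
Lemma lend_sum I (r : seq I) (Q : pred I) (F : I -> lend) s :
  (\sum_(i <- r | Q i) F i) s = \sum_(i <- r | Q i) F i s.
Proof. by elim/big_rec2: _ => // i x f _ <-. Qed.

Fact lend_scalerAl a (f g : lend) : a *: (f * g) = (a *: f) * g.
Proof. by apply: lendP. Qed.
Fact lend_scalerAr a (f g : lend) : a *: (f * g) = f * (a *: g).
Proof. by apply: lendP => s; rewrite !(lendZ, lendM) linearZ. Qed.

End LinearEndomorphisms.

Section UniversalProperty.
Import monalg.
Variables (K : fieldType) (N : nat) (A : algType K).
Local Notation q_ := (subvs_of (qN K N)).
Variable rho : {linear q_ -> A}.
Hypothesis rho_bracket : forall p q x y z,
  gl_homog p (vsval x) -> gl_homog q (vsval y) ->
  vsval z = sbracket p q (vsval x) (vsval y) ->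
  rho x * rho y - (-1) ^+ (p && q) *: (rho y * rho x) = rho z.

Definition word_eval (w : monalg.fmonom q_) : A := \prod_(x <- w) rho x.

Fact word_eval_mmorphism : monalg.mmorphism word_eval.
Proof.
split=> [v w|]; rewrite /word_eval; first by rewrite monalg.fmM big_cat.
by rewrite monalg.fm1 big_nil.
Qed.

HB.instance Definition _ := monalg.isMultiplicative.Build
  (monalg.fmonom q_) A word_eval word_eval_mmorphism.

Local Notation T_ := (monalg.malg (monalg.fmonom q_) K).

Definition free_lift (u : T_) : A := monalg.mmap (in_alg A) word_eval u.

Lemma free_liftD u v : free_lift (u + v) = free_lift u + free_lift v.
Proof. exact: raddfD. Qed.
Lemma free_liftZ a u : free_lift (a *: u) = a *: free_lift u.
Proof. by rewrite /free_lift monalg.mmapZ /= mulr_algl. Qed.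
Lemma free_liftM u v : free_lift (u * v) = free_lift u * free_lift v.
Proof.
rewrite /free_lift (monalg.commr_mmap_is_multiplicative _).1 // => g m m'.
by rewrite /GRing.comm /= mulr_algl mulr_algr.
Qed.
Lemma free_lift1 : free_lift 1 = 1.
Proof. exact: monalg.mmap1. Qed.
Lemma free_lift_gen x : free_lift (gen x) = rho x.
Proof.
rewrite /free_lift /gen /free_gen -lock monalg.mmapU /= scale1r mul1r.
by rewrite /word_eval monalg.fmuE big_seq1.
Qed.

(** Opaque packaging: what follows uses only these five properties and never unfolds the monoid
    algebra. *)
Lemma free_lift_exists : {phi : T_ -> A |
  [/\ {morph phi : u v / u + v}, {morph phi : u v / u * v},
      forall a u, phi (a *: u) = a *: phi u, phi 1 = 1 &
      forall x, phi (gen x) = rho x]}.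
Proof.
exists free_lift; split; [exact: free_liftD | exact: free_liftM |
  exact: free_liftZ | exact: free_lift1 | exact: free_lift_gen].
Qed.

Lemma free_lift_ideal (phi := sval free_lift_exists) u : U_ideal u -> phi u = 0.
Proof.
rewrite {}/phi; case: free_lift_exists => phi /= [phiD phiM phiZ _ phi_gen].
have phi0 : phi 0 = 0 by rewrite -(scale0r 0) phiZ scale0r.
have phiN u' : phi (- u') = - phi u' by rewrite -scaleN1r phiZ scaleN1r.
elim=> {u} [a x y|p q x y z hx hy hz||u v _ IHu _ IHv|u v _ IHv|u v _ IHu].
- by rewrite phiD phiN phiD phiZ !phi_gen linearP subrr.
- apply: etrans (phiD _ _) _; rewrite phiN phi_gen.
  apply/eqP; rewrite subr_eq0 -(rho_bracket hx hy hz); apply/eqP.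
  rewrite [LHS]phiD [X in _ + X = _]phiN [phi (_ *: _)]phiZ.
  by rewrite -!phi_gen; congr (_ - _ *: _); exact: phiM.
- exact: phi0.
- by rewrite phiD IHu IHv addr0.
- by rewrite phiM IHv mulr0.
- by rewrite phiM IHu mul0r.
Qed.

Lemma U_lift_exists : {phi : UqN K N -> A |
  [/\ {morph phi : u v / u + v}, {morph phi : u v / u * v},
      forall a u, phi (a *: u) = a *: phi u, phi 1 = 1 &
      forall x, phi (Defs.iota x) = rho x]}.
Proof.
move: free_lift_ideal; case: free_lift_exists => phi /=.
move=> [phiD phiM phiZ phi1 phi_gen] phiI.
have phiN u : phi (- u) = - phi u by rewrite -scaleN1r phiZ scaleN1r.
pose psi (u : UqN K N) := phi (generic_quotient.repr u).
have psi_pi u : psi (U_pi u) = phi u.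
  apply/eqP; rewrite -subr_eq0 -phiN -phiD; apply/eqP/phiI/U_pi_eq.
  exact: U_piK.
exists psi; split.
- elim/U_pi_ind=> u; elim/U_pi_ind=> v.
  by rewrite -U_piD !psi_pi phiD.
- elim/U_pi_ind=> u; elim/U_pi_ind=> v.
  by rewrite -[U_pi u * _]U_piM !psi_pi phiM.
- move=> a; elim/U_pi_ind=> u.
  by rewrite -[a *: U_pi u]U_piZ !psi_pi phiZ.
- by rewrite -[1]U_pi1 psi_pi phi1.
- by move=> x; rewrite psi_pi phi_gen.
Qed.

End UniversalProperty.

(** * Presentation of U(q_N) by the generators F_ij *)

Section GeneratorsRelations.
Variables (K : fieldType) (N : nat) (A : algType K) (g : idx N -> idx N -> A).
Hypothesis g_opp : forall i j, g (opp i) (opp j) = g i j.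
Hypothesis g_bracket : forall i j k l,
  g i j * g k l
    - (-1) ^+ ((par i (+) par j) && (par k (+) par l)) *: (g k l * g i j)
  = DF g i j k l.

Definition mx_lift (M : 'M[K]_(N + N)) : A :=
  \sum_(k : 'I_N) \sum_(j : idx N) ent M (pos k) j *: g (pos k) j.

Fact mx_lift_linear : linear mx_lift.
Proof.
move=> a x y; rewrite /mx_lift scaler_sumr -big_split; apply: eq_bigr => k _.
rewrite scaler_sumr -big_split; apply: eq_bigr => j _.
by rewrite entD entZ scalerDl scalerA.
Qed.
HB.instance Definition _ :=
  GRing.isLinear.Build K 'M[K]_(N + N) A *:%R mx_lift mx_lift_linear.

Lemma mx_liftF i j : mx_lift (Fmx K i j) = g i j.
Proof.
rewrite /mx_lift.
under eq_bigr => k _ do under eq_bigr => l _ do rewrite entF scalerDl.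
have E (k : 'I_N) a b : \sum_(l : idx N) ((pos k == a) && (l == b))%:R *: g (pos k) l
    = (pos k == a)%:R *: g (pos k) b.
  case: (pos k == a); last first.
    by rewrite scale0r big1 // => l _; rewrite scale0r.
  by rewrite scale1r -[RHS](sum_delta (fun l => g (pos k) l)).
under eq_bigr => k _ do rewrite big_split /= !E.
rewrite big_split /=.
have E1 (k : 'I_N) (G : 'I_N -> A) :
    \sum_(l : 'I_N) (pos l == pos k)%:R *: G l = G k :> A.
  rewrite (bigD1 k) //= eqxx scale1r big1 ?addr0 // => l /negbTE lk.
  by rewrite (inj_eq _ l k) ?lk ?scale0r // => ? ? [].
case: i => i /=.
  rewrite (E1 i (fun k => g (pos k) j)) big1 ?addr0 // => k _.
  exact: scale0r.
rewrite big1 ?add0r => [|k _].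
  by rewrite (E1 i (fun k => g (pos k) (opp j))) -[RHS]g_opp.
exact: scale0r.
Qed.

Lemma bilin_expand (I J : finType) (V W : lmodType K) (op : V -> V -> W)
    (x : I -> K) (y : J -> K) (F : I -> V) (G : J -> V) :
  (forall b, linear (op^~ b)) -> (forall a, linear (op a)) ->
  op (\sum_i x i *: F i) (\sum_j y j *: G j)
  = \sum_i \sum_j (x i * y j) *: op (F i) (G j).
Proof.
move=> opl opr.
have opl0 b : op 0 b = 0.
  by apply: (addrI (op 0 b)); rewrite -[X in X + _]scale1r -opl scaler0 !addr0.
have opr0 a : op a 0 = 0.
  by apply: (addrI (op a 0)); rewrite -[X in X + _]scale1r -opr scaler0 !addr0.
have oplD b : {morph op^~ b : u v / u + v}.
  by move=> u v; have := opl b 1 u v; rewrite !scale1r.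
have oprD a : {morph op a : u v / u + v}.
  by move=> u v; have := opr a 1 u v; rewrite !scale1r.
rewrite (big_morph _ (oplD _) (opl0 _)); apply: eq_bigr => i _.
rewrite (big_morph _ (oprD _) (opr0 _)); apply: eq_bigr => j _.
have := opl (G j) (x i) (F i) 0; rewrite opl0 !addr0 => oplj.
by have := opr (x i *: F i) (y j) (G j) 0; rewrite opr0 !addr0 oplj scalerA mulrC.
Qed.

Lemma mx_lift_bracket p q x y :
  x \in qN K N -> y \in qN K N -> gl_homog p x -> gl_homog q y ->
  mx_lift x * mx_lift y - (-1) ^+ (p && q) *: (mx_lift y * mx_lift x)
  = mx_lift (sbracket p q x y).
Proof.
move=> /mem_qN /sym_expand xE /mem_qN /sym_expand yE hx hy.
rewrite pair_big /= in xE; rewrite pair_big /= in yE.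
pose F (i : 'I_N * idx N) := Fmx K (pos i.1) i.2.
pose X i := ent x (pos (i : 'I_N * idx N).1) i.2.
pose Y i := ent y (pos (i : 'I_N * idx N).1) i.2.
have {}xE : x = \sum_i X i *: F i by [].
have {}yE : y = \sum_i Y i *: F i by [].
have E := bilin_expand X Y F F.
have -> : mx_lift x * mx_lift y =
    \sum_i \sum_j (X i * Y j) *: (mx_lift (F i) * mx_lift (F j)).
  rewrite {1}xE yE (E _ (fun a b => mx_lift a * mx_lift b)) // => [b|a] c u v.
    by rewrite linearP mulrDl scalerAl.
  by rewrite linearP mulrDr scalerAr.
have -> : mx_lift y * mx_lift x =
    \sum_i \sum_j (X i * Y j) *: (mx_lift (F j) * mx_lift (F i)).
  rewrite {1}xE yE (E _ (fun a b => mx_lift b * mx_lift a)) // => [b|a] c u v.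
    by rewrite linearP mulrDr scalerAr.
  by rewrite linearP mulrDl scalerAl.
have -> : mx_lift (sbracket p q x y) =
    \sum_i \sum_j (X i * Y j) *: mx_lift (sbracket p q (F i) (F j)).
  rewrite {1}xE {1}yE (E _ (fun a b => mx_lift (sbracket p q a b))) //.
    move=> b c u v; rewrite /sbracket mulmxDl mulmxDr -scalemxAl -scalemxAr.
    by rewrite -mx_lift_linear; congr mx_lift; apply/matrixP => i j; rewrite !mxE; ring.
  move=> a c u v; rewrite /sbracket mulmxDl mulmxDr -scalemxAl -scalemxAr.
  by rewrite -mx_lift_linear; congr mx_lift; apply/matrixP => i j; rewrite !mxE; ring.
rewrite scaler_sumr -sumrB; apply: eq_bigr => i _.
rewrite scaler_sumr -sumrB; apply: eq_bigr => j _.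
rewrite scalerA [_ * (X i * _)]mulrC -[(_ * _ * _) *: _]scalerA -scalerBr.
(* A nonzero coefficient of the homogeneous element x forces the parity of [F i] to be p, and
   likewise for y; only then is the sign the one of [g_bracket]. All other terms vanish. *)
have [->|/hx px] := eqVneq (X i) 0; first by rewrite mul0r !scale0r.
have [->|/hy py] := eqVneq (Y j) 0; first by rewrite mulr0 !scale0r.
congr (_ *: _); rewrite /F !mx_liftF -px -py g_bracket sbracketF /DF.
by rewrite lin_comb /= !mx_liftF.
Qed.

Lemma U_rep_exists : {phi : UqN K N -> A |
  [/\ {morph phi : u v / u + v}, {morph phi : u v / u * v},
      forall a u, phi (a *: u) = a *: phi u, phi 1 = 1 &
      forall i j, phi (FU K i j) = g i j]}.
Proof.
pose rho (x : subvs_of (qN K N)) := mx_lift (vsval x).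
have rho_lin : linear rho by move=> a x y; rewrite /rho !linearP.
pose rho' : {linear subvs_of (qN K N) -> A} :=
  HB.pack rho (GRing.isLinear.Build _ _ _ _ rho rho_lin).
have [|phi [pD pM pZ p1 pi]] := @U_lift_exists K N A rho'.
  move=> p q x y z hx hy zE; rewrite /= /rho zE.
  by apply: mx_lift_bracket => //; apply: subvsP.
exists phi; split=> // i j; rewrite pi /= /rho /=; exact: mx_liftF.
Qed.

End GeneratorsRelations.

(** * Super polynomials and the action of U(q_N) on them *)

Section SuperWeylRelations.
Variables (K : fieldType) (N : nat) (A : algType K).
Local Notation I2 := (idx N * idx N)%type.
Variables z d : I2 -> A.

Definition par2 (s : I2) : bool := par s.1 (+) par s.2.
Definition opp2 (s : I2) : I2 := (opp s.1, opp s.2).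
Local Notation sg p q := ((-1) ^+ (p && q) : K).
(** The pairing of d_s with z_t. Since F_(-i,-j) = F_ij, both s and [opp2 s] name the same variable;
    the two summands are never both 1. *)
Definition delta2 (s t : I2) : K := (s == t)%:R + (s == opp2 t)%:R.

Hypothesis z_opp : forall s, z (opp2 s) = z s.
Hypothesis d_opp : forall s, d (opp2 s) = d s.
Hypothesis zz : forall s t, z s * z t = sg (par2 s) (par2 t) *: (z t * z s).
Hypothesis dd : forall s t, d s * d t = sg (par2 s) (par2 t) *: (d t * d s).
Hypothesis dz : forall s t,
  d s * z t = sg (par2 s) (par2 t) *: (z t * d s) + (delta2 s t)%:A.

Lemma sgK p q : sg p q * sg p q = 1.
Proof. by rewrite -expr2 sqrr_sign. Qed.
Lemma sgC p q : sg p q = sg q p.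
Proof. by rewrite andbC. Qed.
Lemma sgDl p q r : sg (p (+) q) r = sg p r * sg q r.
Proof. by rewrite -signr_addb andb_addl. Qed.
Lemma sgDr p q r : sg r (p (+) q) = sg r p * sg r q.
Proof. by rewrite -signr_addb andb_addr. Qed.
Lemma delta2C s t : delta2 s t = delta2 t s.
Proof.
rewrite /delta2 eq_sym; congr (_ + _%:R).
by case: s t => [i j] [k l]; rewrite /opp2 /= !xpair_eqE [k == opp i]eq_sym [l == opp j]eq_sym !eq_opp.
Qed.

(** z_s d_t acts as a derivation taking z_t to z_s, of parity par2 s + par2 t; [zd_d] is the dual
    action on the d_u. *)
Lemma zd_z s t u : z s * d t * z u
  = sg (par2 s (+) par2 t) (par2 u) *: (z u * (z s * d t)) + delta2 t u *: z s.
Proof.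
rewrite -mulrA dz mulrDr -scalerAr mulr_algr [z s * (z u * _)]mulrA zz -scalerAl scalerA.
by congr (_ *: _ + _); [rewrite sgDl mulrC | rewrite mulrA].
Qed.

Lemma zd_d s t u : z s * d t * d u
  = sg (par2 s (+) par2 t) (par2 u) *: (d u * (z s * d t) - delta2 u s *: d t).
Proof.
rewrite (_ : _ - _ = sg (par2 u) (par2 s) *: (z s * (d u * d t))); last first.
  by rewrite mulrA dz mulrDl -scalerAl mulr_algl addrK mulrA.
rewrite -mulrA dd -scalerAr scalerA; congr (_ *: _).
by rewrite sgDl [sg (par2 u) _]sgC mulrAC sgK mul1r.
Qed.



Lemma sg_delta2 s t q :
  sg (par2 t) q * delta2 s t = sg (par2 s) q * delta2 s t.
Proof.
rewrite /delta2; case: eqP => [->//|_]; case: eqP => [->|]; rewrite ?addr0 ?mulr0 //.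
by rewrite /par2 /opp2 /= !par_opp addNb addbN negbK.
Qed.

(* q_N is the super commutator algebra of the associative superalgebra of the
   matrices spanned by the F_ij, so left multiplication in the latter is a
   representation of q_N on itself and extends to derivations [left_der] of
   S(q_N).  Adding the multiplication operators z again gives a representation,
   with which the analogous [right_rep] supercommutes. *)
Definition left_der (i j : idx N) : A := \sum_c z (i, c) * d (j, c).
Definition left_rep i j : A := z (i, j) + left_der i j.
(** The derivation acts from the left although it multiplies F_ci by F_ij on the right; the sign is
    that of moving F_ij past F_ci. *)
Definition right_der (i j : idx N) : A :=
  \sum_c sg (par c (+) par i) (par i (+) par j) *: (z (c, j) * d (c, i)).
Definition right_rep i j : A := z (i, j) + right_der i j.

Lemma left_derE i j : \sum_c z (opp i, c) * d (j, c) = left_der i (opp j).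
Proof.
rewrite /left_der [RHS](reindex_inj (inv_inj (@oppK N))); apply: eq_bigr => c _.
by rewrite -(z_opp (i, _)) -(d_opp (_ j, _)) /opp2 /= !oppK.
Qed.

Lemma left_rep_opp i j : left_rep (opp i) (opp j) = left_rep i j.
Proof.
by rewrite /left_rep -(z_opp (i, j)) {1}/left_der left_derE oppK.
Qed.

Lemma sum_delta2 (V : lmodType K) (G : idx N -> V) (a b c : idx N) :
  \sum_x delta2 (a, x) (b, c) *: G x = (a == b)%:R *: G c + (opp a == b)%:R *: G (opp c).
Proof.
under eq_bigr => x _ do rewrite /delta2 /opp2 /= !xpair_eqE scalerDl.
have E (p : bool) e : \sum_x (p && (x == e))%:R *: G x = p%:R *: G e.
  case: p; rewrite ?scale0r ?scale1r /=; last first.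
    by rewrite big1 // => x _; rewrite scale0r.
  by rewrite (bigD1 e) //= eqxx scale1r big1 ?addr0 // => x /negbTE ->; rewrite scale0r.
by rewrite big_split /= !E eq_opp.
Qed.

Lemma left_der_z i j k l : left_der i j * z (k, l)
  = sg (par i (+) par j) (par k (+) par l) *: (z (k, l) * left_der i j)
    + ((j == k)%:R *: z (i, l) + (opp j == k)%:R *: z (opp i, l)).
Proof.
rewrite /left_der mulr_suml mulr_sumr scaler_sumr -(z_opp (_ i, _)) /opp2 /= oppK.
rewrite -(sum_delta2 (fun c => z (i, c))) -big_split; apply: eq_bigr => c _.
rewrite zd_z; congr (sg _ _ *: _ + _).
by rewrite /par2 /= addbACA addbb addbF.
Qed.

Lemma right_der_z i j k l : right_der i j * z (k, l)
  = sg (par i (+) par j) (par k (+) par l) *: (z (k, l) * right_der i j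
    + ((i == l)%:R *: z (k, j) + (opp i == l)%:R *: z (opp k, j))).
Proof.
rewrite /right_der mulr_suml mulr_sumr.
have -> : (i == l)%:R *: z (k, j) + (opp i == l)%:R *: z (opp k, j)
    = \sum_c delta2 (c, i) (k, l) *: z (c, j).
  rewrite -(sum_delta2 (fun c => z (c, j)) i l k); apply: eq_bigr => c _.
  by rewrite /delta2 /opp2 /= !xpair_eqE ![(c == _) && _]andbC.
rewrite -big_split scaler_sumr; apply: eq_bigr => c _ /=.
rewrite -scalerAl zd_z scalerDr scalerDr -scalerAr !scalerA.
congr (_ *: _ + _ *: _).
  by rewrite /par2 /= addbACA addbb addFb [par j (+) _]addbC mulrC.
by rewrite [in RHS]sgC -[par k (+) par l]/(par2 (k, l)) sg_delta2.
Qed.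

Lemma left_der_d i j k l : left_der i j * d (k, l)
  = sg (par i (+) par j) (par k (+) par l) *: (d (k, l) * left_der i j
    - ((i == k)%:R *: d (j, l) + (opp i == k)%:R *: d (j, opp l))).
Proof.
rewrite -(sum_delta2 (fun c => d (j, c))) /left_der mulr_suml mulr_sumr.
rewrite -sumrB scaler_sumr; apply: eq_bigr => c _.
rewrite zd_d [delta2 (k, l) _]delta2C; congr (sg _ _ *: _).
by rewrite /par2 /= addbACA addbb addbF.
Qed.

Lemma left_der_left_der i j k l : left_der i j * left_der k l
  = sg (par i (+) par j) (par k (+) par l) *: (left_der k l * left_der i j)
    + ((j == k)%:R *: left_der i l + (opp j == k)%:R *: left_der (opp i) l)
    - sg (par i (+) par j) (par k (+) par l) *:
      ((i == l)%:R *: left_der k j + (opp i == l)%:R *: left_der k (opp j)).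
Proof.
have E c : left_der i j * (z (k, c) * d (l, c))
  = sg (par i (+) par j) (par k (+) par l) *: (z (k, c) * d (l, c) * left_der i j)
    + ((j == k)%:R *: (z (i, c) * d (l, c))
       + (opp j == k)%:R *: (z (opp i, c) * d (l, c)))
    - sg (par i (+) par j) (par k (+) par l) *:
      ((i == l)%:R *: (z (k, c) * d (j, c))
       + (opp i == l)%:R *: (z (k, c) * d (opp j, c))).
  rewrite mulrA left_der_z mulrDl -scalerAl -[z (k, c) * _ * d _]mulrA.
  rewrite left_der_d -scalerAr scalerA -sgDr addbACA addbb addbF mulrDl -!scalerAl.
  rewrite -[d (opp j, c)]d_opp /opp2 /= oppK !mulrBr !mulrDr -!scalerAr scalerBr.
  by rewrite mulrA addrAC.
rewrite {2}/left_der mulr_sumr (eq_bigr _ (fun c _ => E c)) sumrB big_split /=.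
rewrite -!scaler_sumr -mulr_suml !big_split /= -!scaler_sumr.
by [].
Qed.

(** Associativity: left and right multiplications supercommute, hence so do the derivations
    extending them. In coordinates, the correction from moving [left_der] past z cancels the one
    from moving it past d. *)
Lemma left_der_right_der i j k l : left_der i j * right_der k l
  = sg (par i (+) par j) (par k (+) par l) *: (right_der k l * left_der i j).
Proof.
pose x := sg (par i (+) par j) (par k (+) par l).
pose y (c : idx N) := sg (par c (+) par k) (par k (+) par l).
have E c : left_der i j * (y c *: (z (c, l) * d (c, k)))
  = x *: (y c *: (z (c, l) * d (c, k)) * left_der i j)
    + ((c == j)%:R *: (y c *: (z (i, l) * d (c, k)))
       + (c == opp j)%:R *: (y c *: (z (opp i, l) * d (c, k))))
    - x *: ((c == i)%:R *: (y c *: (z (c, l) * d (j, k)))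
       + (c == opp i)%:R *: (y c *: (z (c, l) * d (opp j, k)))).
  rewrite -scalerAr mulrA left_der_z mulrDl -scalerAl -[z (c, l) * _ * d _]mulrA.
  rewrite left_der_d -scalerAr.
  rewrite [(-1) ^+ _ *: ((-1) ^+ _ *: _)]scalerA -sgDr addbACA addbb addFb.
  rewrite [par l (+) par k]addbC -/x mulrDl -!scalerAl.
  rewrite -[d (opp j, k)]d_opp /opp2 /= oppK mulrBr !mulrDr -!scalerAr.
  rewrite !scalerBr !scalerDr !scalerA mulrA.
  rewrite [j == c]eq_sym [opp j == c]eq_sym [i == c]eq_sym [opp i == c]eq_sym.
  rewrite addrAC scalerN scalerDr !scalerA.
  by congr (_ *: _ + (_ *: _ + _ *: _) - (_ *: _ + _ *: _)); ring.
rewrite {1}/right_der mulr_sumr (eq_bigr _ (fun c _ => E c)) sumrB big_split /=.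
rewrite -!scaler_sumr -mulr_suml !big_split /= !sum_delta -/x.
rewrite -[RHS]addr0 -addrA; congr (_ + _); apply/eqP; rewrite subr_eq0; apply/eqP.
rewrite !scalerDr !scalerA /x /y -!sgDl addbACA addbb.
have -> : d (opp j, k) = d (j, opp k) by rewrite -d_opp /opp2 /= oppK.
congr (sg _ _ *: _ + sg _ _ *: _).
by rewrite !par_opp; case: (par i) (par j) (par k) => [] [] [].
Qed.

Lemma subaDl (a b : A) : a - (a + b) = - b.
Proof. by rewrite opprD addrA subrr add0r. Qed.
Lemma adda_subK (a b c : A) : a + b - c - a = b - c.
Proof. by rewrite (ACl ((1*4)*(2*3))) /= subrr add0r. Qed.

Lemma scomm_add (x : K) (a b a' b' : A) :
  (a + b) * (a' + b') - x *: ((a' + b') * (a + b))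
  = (a * a' - x *: (a' * a)) + ((b * a' - x *: (a' * b)) + (a * b' - x *: (b' * a)))
    + (b * b' - x *: (b' * b)).
Proof.
rewrite !mulrDl !mulrDr !scalerDr !opprD.
by rewrite [LHS](AC (2*2*(2*2)) (1*5*(3*6*(2*7))*(4*8))).
Qed.

(** Write z_x + L_x for the operator of x. The z's supercommute and the L's satisfy the bracket
    relations. The cross terms are z_(xy), from L_x acting on z_y, and -+ z_(yx), from L_y acting on
    z_x; together they are z of the superbracket. *)
Lemma left_rep_bracket i j k l :
  left_rep i j * left_rep k l
    - sg (par i (+) par j) (par k (+) par l) *: (left_rep k l * left_rep i j)
  = DF left_rep i j k l.
Proof.
set x := sg _ _.
have zo : z (opp k, j) = z (k, opp j) by rewrite -z_opp /opp2 /= oppK.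
rewrite /left_rep scomm_add zz [par2 _]/par2 [par2 _]/par2 -/x subrr add0r.
rewrite left_der_z -/x [x *: _ + _]addrC addrK left_der_z.
rewrite [sg (par k (+) par l) _]sgC -/x scalerDr scalerA sgK scale1r subaDl.
rewrite left_der_left_der -/x adda_subK zo.
rewrite /DF -/x ![i == l]eq_sym (eq_opp i) [i == opp l]eq_sym !scalerDr.
by rewrite !opprD [LHS](AC (2*2*(2*2)) (1*5*(2*6)*(3*7*(4*8)))).
Qed.

(** Here both cross terms are z_(xy), once from left multiplication of y by x and once from right
    multiplication of x by y, with opposite signs. *)
Lemma left_rep_right_rep i j k l : left_rep i j * right_rep k l
  = sg (par i (+) par j) (par k (+) par l) *: (right_rep k l * left_rep i j).
Proof.
set x := sg _ _; apply/eqP; rewrite -subr_eq0 /left_rep /right_rep scomm_add; apply/eqP.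
rewrite zz [par2 _]/par2 [par2 _]/par2 -/x subrr add0r left_der_right_der -/x subrr addr0.
rewrite left_der_z -/x [x *: _ + _]addrC addrK right_der_z.
rewrite [sg (par k (+) par l) _]sgC -/x scalerA sgK scale1r opprD addNKr.
by rewrite [k == j]eq_sym [opp k == j]eq_sym -eq_opp subrr.
Qed.

End SuperWeylRelations.

(** * Polynomials in even and odd variables, with their multiplication and derivation operators *)

Section SuperPolynomials.
Variables (K : fieldType) (P : finType) (key : P -> nat).
Hypothesis key_inj : injective key.
Local Notation pol := {mpoly K[#|P|]}.

(* Polynomials in even variables x_t and odd variables xi_t, t in P: the
   component of s at B is the coefficient of the product of the xi_t, t in B,
   taken in the order of [key]. *)
Definition spoly : Type := {ffun {set P} -> pol}.
HB.instance Definition _ := GRing.Lmodule.on spoly.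

Lemma spolyP (s t : spoly) : (forall B, s B = t B) -> s = t.
Proof. by move=> e; apply/ffunP. Qed.

Definition sone : spoly := [ffun B => (B == set0)%:R].

Lemma spolyDE (s t : spoly) B : (s + t) B = s B + t B.
Proof. by rewrite ffunE. Qed.
Lemma spolyZE a (s : spoly) B : (a *: s) B = a *: s B.
Proof. by rewrite ffunE. Qed.
Lemma spoly0E B : (0 : spoly) B = 0.
Proof. by rewrite ffunE. Qed.
Lemma spolyNE (s : spoly) B : (- s) B = - s B.
Proof. by rewrite ffunE. Qed.
Lemma spolyBE (s t : spoly) B : (s - t) B = s B - t B.
Proof. by rewrite !ffunE. Qed.
Lemma spoly_sumE I (r : seq I) (Q : pred I) (F : I -> spoly) B :
  (\sum_(i <- r | Q i) F i) B = \sum_(i <- r | Q i) F i B.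
Proof. by elim/big_rec2: _ => [|i x f _ <-]; rewrite ?spoly0E ?spolyDE. Qed.

Fact spoly_lend_neq0 : (1 : lend spoly) != 0.
Proof.
apply/eqP => /(congr1 (fun f : lend spoly => f sone set0)).
by rewrite lend1 lend0 ffunE spoly0E eqxx => /eqP; rewrite oner_eq0.
Qed.
HB.instance Definition _ := GRing.PzSemiRing_isNonZero.Build (lend spoly)
  spoly_lend_neq0.
HB.instance Definition _ := GRing.Lmodule_isLalgebra.Build K (lend spoly)
  (@lend_scalerAl K spoly).
HB.instance Definition _ := GRing.Lalgebra_isAlgebra.Build K (lend spoly)
  (@lend_scalerAr K spoly).

Definition xvar (t : P) : pol := 'X_(enum_rank t).

Fact ev_mul_linear t : linear (fun s : spoly => [ffun B => xvar t * s B] : spoly).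
Proof.
by move=> a x y; apply: spolyP => B; rewrite !ffunE mulrDr scalerAr.
Qed.
Definition ev_mul t : lend spoly := Lend (ev_mul_linear t).

Fact ev_der_linear t :
  linear (fun s : spoly => [ffun B => (s B)^`M(enum_rank t)] : spoly).
Proof. by move=> a x y; apply: spolyP => B; rewrite !ffunE linearP. Qed.
Definition ev_der t : lend spoly := Lend (ev_der_linear t).

(* The sign of moving xi_t past the smaller variables of B. *)
Definition koszul (t : P) (B : {set P}) : K :=
  (-1) ^+ #|[set u in B | (key u < key t)%N]|.

Fact odd_mul_linear t : linear (fun s : spoly =>
  [ffun B : {set P} => if t \in B then koszul t B *: s (B :\ t) else 0] : spoly).
Proof.
move=> a x y; apply: spolyP => B; rewrite !ffunE.
by case: ifP; rewrite ?scaler0 ?addr0 // scalerDr !scalerA mulrC.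
Qed.
Definition odd_mul t : lend spoly := Lend (odd_mul_linear t).

Fact odd_der_linear t : linear (fun s : spoly =>
  [ffun B : {set P} => if t \in B then 0 else koszul t B *: s (t |: B)] : spoly).
Proof.
move=> a x y; apply: spolyP => B; rewrite !ffunE.
by case: ifP; rewrite ?scaler0 ?addr0 // scalerDr !scalerA mulrC.
Qed.
Definition odd_der t : lend spoly := Lend (odd_der_linear t).

Lemma ev_mulE t s B : ev_mul t s B = xvar t * s B.
Proof. by rewrite ffunE. Qed.
Lemma ev_derE t s B : ev_der t s B = (s B)^`M(enum_rank t).
Proof. by rewrite ffunE. Qed.
Lemma odd_mulE t s B :
  odd_mul t s B = if t \in B then koszul t B *: s (B :\ t) else 0.
Proof. by rewrite ffunE. Qed.
Lemma odd_derE t s B :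
  odd_der t s B = if t \in B then 0 else koszul t B *: s (t |: B).
Proof. by rewrite ffunE. Qed.

Lemma koszulK t B : koszul t B * koszul t B = 1.
Proof. by rewrite /koszul -expr2 sqrr_sign. Qed.

Lemma koszulU t u (B : {set P}) : u \notin B ->
  koszul t (u |: B) = (-1) ^+ (key u < key t)%N * koszul t B.
Proof.
move=> uB; rewrite /koszul -exprD; congr (_ ^+ _).
rewrite (cardsD1 u) inE setU11 /=; congr (_ + _)%N.
apply: eq_card => v; rewrite !inE; case: eqP => [->|_] //=.
by rewrite (negbTE uB).
Qed.

Lemma koszulD t u (B : {set P}) : u \in B ->
  koszul t (B :\ u) = (-1) ^+ (key u < key t)%N * koszul t B.
Proof.
move=> uB; rewrite -{2}(setD1K uB) koszulU ?setD11 // mulrA -expr2 sqrr_sign.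
by rewrite mul1r.
Qed.

(** Of two distinct odd variables exactly one has to pass the other; this is where the minus sign in
    the anticommutation relations comes from. *)
Lemma key_lt_sign t u : t != u ->
  (-1) ^+ (key t < key u)%N = - (-1) ^+ (key u < key t)%N :> K.
Proof.
move=> tu; case: (ltngtP (key t) (key u)) => [_|_|/key_inj/eqP]; rewrite ?(negbTE tu) //.
by rewrite expr0 expr1 opprK.
Qed.

Lemma odd_mul_mul t u : odd_mul t * odd_mul u = - (odd_mul u * odd_mul t).
Proof.
apply: lendP => s; apply: spolyP => B; rewrite lendN spolyNE !lendM !odd_mulE.
rewrite !inE.
case: (eqVneq t u) => [->|tu /=]; first by case: ifP; rewrite ?scaler0 oppr0.
case: (boolP (t \in B)) => tB; case: (boolP (u \in B)) => uB //=;
  rewrite ?scaler0 ?oppr0 //.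
rewrite !scalerA koszulD // koszulD // (key_lt_sign tu) -scaleNr.
rewrite (_ : B :\ t :\ u = B :\ u :\ t); last by apply/setP => v; rewrite !inE andbCA.
by congr (_ *: _); ring.
Qed.

Lemma odd_der_der t u : odd_der t * odd_der u = - (odd_der u * odd_der t).
Proof.
apply: lendP => s; apply: spolyP => B; rewrite lendN spolyNE !lendM !odd_derE.
rewrite !inE.
case: (eqVneq t u) => [->|tu /=]; first by case: ifP; rewrite ?scaler0 oppr0.
case: (boolP (t \in B)) => tB; case: (boolP (u \in B)) => uB //=;
  rewrite ?scaler0 ?oppr0 //.
rewrite !scalerA koszulU // koszulU // (key_lt_sign tu) -scaleNr setUCA.
by congr (_ *: _); ring.
Qed.

Lemma odd_der_mul t u :
  odd_der t * odd_mul u = - (odd_mul u * odd_der t) + (t == u)%:R%:A.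
Proof.
apply: lendP => s; apply: spolyP => B.
rewrite lendD lendN lendZ lend1 spolyDE spolyNE spolyZE !lendM !odd_derE !odd_mulE.
rewrite odd_derE !inE.
case: (eqVneq t u) => [<-|tu] /=.
  case: (boolP (t \in B)) => tB /=.
    by rewrite setD1K // koszulD // ltnn mul1r scalerA koszulK !scale1r addNr.
  by rewrite koszulU // ltnn mul1r scalerA koszulK setU1K // oppr0 add0r.
rewrite scale0r addr0.
case: (boolP (t \in B)) => tB; case: (boolP (u \in B)) => uB //=;
  rewrite ?scaler0 ?oppr0 //.
rewrite !scalerA koszulU // koszulD // (key_lt_sign tu) -scaleNr.
have -> : (t |: B) :\ u = t |: B :\ u.
  by apply/setP => v; rewrite !inE; case: (eqVneq v t) => // ->; rewrite tu.
by congr (_ *: _); ring.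
Qed.

Lemma ev_mul_mul t u : ev_mul t * ev_mul u = ev_mul u * ev_mul t.
Proof. by apply: lendP => s; apply: spolyP => B; rewrite !lendM !ev_mulE mulrCA. Qed.

Lemma ev_der_der t u : ev_der t * ev_der u = ev_der u * ev_der t.
Proof.
by apply: lendP => s; apply: spolyP => B; rewrite !lendM !ev_derE mderiv_comm.
Qed.

Lemma ev_der_mul t u : ev_der t * ev_mul u = ev_mul u * ev_der t + (t == u)%:R%:A.
Proof.
apply: lendP => s; apply: spolyP => B.
rewrite lendD lendZ lend1 spolyDE spolyZE !lendM !(ev_derE, ev_mulE) mderivM addrC.
congr (_ + _); rewrite /xvar mderivX mnmE (inj_eq enum_rank_inj) [u == t]eq_sym.
case: eqP => [->|_]; last by rewrite !scale0r mul0r.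
rewrite (_ : (_ - _)%MM = 0%MM) ?mpolyX0 ?scale1r ?mul1r //.
by apply/mnmP => i; rewrite mnmBE subnn mnm0E.
Qed.

Lemma ev_odd_mul_mul t u : ev_mul t * odd_mul u = odd_mul u * ev_mul t.
Proof.
apply: lendP => s; apply: spolyP => B; rewrite !lendM !(ev_mulE, odd_mulE).
by case: ifP; rewrite ?mulr0 // scalerAr.
Qed.
Lemma ev_odd_mul_der t u : ev_mul t * odd_der u = odd_der u * ev_mul t.
Proof.
apply: lendP => s; apply: spolyP => B; rewrite !lendM !(ev_mulE, odd_derE).
by case: ifP; rewrite ?mulr0 // scalerAr.
Qed.
Lemma ev_odd_der_mul t u : ev_der t * odd_mul u = odd_mul u * ev_der t.
Proof.
apply: lendP => s; apply: spolyP => B; rewrite !lendM !(ev_derE, odd_mulE).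
by case: ifP; rewrite ?mderiv0 // mderivZ.
Qed.
Lemma ev_odd_der_der t u : ev_der t * odd_der u = odd_der u * ev_der t.
Proof.
apply: lendP => s; apply: spolyP => B; rewrite !lendM !(ev_derE, odd_derE).
by case: ifP; rewrite ?mderiv0 // mderivZ.
Qed.

End SuperPolynomials.

Arguments sone {K P}.
Arguments ev_mul {K P} t.
Arguments ev_der {K P} t.
Arguments odd_mul {K P} key t.
Arguments odd_der {K P} key t.

Section SymmetricAlgebraOfQ.
Variables (K : fieldType) (N : nat) (key : ('I_N * 'I_N)%type -> nat).
Hypothesis key_inj : injective key.
Local Notation I2 := (idx N * idx N)%type.
Local Notation P := ('I_N * 'I_N)%type.
Local Notation S := (spoly K P).

Definition absi (i : idx N) : 'I_N := match i with inl k => k | inr k => k end.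
Definition abs2 (s : I2) : P := (absi s.1, absi s.2).

Definition zvar (s : I2) : lend S :=
  if par2 s then odd_mul key (abs2 s) else ev_mul (abs2 s).
Definition dvar (s : I2) : lend S :=
  if par2 s then odd_der key (abs2 s) else ev_der (abs2 s).

Lemma abs2_opp s : abs2 (opp2 s) = abs2 s.
Proof. by case: s => [[i|i] [j|j]]. Qed.
Lemma par2_opp (s : I2) : par2 (opp2 s) = par2 s.
Proof. by case: s => [[i|i] [j|j]]. Qed.

Lemma zvar_opp s : zvar (opp2 s) = zvar s.
Proof. by rewrite /zvar abs2_opp par2_opp. Qed.
Lemma dvar_opp s : dvar (opp2 s) = dvar s.
Proof. by rewrite /dvar abs2_opp par2_opp. Qed.

(** Parity and absolute values form a complete invariant of an index pair up to [opp2], so they name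
    the variable of F_s without redundancy. *)
Lemma delta2_abs s t : delta2 K s t = ((par2 s == par2 t) && (abs2 s == abs2 t))%:R.
Proof.
case: s t => [[i|i] [j|j]] [[k|k] [l|l]]; rewrite /delta2 /opp2 /abs2 /par2 /= !xpair_eqE /=;
  by rewrite ?andbF ?addr0 ?add0r.
Qed.

Lemma zvarM s t :
  zvar s * zvar t = (-1) ^+ (par2 s && par2 t) *: (zvar t * zvar s) :> lend S.
Proof.
rewrite /zvar; case: (par2 s); case: (par2 t); rewrite ?scale1r.
- by rewrite scaleN1r odd_mul_mul.
- by rewrite ev_odd_mul_mul.
- by rewrite ev_odd_mul_mul.
- by rewrite ev_mul_mul.
Qed.
Lemma dvarM s t :
  dvar s * dvar t = (-1) ^+ (par2 s && par2 t) *: (dvar t * dvar s) :> lend S.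
Proof.
rewrite /dvar; case: (par2 s); case: (par2 t); rewrite ?scale1r.
- by rewrite scaleN1r odd_der_der.
- by rewrite ev_odd_der_der.
- by rewrite ev_odd_der_der.
- by rewrite ev_der_der.
Qed.
Lemma dvar_zvar s t : dvar s * zvar t
  = (-1) ^+ (par2 s && par2 t) *: (zvar t * dvar s) + (delta2 K s t)%:A :> lend S.
Proof.
rewrite delta2_abs /dvar /zvar; case: (par2 s); case: (par2 t);
  rewrite ?scale1r ?scaleN1r ?scale0r ?addr0 //=.
- by rewrite odd_der_mul.
- by rewrite ev_odd_mul_der.
- by rewrite ev_odd_der_mul.
- by rewrite ev_der_mul.
Qed.

End SymmetricAlgebraOfQ.

(** * Filtration by total degree *)

Section Degrees.
Variables (K : fieldType) (P : finType) (key : P -> nat).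
Local Notation S := (spoly K P).

(** Odd variables have degree 1. With a strict bound, d = 0 leaves only the zero polynomial
    ([deg_lt0P]), which is where the descents on the degree end. *)
Definition deg_lt (d : nat) (s : S) :=
  forall (B : {set P}) m, (d <= mdeg m + #|B|)%N -> (s B)@_m = 0.

Lemma deg_lt0 d : deg_lt d 0.
Proof. by move=> B m _; rewrite spoly0E mcoeff0. Qed.
Lemma deg_ltD d s t : deg_lt d s -> deg_lt d t -> deg_lt d (s + t).
Proof. by move=> hs ht B m hd; rewrite spolyDE mcoeffD hs // ht // addr0. Qed.
Lemma deg_ltZ d a s : deg_lt d s -> deg_lt d (a *: s).
Proof. by move=> hs B m hd; rewrite spolyZE mcoeffZ hs // mulr0. Qed.
Lemma deg_ltN d s : deg_lt d s -> deg_lt d (- s).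
Proof. by rewrite -scaleN1r; apply: deg_ltZ. Qed.
Lemma deg_lt_sum d I (r : seq I) (Q : pred I) (F : I -> S) :
  (forall i, Q i -> deg_lt d (F i)) -> deg_lt d (\sum_(i <- r | Q i) F i).
Proof. by move=> h; elim/big_ind: _ => //; [exact: deg_lt0|exact: deg_ltD]. Qed.
Lemma deg_ltW d e s : (d <= e)%N -> deg_lt d s -> deg_lt e s.
Proof. by move=> de hs B m em; apply: hs; apply: leq_trans em. Qed.
Lemma deg_lt0P s : deg_lt 0 s -> s = 0.
Proof.
by move=> hs; apply: spolyP => B; apply/mpolyP => m; rewrite hs // spoly0E mcoeff0.
Qed.
Lemma deg_lt_exists s : exists d, deg_lt d s.
Proof.
exists (\max_(B : {set P}) (msize (s B) + #|B|))%N => B m hm.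
apply: memN_msupp_eq0; apply/negP => /msize_mdeg_lt lm.
have := leq_bigmax (F := fun B : {set P} => (msize (s B) + #|B|)%N) B.
by move=> /leq_trans/(_ hm); rewrite leq_add2r leqNgt lm.
Qed.

Lemma mcoeff_varM n (i : 'I_n) (p : {mpoly K[n]}) m :
  ('X_i * p)@_m = if m i == 0%N then 0 else p@_(m - U_(i)).
Proof.
rewrite mulrC; case: eqP => [mi0|/eqP mi].
  apply: memN_msupp_eq0; rewrite (perm_mem (msuppMX _ _)).
  by apply/negP => /mapP[k _ mE]; move: mi0; rewrite mE mnmDE mnm1E eqxx.
by rewrite -[in LHS](submK (m := U_(i)%MM) (m' := m)) ?lep1mP // addmC mcoeffMX.
Qed.

Lemma ev_mul_coef (t : P) (s : S) B m : (ev_mul t s B)@_m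
  = if m (enum_rank t) == 0%N then 0 else (s B)@_(m - U_(enum_rank t)).
Proof. by rewrite ev_mulE mcoeff_varM. Qed.
Lemma ev_der_coef (t : P) (s : S) B m :
  (ev_der t s B)@_m = (s B)@_(m + U_(enum_rank t)) *+ (m (enum_rank t)).+1.
Proof. by rewrite ev_derE mcoeff_mderiv. Qed.

Lemma mdegU_sub n (i : 'I_n) (m : 'X_{1..n}) :
  m i != 0%N -> mdeg m = (mdeg (m - U_(i))).+1.
Proof.
by move=> mi; rewrite -{1}(submK (m := U_(i)%MM) (m' := m)) ?lep1mP // mdegD mdeg1 addn1.
Qed.

Lemma deg_lt_ev_mul d t s : deg_lt d s -> deg_lt d.+1 (ev_mul t s).
Proof.
move=> hs B m hd; rewrite ev_mul_coef; case: eqP => // /eqP mi; apply: hs.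
by move: hd; rewrite (mdegU_sub mi) addSn ltnS.
Qed.
Lemma deg_lt_odd_mul d t s : deg_lt d s -> deg_lt d.+1 (odd_mul key t s).
Proof.
move=> hs B m hd; rewrite odd_mulE; case: ifP => tB; rewrite ?mcoeff0 // mcoeffZ hs ?mulr0 //.
by move: hd; rewrite (cardsD1 t) tB addnS ltnS.
Qed.
Lemma deg_lt_ev_der d t s : deg_lt d.+1 s -> deg_lt d (ev_der t s).
Proof.
move=> hs B m hd; rewrite ev_der_coef hs ?mul0rn //.
by rewrite mdegD mdeg1 addn1 addSn ltnS.
Qed.
Lemma deg_lt_odd_der d t s : deg_lt d.+1 s -> deg_lt d (odd_der key t s).
Proof.
move=> hs B m hd; rewrite odd_derE; case: (boolP (t \in B)) => tB.
  by rewrite mcoeff0.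
by rewrite mcoeffZ hs ?mulr0 // cardsU1 tB addnS ltnS.
Qed.

End Degrees.

(** * The representation of U(q_N) on S(q_N) *)

Section RepresentationOfU.
Variables (K : fieldType) (N : nat) (key : ('I_N * 'I_N)%type -> nat).
Hypothesis key_inj : injective key.
Local Notation P := ('I_N * 'I_N)%type.
Local Notation S := (spoly K P).
Local Notation zv := (zvar K key).
Local Notation dv := (dvar K key).
Local Notation U := (UqN K N).
Local Notation sg p q := ((-1) ^+ (p && q) : K).

Definition lrep := left_rep zv dv.
Definition lder := left_der zv dv.
Definition rrep := right_rep zv dv.
Definition rder := right_der zv dv.

Lemma deg_lt_zvar d i s : deg_lt d s -> deg_lt d.+1 (zv i s).
Proof.
by rewrite /zvar; case: ifP => _; [apply: deg_lt_odd_mul|apply: deg_lt_ev_mul].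
Qed.
Lemma deg_lt_zd d i j s : deg_lt d s -> deg_lt d (zv i (dv j s)).
Proof.
case: d => [/deg_lt0P->|d hs]; first by rewrite !linear0; exact: deg_lt0.
apply: deg_lt_zvar.
by rewrite /dvar; case: ifP => _; [apply: deg_lt_odd_der|apply: deg_lt_ev_der].
Qed.
Lemma deg_lt_lder d i j s : deg_lt d s -> deg_lt d (lder i j s).
Proof.
by move=> hs; rewrite /lder lend_sum; apply: deg_lt_sum => c _; apply: deg_lt_zd.
Qed.

Lemma dvar_one i : dv i sone = 0.
Proof.
rewrite /dvar; case: ifP => _; apply: spolyP => B; rewrite spoly0E.
  rewrite odd_derE; case: ifP => // _; rewrite ffunE.
  rewrite (_ : _ == _ = false) ?scaler0 //; apply/negbTE/set0Pn.
  by exists (abs2 i); rewrite setU11.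
rewrite ev_derE ffunE; case: (B == set0); last exact: mderiv0.
by rewrite -mpolyC1 mderivC.
Qed.

Lemma lrep_one i j : lrep i j sone = zv (i, j) sone.
Proof.
rewrite /lrep /left_rep lendD lend_sum big1 ?addr0 // => c _.
by rewrite lendM dvar_one linear0.
Qed.
Lemma rrep_one i j : rrep i j sone = zv (i, j) sone.
Proof.
rewrite /rrep /right_rep lendD lend_sum big1 ?addr0 // => c _.
by rewrite lendZ lendM dvar_one linear0 scaler0.
Qed.

Lemma lrep_spec : {phi : U -> lend S |
  [/\ {morph phi : u v / u + v}, {morph phi : u v / u * v},
      forall a u, phi (a *: u) = a *: phi u, phi 1 = 1 &
      forall i j, phi (FU K i j) = lrep i j]}.
Proof.
apply: U_rep_exists => [i j|i j k l].
  by apply: left_rep_opp; [exact: zvar_opp|exact: dvar_opp].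
by apply: left_rep_bracket;
  [exact: zvar_opp|exact: dvar_opp|exact: zvarM|exact: dvarM|exact: dvar_zvar].
Qed.

Definition Act : U -> lend S := sval lrep_spec.
Lemma ActD u v : Act (u + v) = Act u + Act v.
Proof. by rewrite /Act; case: lrep_spec => phi []. Qed.
Lemma ActM u v : Act (u * v) = Act u * Act v.
Proof. by rewrite /Act; case: lrep_spec => phi []. Qed.
Lemma ActZ a u : Act (a *: u) = a *: Act u.
Proof. by rewrite /Act; case: lrep_spec => phi []. Qed.
Lemma Act1 : Act 1 = 1.
Proof. by rewrite /Act; case: lrep_spec => phi []. Qed.
Lemma ActF i j : Act (FU K i j) = lrep i j.
Proof. by rewrite /Act; case: lrep_spec => phi []. Qed.
Lemma Act0 : Act 0 = 0.
Proof. by rewrite -(scale0r 0) ActZ scale0r. Qed.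
Lemma Act_sum I (r : seq I) (Q : pred I) (F : I -> U) :
  Act (\sum_(i <- r | Q i) F i) = \sum_(i <- r | Q i) Act (F i).
Proof. exact: (big_morph _ ActD Act0). Qed.

Lemma iota_expand (x : subvs_of (qN K N)) : Defs.iota x =
  \sum_(k : 'I_N) \sum_(j : idx N) ent (vsval x) (pos k) j *: FU K (pos k) j.
Proof.
have {1}-> : x = \sum_(k : 'I_N) \sum_(j : idx N)
    ent (vsval x) (pos k) j *: (Subvs (Fmx_in K (pos k) j) : subvs_of (qN K N)).
  apply: val_inj; rewrite linear_sum [LHS]sym_expand; last by apply/mem_qN/subvsP.
  apply: eq_bigr => k _; rewrite linear_sum; apply: eq_bigr => j _.
  by rewrite linearZ.
rewrite linear_sum; apply: eq_bigr => k _; rewrite linear_sum; apply: eq_bigr => j _.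
by rewrite linearZ.
Qed.

Lemma Act_rrep p u i j : U_homog p u ->
  Act u * rrep i j = sg p (par i (+) par j) *: (rrep i j * Act u).
Proof.
have AF k l : Act (FU K k l) * rrep i j =
    sg (par k (+) par l) (par i (+) par j) *: (rrep i j * Act (FU K k l)).
  rewrite ActF; apply: left_rep_right_rep;
  [exact: zvar_opp|exact: dvar_opp|exact: zvarM|exact: dvarM|exact: dvar_zvar].
elim=> {p u} [|p q x u hx _ IH|p|p a u v _ IHu _ IHv].
- by rewrite Act1 mul1r mulr1 scale1r.
- have Ax : Act (Defs.iota x) * rrep i j =
      sg p (par i (+) par j) *: (rrep i j * Act (Defs.iota x)).
    rewrite iota_expand Act_sum mulr_suml mulr_sumr scaler_sumr; apply: eq_bigr => k _.
    rewrite Act_sum mulr_suml mulr_sumr scaler_sumr; apply: eq_bigr => l _.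
    rewrite ActZ -scalerAl -scalerAr AF.
    have [->|/hx <-] := eqVneq (ent (vsval x) (pos k) l) 0.
      by rewrite !scale0r scaler0.
    by rewrite !scalerA mulrC.
  rewrite ActM -mulrA IH -scalerAr [Act _ * (rrep _ _ * _)]mulrA Ax -scalerAl scalerA.
  by rewrite -mulrA sgDl mulrC.
- by rewrite Act0 mul0r mulr0 scaler0.
- by rewrite ActD ActZ mulrDl [rrep i j * _]mulrDr -scalerAl -scalerAr IHu IHv scalerDr !scalerA mulrC.
Qed.

(* Phi u = u.1.  Right multiplication by F_ij corresponds to [rrep] i j, whence
   Phi u is killed by the adjoint action lder - rder when u is central. *)
Definition Phi (u : U) : S := Act u sone.

Lemma PhiD u v : Phi (u + v) = Phi u + Phi v.
Proof. by rewrite /Phi ActD. Qed.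
Lemma PhiZ a u : Phi (a *: u) = a *: Phi u.
Proof. by rewrite /Phi ActZ. Qed.
Lemma Phi0 : Phi 0 = 0. Proof. by rewrite /Phi Act0. Qed.
Lemma PhiN u : Phi (- u) = - Phi u.
Proof. by rewrite -scaleN1r PhiZ scaleN1r. Qed.
Lemma PhiB u v : Phi (u - v) = Phi u - Phi v.
Proof. by rewrite PhiD PhiN. Qed.
Lemma Phi_sum I (r : seq I) (Q : pred I) (F : I -> U) :
  Phi (\sum_(i <- r | Q i) F i) = \sum_(i <- r | Q i) Phi (F i).
Proof. exact: (big_morph _ PhiD Phi0). Qed.
Lemma PhiFl i j u : Phi (FU K i j * u) = zv (i, j) (Phi u) + lder i j (Phi u).
Proof. by rewrite /Phi ActM ActF. Qed.
(** [lrep] i j and [rrep] i j send 1 to the same variable z_ij. So F_ij, applied first to 1, may be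
    replaced by [rrep] i j, which then moves out past the action of u. *)
Lemma PhiFr p u i j : U_homog p u ->
  Phi (u * FU K i j) = sg p (par i (+) par j) *: rrep i j (Phi u).
Proof.
move=> hu; rewrite /Phi ActM ActF lendM lrep_one -rrep_one -lendM (Act_rrep _ _ hu).
by [].
Qed.

Lemma Phi_central u i j : U_homog false u -> u * FU K i j = FU K i j * u ->
  lder i j (Phi u) = rder i j (Phi u).
Proof.
move=> hu cu; have := PhiFr i j hu; rewrite cu PhiFl scale1r /rrep /right_rep lendD.
by move/addrI.
Qed.

End RepresentationOfU.

(** * The Poincare-Birkhoff-Witt basis *)

Section LinearSpan.
Variables (K : fieldType) (V : lmodType K).
Implicit Types Q : V -> Prop.

(** Spans of possibly infinite families; induction on this predicate replaces the choice of
    coefficients. *)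
Inductive lspan Q : V -> Prop :=
  | lspan_nil : lspan Q 0
  | lspan_cons a v w : Q v -> lspan Q w -> lspan Q (a *: v + w).

Lemma lspan_in Q v : Q v -> lspan Q v.
Proof. by move=> Qv; rewrite -[v]addr0 -[v]scale1r; apply/lspan_cons/lspan_nil. Qed.
Lemma lspan_add Q v w : lspan Q v -> lspan Q w -> lspan Q (v + w).
Proof.
elim=> [|a x y Qx _ IH] hw; rewrite ?add0r // -addrA.
by apply: lspan_cons => //; apply: IH.
Qed.
Lemma lspan_scale Q a v : lspan Q v -> lspan Q (a *: v).
Proof.
elim=> [|b x y Qx _ IH]; first by rewrite scaler0; apply: lspan_nil.
by rewrite scalerDr scalerA; apply: lspan_cons.
Qed.
Lemma lspan_opp Q v : lspan Q v -> lspan Q (- v).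
Proof. by rewrite -scaleN1r; apply: lspan_scale. Qed.
Lemma lspan_sum Q I (r : seq I) (R : pred I) (F : I -> V) :
  (forall i, R i -> lspan Q (F i)) -> lspan Q (\sum_(i <- r | R i) F i).
Proof. by move=> h; elim/big_ind: _ => //; [exact: lspan_nil|exact: lspan_add]. Qed.
Lemma lspan_bind Q Q' v : lspan Q v -> (forall w, Q w -> lspan Q' w) -> lspan Q' v.
Proof.
move=> hv h; elim: hv => [|a x y Qx _ IH]; first exact: lspan_nil.
by apply: lspan_add => //; apply/lspan_scale/h.
Qed.
Lemma lspan_mono Q Q' v : lspan Q v -> (forall w, Q w -> Q' w) -> lspan Q' v.
Proof. by move=> hv h; apply: lspan_bind hv _ => w /h; apply: lspan_in. Qed.

End LinearSpan.

Lemma lspan_map (K : fieldType) (V W : lmodType K) (Q : V -> Prop) (Q' : W -> Prop)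
    (f : V -> W) v : (forall a x y, f (a *: x + y) = a *: f x + f y) ->
  lspan Q v -> (forall w, Q w -> lspan Q' (f w)) -> lspan Q' (f v).
Proof.
move=> flin hv h; elim: hv => [|a x y Qx _ IH].
  suff -> : f 0 = 0 by exact: lspan_nil.
  by apply: (addrI (f 0)); rewrite -[X in X + _]scale1r -flin scaler0 !addr0.
by rewrite flin; apply: lspan_add => //; apply/lspan_scale/h.
Qed.

(** * Straightening of words into ordered monomials *)

Section Straightening.
Variables (K : fieldType) (P : finType) (key : P -> nat) (A : algType K).
Hypothesis key_inj : injective key.
Hypothesis char0 : (2%:R : K) != 0.
Local Notation T := (bool * P)%type.
Variable F : T -> A.
Local Notation sg p q := ((-1) ^+ (p && q) : K).

Definition keyT (t : T) : nat := ((key t.2).*2 + t.1)%N.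
(** An even letter may be repeated, an odd one may not, because its square is half of its bracket
    with itself. By [keyT], the even letter of an index immediately precedes the odd one. *)
Definition ordT (t u : T) : bool := (keyT t < keyT u)%N || (t == u) && ~~ t.1.
Definition normal (w : seq T) : bool := pairwise ordT w.
Definition wpar (w : seq T) : bool := foldr (fun t p => t.1 (+) p) false w.
Definition wprod (w : seq T) : A := \prod_(t <- w) F t.

Lemma keyT_inj : injective keyT.
Proof.
move=> [b p] [c q]; rewrite /keyT /= => e.
have bc : b = c.
  by have := congr1 odd e; rewrite !oddD !odd_double /= !oddb.
by move: e; rewrite bc => /addIn/double_inj/key_inj ->.
Qed.

Lemma wprod_cons t w : wprod (t :: w) = F t * wprod w.
Proof. by rewrite /wprod big_cons. Qed.
Lemma wprod_cat v w : wprod (v ++ w) = wprod v * wprod w.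
Proof. by rewrite /wprod big_cat. Qed.

(** The letters in B span a sub-superalgebra. Straightening can thus be carried out inside n_-, the
    diagonal part or n_+ separately, without introducing foreign letters. *)
Definition br_closed (B : pred T) := forall t u, B t -> B u ->
  lspan (fun v => exists2 x, B x /\ x.1 = t.1 (+) u.1 & v = F x)
        (F t * F u - sg t.1 u.1 *: (F u * F t)).

(** Excluding the empty word matters: a bracket replaces two letters by one, never by none, so a
    product of negative (or positive) letters keeps at least one such letter after straightening. *)
Definition NF (B : pred T) (p : bool) (d : nat) (v : A) : Prop :=
  exists w, [/\ v = wprod w, normal w, all B w, wpar w = p & (0 < size w <= d)%N].

Lemma NF_le B p d e v : (d <= e)%N -> lspan (NF B p d) v -> lspan (NF B p e) v.
Proof.
move=> de hv; apply: lspan_mono hv _ => x [w [-> nw Bw pw /andP[w0 wd]]].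
by exists w; split; rewrite // w0 (leq_trans wd).
Qed.

Section StraighteningStep.
Variables (B : pred T) (n : nat).
Hypothesis Bcl : br_closed B.
Hypothesis IHn : forall w, all B w -> (0 < size w <= n)%N ->
  lspan (NF B (wpar w) (size w)) (wprod w).

Lemma straighten_mul t p d v : B t -> (d < n)%N ->
  lspan (NF B p d) v -> lspan (NF B (t.1 (+) p) d.+1) (F t * v).
Proof.
move=> Bt dn hv; apply: (lspan_map (f := fun x => F t * x)) hv _.
  by move=> a x y; rewrite mulrDr scalerAr.
move=> _ [w [-> nw Bw <- /andP[w0 wd]]]; rewrite -wprod_cons.
apply: (@NF_le _ _ (size (t :: w))); first by rewrite /= ltnS.
by apply: (IHn (w := t :: w)); rewrite /= ?Bt //; apply: leq_ltn_trans dn.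
Qed.

Lemma straighten_bracket t u w : B t -> B u -> all B w -> (size w < n)%N ->
  lspan (NF B (t.1 (+) u.1 (+) wpar w) (size w).+1)
    ((F t * F u - sg t.1 u.1 *: (F u * F t)) * wprod w).
Proof.
move=> Bt Bu Bw wn; apply: (lspan_map (f := fun x => x * wprod w)) (Bcl Bt Bu) _.
  by move=> a x y; rewrite mulrDl scalerAl.
move=> _ [x [Bx px] ->]; rewrite -wprod_cons -px.
by apply: (IHn (w := x :: w)); rewrite /= ?Bx.
Qed.

(** Let u be the head of w. If t may precede u, nothing has to be done. If t = u is odd, F_u F_u is
    half of a bracket and the word gets shorter, which is the second alternative. Otherwise t and u
    are exchanged at the cost of a bracket, and t is inserted into the tail. *)
Lemma insertion t w : B t -> all B w -> normal w -> (size w <= n)%N ->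
  exists c w', [/\ lspan (NF B (t.1 (+) wpar w) (size w)) (F t * wprod w - c *: wprod w'),
    normal w', {subset w' <= t :: w}, wpar w' = t.1 (+) wpar w & size w' = (size w).+1]
  \/ lspan (NF B (t.1 (+) wpar w) (size w)) (F t * wprod w).
Proof.
move=> Bt; elim: w => [|u w IHw] /=.
  move=> _ _ _; exists 1, [:: t]; left; split=> //.
  by rewrite wprod_cons scale1r subrr; apply: lspan_nil.
case/andP=> Bu Bw /andP[ow nw] wn.
have [tu|ut] := boolP (ordT t u).
  exists 1, [:: t, u & w]; left; split=> //=.
    by rewrite -wprod_cons scale1r subrr; apply: lspan_nil.
  rewrite tu ow nw !andbT /=; apply/allP => x xw.
  have := allP ow x xw; move: tu; rewrite /ordT.
  case/orP=> [tu|/andP[/eqP-> //]]; case/orP=> [ux|/andP[/eqP<- _]].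
    by rewrite (ltn_trans tu ux).
  by rewrite tu.
have [tEu|tu] := eqVneq t u.
  have u1 : u.1 by move: ut; rewrite tEu /ordT ltnn eqxx /= negbK.
  exists 0, [::]; right; have hb := straighten_bracket Bu Bu Bw wn; rewrite tEu.
  rewrite (_ : F u * wprod (u :: w) = 2%:R^-1 *:
    ((F u * F u - sg u.1 u.1 *: (F u * F u)) * wprod w)).
    by rewrite addbA; apply: lspan_scale.
  rewrite wprod_cons u1 expr1 scaleN1r opprK -mulr2n mulrnAl -scaler_nat scalerA.
  by rewrite mulVf // scale1r mulrA.
have lt_ut : (keyT u < keyT t)%N.
  move: ut; rewrite /ordT (negbTE tu) /= orbF -leqNgt leq_eqVlt.
  by case/orP=> // /eqP/keyT_inj eut; rewrite eut eqxx in tu.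
have E : F t * wprod (u :: w) = sg t.1 u.1 *: (F u * (F t * wprod w))
    + (F t * F u - sg t.1 u.1 *: (F u * F t)) * wprod w.
  by rewrite wprod_cons mulrBl -scalerAl !mulrA addrC subrK.
have hb := straighten_bracket Bt Bu Bw wn.
rewrite -addbA in hb.
have [c [w']] := IHw Bw nw (ltnW wn).
case=> [[h nw' sw' pw' zw']|h].
  exists (sg t.1 u.1 * c), (u :: w'); left; split=> //=.
  - rewrite E wprod_cons -scalerA [c *: (F u * _)]scalerAr addrAC -scalerBr -mulrBr.
    apply: lspan_add hb; apply: lspan_scale.
    rewrite addbCA; apply: straighten_mul h => //.
  - rewrite /normal /= -/(normal w') nw' andbT; apply/allP => x /sw'.
    rewrite inE => /orP[/eqP->|xw]; first by rewrite /ordT lt_ut.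
    exact: (allP ow).
  - move=> x; rewrite inE => /orP[/eqP->|/sw']; rewrite !inE ?eqxx ?orbT //.
    by case/orP=> ->; rewrite ?orbT.
  - by rewrite pw' addbCA.
  - by rewrite zw'.
exists 0, [::]; right; rewrite E; apply: lspan_add hb; apply: lspan_scale.
by rewrite addbCA; apply: straighten_mul h.
Qed.

End StraighteningStep.

Lemma straighten (B : pred T) w : br_closed B -> all B w -> (0 < size w)%N ->
  lspan (NF B (wpar w) (size w)) (wprod w).
Proof.
move=> Bcl; have [n] := ubnP (size w); elim: n w => // n IHn [|t w] //=.
rewrite ltnS => wn /andP[Bt Bw] _.
have IHs v : all B v -> (0 < size v <= size w)%N -> lspan (NF B (wpar v) (size v)) (wprod v).
  by move=> Bv /andP[v0 vw]; apply: IHn => //; apply: leq_ltn_trans wn.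
have ins v : all B v -> normal v -> (size v <= size w)%N ->
    lspan (NF B (t.1 (+) wpar v) (size v).+1) (F t * wprod v).
  move=> Bv nv vw; have [c [w' [[h nw' sw' pw' zw']|h]]] := insertion Bcl IHs Bt Bv nv vw.
    rewrite -[F t * _](subrK (c *: wprod w')); apply: lspan_add.
      by apply: NF_le h.
    apply/lspan_scale/lspan_in; exists w'; split; rewrite ?zw' /= ?leqnn //.
    by apply/allP => x /sw'; rewrite inE => /orP[/eqP->|/(allP Bv)].
  by apply: NF_le h.
rewrite wprod_cons; case: w => [|u w] in wn Bw IHs ins *; first exact: (ins [::]).
have := IHs (u :: w) Bw; rewrite leqnn => /(_ isT).
move=> hw; apply: (lspan_map (f := fun x => F t * x)) hw _.
  by move=> a x y; rewrite mulrDr scalerAr.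
move=> _ [v [-> nv Bv <- /andP[v0 vw]]]; apply: NF_le (ins v Bv nv vw).
by rewrite ltnS.
Qed.

End Straightening.

(** * Normal words as monomials *)

Section OrderedMonomials.
Variables (P : finType) (key : P -> nat).
Hypothesis key_inj : injective key.
Local Notation T := (bool * P)%type.
Local Notation n := #|P|.
Local Notation normal := (normal key).

Definition leT (t u : T) : bool := (keyT key t <= keyT key u)%N.

Lemma leT_total : total leT.
Proof. by move=> t u; apply: leq_total. Qed.
Lemma leT_trans : transitive leT.
Proof. by move=> t u v; apply: leq_trans. Qed.
Lemma leT_anti : antisymmetric leT.
Proof. by move=> t u; rewrite -eqn_leq => /eqP/(keyT_inj key_inj). Qed.

Lemma normal_sorted w : normal w -> sorted leT w.
Proof.
move=> nw; rewrite (sorted_pairwise leT_trans); apply: sub_pairwise nw => t u.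
by case/orP=> [/ltnW//|/andP[/eqP-> _]]; apply: leqnn.
Qed.

Lemma sorted_normal w : sorted leT w ->
  (forall p, (count_mem (true, p) w <= 1)%N) -> normal w.
Proof.
rewrite (sorted_pairwise leT_trans); elim: w => //= t w IHw /andP[tw ww] cw.
rewrite /normal /= -/(normal w) IHw ?andbT // => [|p]; last first.
  by apply: leq_trans (cw p); apply: leq_addl.
apply/allP => u uw; have := allP tw u uw; rewrite /ordT /leT leq_eqVlt.
case/orP=> [/eqP/(keyT_inj key_inj) tu|->//].
rewrite tu ltnn eqxx /=; case: u => [[] p] //= in uw tu *.
by have := cw p; rewrite tu eqxx add1n ltnS leqn0 -leqn0 leqNgt -has_count has_pred1 uw.
Qed.

Lemma normal_perm_eq w v : normal w -> normal v -> perm_eq w v -> w = v.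
Proof.
by move=> /normal_sorted sw /normal_sorted sv; apply: sorted_eq sw sv;
  [exact: leT_trans|exact: leT_anti].
Qed.

Lemma normal_odd_count w p : normal w -> (count_mem (true, p) w <= 1)%N.
Proof.
elim: w => //= t w IHw /andP[tw nw]; case: eqP => [tE|_]; last exact: IHw.
rewrite tE in tw *; rewrite add1n ltnS leqn0 -leqn0 leqNgt -has_count has_pred1.
apply/negP => /(allP tw); rewrite /ordT ltnn /=.
by rewrite andbF.
Qed.

Definition mset (w : seq T) : 'X_{1..n} :=
  [multinom count_mem (false, enum_val i) w | i < n].
Definition oset (w : seq T) : {set P} := [set p | (true, p) \in w].
(** The normal word of a monomial. By [msetK], [osetK] and [mwordK], normal words correspond
    bijectively to pairs of an exponent of the even variables and a set of odd variables. *)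
Definition mword (m : 'X_{1..n}) (B : {set P}) : seq T :=
  sort leT (flatten [seq nseq (m (enum_rank p)) (false, p) | p <- index_enum P]
            ++ [seq (true, p) | p <- enum B]).

Lemma count_nseq_eq (t u : T) k : count_mem t (nseq k u) = ((u == t) * k)%N.
Proof. by rewrite count_nseq /= . Qed.

Lemma count_mword_even m B p : count_mem (false, p) (mword m B) = m (enum_rank p).
Proof.
rewrite /mword count_sort count_cat count_flatten sumnE !big_map.
rewrite (bigD1 p) //= count_nseq_eq eqxx mul1n.
rewrite big1 ?addn0 => [|q qp]; last first.
  by rewrite count_nseq_eq xpair_eqE /= (negbTE qp).
by rewrite count_map (eq_count (a2 := pred0)) ?count_pred0 ?addn0.
Qed.

Lemma count_mword_odd m B p : count_mem (true, p) (mword m B) = (p \in B).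
Proof.
rewrite /mword count_sort count_cat count_flatten sumnE !big_map.
rewrite big1 ?add0n => [|q _]; last by rewrite /= count_nseq_eq.
rewrite count_map (eq_count (a2 := pred1 p)) ?count_uniq_mem ?enum_uniq ?mem_enum //.
Qed.

Lemma mword_normal m B : normal (mword m B).
Proof.
apply: sorted_normal => [|p]; first exact: (sort_sorted leT_total).
by rewrite count_mword_odd leq_b1.
Qed.

Lemma msetK m B : mset (mword m B) = m.
Proof. by apply/mnmP => i; rewrite mnmE count_mword_even enum_valK. Qed.
Lemma osetK m B : oset (mword m B) = B.
Proof.
apply/setP => p; rewrite inE -has_pred1 has_count count_mword_odd.
by case: (p \in B).
Qed.

Lemma mwordK w : normal w -> mword (mset w) (oset w) = w.
Proof.
move=> nw; apply: normal_perm_eq => //; first exact: mword_normal.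
apply/allP => -[[] p] _ /=; apply/eqP.
  rewrite count_mword_odd inE; have := normal_odd_count p nw.
  by rewrite -has_pred1 has_count; case: (count_mem _ w) => [|[|]].
by rewrite count_mword_even mnmE enum_rankK.
Qed.

Lemma mem_mword_even m B p : ((false, p) \in mword m B) = (m (enum_rank p) != 0%N).
Proof. by rewrite -has_pred1 has_count count_mword_even lt0n. Qed.
Lemma mem_mword_odd m B p : ((true, p) \in mword m B) = (p \in B).
Proof. by rewrite -has_pred1 has_count count_mword_odd; case: (p \in B). Qed.

Lemma all_mword (Q : pred T) m B : all Q (mword m B) <->
  (forall p, m (enum_rank p) != 0%N -> Q (false, p)) /\ (forall p, p \in B -> Q (true, p)).
Proof.
split=> [/allP h|[h0 h1]].
  by split=> p hp; apply: h; rewrite ?mem_mword_even ?mem_mword_odd.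
by apply/allP => -[[] p]; rewrite ?mem_mword_even ?mem_mword_odd; [apply: h1|apply: h0].
Qed.

Lemma mset_cons t w : mset (t :: w) =
  ((if t.1 then 0 else U_(enum_rank t.2)) + mset w)%MM.
Proof.
apply/mnmP => i; rewrite mnmDE !mnmE /=; congr (_ + _)%N.
case: t => [[] p]; rewrite xpair_eqE /= ?mnm0E ?mnm1E //.
by rewrite -(inj_eq enum_val_inj) enum_rankK.
Qed.

Lemma oset_cons t w : oset (t :: w) = if t.1 then t.2 |: oset w else oset w.
Proof.
apply/setP => p; rewrite !inE; by case: t => [[] q]; rewrite /= !inE.
Qed.

Lemma normal_oset_head (p : P) w : normal ((true, p) :: w) -> p \notin oset w.
Proof.
move=> nw; have := normal_odd_count p nw; rewrite /= eqxx add1n ltnS leqn0 inE.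
by rewrite -leqn0 leqNgt -has_count has_pred1.
Qed.

Lemma size_normal w : normal w -> size w = (mdeg (mset w) + #|oset w|)%N.
Proof.
elim: w => [_|[b p] w IHw nw].
  rewrite (_ : mset [::] = 0%MM) ?mdeg0; last by apply/mnmP => i; rewrite !mnmE.
  by rewrite (_ : oset _ = set0) ?cards0 //; apply/setP => q; rewrite !inE.
have nw' : normal w by case/andP: nw.
rewrite /= IHw // mset_cons oset_cons /= mdegD; case: b nw => nw.
  by rewrite mdeg0 cardsU1 (normal_oset_head nw) addnCA.
by rewrite mdeg1 add1n addSn.
Qed.

Lemma wpar_normal w : normal w -> wpar w = odd #|oset w|.
Proof.
elim: w => [_|[b p] w IHw nw].
  by rewrite (_ : oset _ = set0) ?cards0 //; apply/setP => q; rewrite !inE.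
have nw' : normal w by case/andP: nw.
rewrite /= IHw // oset_cons; case: b nw => nw //=.
by rewrite cardsU1 (normal_oset_head nw) oddD.
Qed.

End OrderedMonomials.

Section MonomialBasis.
Variables (K : fieldType) (P : finType) (key : P -> nat).
Hypothesis key_inj : injective key.
Local Notation T := (bool * P)%type.
Local Notation S := (spoly K P).
Local Notation n := #|P|.

Definition smono (m : 'X_{1..n}) (B : {set P}) : S :=
  [ffun C => if C == B then 'X_[m] else 0].

Definition zT (t : T) : lend S := if t.1 then odd_mul key t.2 else ev_mul t.2.

(** No sign appears: in a normal word each odd letter precedes all the odd letters after it in the
    order of [key], so its Koszul sign is 1. *)
Lemma zword_mono w : normal key w ->
  (\prod_(t <- w) zT t : lend S) sone = smono (mset w) (oset w).
Proof.
elim: w => [_|[b p] w IHw nw].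
  rewrite big_nil lend1; apply: spolyP => C; rewrite !ffunE.
  rewrite (_ : mset [::] = 0%MM) ?mpolyX0; last by apply/mnmP => i; rewrite !mnmE.
  by rewrite (_ : oset _ = set0); [case: eqP|apply/setP => q; rewrite !inE].
have /andP[aw nw'] := nw.
rewrite big_cons lendM IHw // mset_cons oset_cons /zT /=.
apply: spolyP => C; case: b nw aw => nw aw; last first.
  rewrite ev_mulE !ffunE; case: eqP => _; last by rewrite mulr0.
  by rewrite mpolyXD.
have pw := normal_oset_head nw.
rewrite odd_mulE !ffunE.
case: (eqVneq C (p |: oset w)) => [->|CB]; last first.
  case: ifP => // pC; case: eqP => [CE|_]; last by rewrite scaler0.
  by case/eqP: CB; rewrite -CE setD1K.
rewrite setU11 setU1K // eqxx add0m /koszul (_ : [set _ in _ | _] = set0) ?cards0 ?scale1r //.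
apply/setP => q; rewrite !inE; apply/negbTE/negP.
case/andP=> /orP[/eqP->|qw]; first by rewrite ltnn.
have := allP aw _ qw; rewrite /ordT /keyT /= !addn1 xpair_eqE /= andbF orbF ltnS.
by rewrite ltn_double => /ltnW; rewrite leqNgt => /negbTE ->.
Qed.

Lemma smono_coef m B C k : (smono m B C)@_k = ((C == B) && (m == k))%:R.
Proof. by rewrite ffunE; case: (C == B); rewrite ?mcoeffX ?mcoeff0. Qed.

End MonomialBasis.

Section OrderedMonomialMap.
Variables (K : fieldType) (P : finType) (key : P -> nat) (A : lalgType K).
Local Notation T := (bool * P)%type.
Local Notation S := (spoly K P).
Local Notation n := #|P|.
Variable g : 'X_{1..n} -> {set P} -> A.

Definition mono_map (s : S) : A :=
  \sum_(B : {set P}) \sum_(m <- msupp (s B)) (s B)@_m *: g m B.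

(** The supports of x, y and a x + y differ; a common degree bound turns the three sums into sums
    over the same monomials, which makes linearity visible. *)
Lemma mono_mapw k (s : S) : (forall B, (msize (s B) <= k)%N) ->
  mono_map s = \sum_(B : {set P}) \sum_(m : 'X_{1..n < k}) (s B)@_m *: g m B.
Proof.
move=> hk; apply: eq_bigr => B _.
rewrite -(big_map val xpredT (fun m => (s B)@_m *: g m B)) /=.
rewrite [RHS](bigID (fun m => m \in msupp (s B))) /= [X in _ + X]big1 ?addr0; last first.
  by move=> m /memN_msupp_eq0 ->; rewrite scale0r.
rewrite -[RHS]big_filter; apply: perm_big; apply: uniq_perm.
- exact: msupp_uniq.
- by rewrite filter_uniq // map_inj_uniq ?index_enum_uniq //; apply: val_inj.
move=> m; rewrite mem_filter; case: (boolP (m \in msupp _)) => //= mB.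
have hm : (mdeg m < k)%N by apply: leq_trans (hk B); apply: msize_mdeg_lt.
by apply/esym/mapP; exists (BMultinom hm); rewrite // mem_index_enum.
Qed.

Lemma mono_map_linear a x y : mono_map (a *: x + y) = a *: mono_map x + mono_map y.
Proof.
pose k := (\max_(B : {set P}) maxn (msize (x B)) (maxn (msize (y B)) (msize ((a *: x + y) B))))%N.
have hk B : (maxn (msize (x B)) (maxn (msize (y B)) (msize ((a *: x + y) B))) <= k)%N.
  exact: (leq_bigmax (F := fun B => maxn (msize (x B)) (maxn (msize (y B)) (msize ((a *: x + y) B))))).
have kx B : (msize (x B) <= k)%N by have := hk B; rewrite !geq_max => /and3P[].
have ky B : (msize (y B) <= k)%N by have := hk B; rewrite !geq_max => /and3P[].
have kz B : (msize ((a *: x + y) B) <= k)%N by have := hk B; rewrite !geq_max => /and3P[].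
rewrite !(mono_mapw (k := k)) // scaler_sumr -big_split; apply: eq_bigr => B _.
rewrite scaler_sumr -big_split; apply: eq_bigr => m _ /=.
by rewrite spolyDE spolyZE mcoeffD mcoeffZ scalerDl scalerA.
Qed.

Lemma mono_map_smono m B : mono_map (smono K m B) = g m B.
Proof.
rewrite /mono_map (bigD1 B) //= ffunE eqxx msuppX big_seq1 mcoeffX eqxx scale1r.
by rewrite big1 ?addr0 // => C /negbTE CB; rewrite ffunE CB msupp0 big_nil.
Qed.

End OrderedMonomialMap.

Section GenerationOfU.
Variables (K : fieldType) (N : nat).
Import monalg.
Local Notation q_ := (subvs_of (qN K N)).

Lemma U_ind (Q : UqN K N -> Prop) : Q 1 ->
  (forall x u, Q u -> Q (Defs.iota x * u)) ->
  (forall a u v, Q u -> Q v -> Q (a *: u + v)) -> forall u, Q u.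
Proof.
move=> Q1 Qx Ql; have Q0 : Q 0 by rewrite -(addNr (1 : UqN K N)) -scaleN1r; apply: Ql.
have Qw (s : seq q_) : Q (U_pi (mkmalgU (FMonom s) 1)).
  elim: s => [|x s IH].
    have -> : mkmalgU (FMonom [::]) 1 = 1 :> {malg K[{fmonom q_}]}.
      by congr (mkmalgU _ _); apply/eqP; rewrite fmP fm1.
    by rewrite U_pi1.
  have -> : mkmalgU (FMonom (x :: s)) 1 = gen x * mkmalgU (FMonom s) 1
      :> {malg K[{fmonom q_}]}.
    rewrite /gen /free_gen -lock.
    rewrite [RHS]fgmulUU mulr1; congr (mkmalgU _ _).
    by apply/eqP; rewrite fmP fmM fmuE.
  by rewrite U_piM; apply: Qx.
elim/U_pi_ind=> u; rewrite (monalgE u).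
elim/big_ind: _ => [|v w Qv Qw'|k _].
- suff -> : U_pi 0 = 0 :> UqN K N by [].
  by apply: (addrI (U_pi 0)); rewrite -U_piD !addr0.
- by rewrite U_piD -[U_pi v]scale1r; apply: Ql.
- have -> : mkmalgU k (monalg.mcoeff k u) = monalg.mcoeff k u *: mkmalgU k 1 :> {malg K[{fmonom q_}]}.
    by apply/malgP => l; rewrite monalg.mcoeffZ !monalg.mcoeffU mulrnAr mulr1.
  rewrite U_piZ -[U_scale _ _]addr0; apply: (Ql (monalg.mcoeff k u) (U_pi (mkmalgU k 1))) => //.
  by case: k.
Qed.

End GenerationOfU.

Section RootOrder.
Variable N : nat.
Local Notation P := ('I_N * 'I_N)%type.

(* Negative roots come first, then the diagonal, then the positive roots. *)
Definition pkey (p : P) : nat := ((N + p.2 - p.1) * N + p.1)%N.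

Lemma pkey_inj : injective pkey.
Proof.
move=> [i j] [k l]; rewrite /pkey /= => e.
have N0 : (0 < N)%N by apply: leq_ltn_trans (ltn_ord i).
have ik : i = k.
  by apply: val_inj; have := congr1 (modn^~ N) e; rewrite !modnMDl !modn_small.
rewrite -{k}ik in e *; move: e => /addIn /eqP; rewrite eqn_mul2r.
rewrite eqn0Ngt N0 /= => /eqP e; congr (_, _); apply: val_inj => /=.
by move: e; have := ltn_ord i; lia.
Qed.

Lemma pkey_neg (p : P) : (p.2 < p.1)%N = (pkey p < N * N)%N.
Proof.
case: p => i j; rewrite /pkey /=; have := ltn_ord i; have := ltn_ord j.
by move=> hj hi; apply/idP/idP => h; nia.
Qed.
Lemma pkey_pos (p : P) : (p.1 < p.2)%N = (N.+1 * N <= pkey p)%N.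
Proof.
case: p => i j; rewrite /pkey /=; have := ltn_ord i; have := ltn_ord j.
by move=> hj hi; apply/idP/idP => h; nia.
Qed.
Lemma ordT_key (t u : bool * P) : ordT pkey t u -> (pkey t.2 <= pkey u.2)%N.
Proof.
case/orP=> [|/andP[/eqP-> //]]; rewrite /keyT -!muln2.
have := leq_b1 t.1; have := leq_b1 u.1; move: (pkey _) (pkey _) => a b; lia.
Qed.
Lemma key_ordT (t u : bool * P) : (pkey t.2 < pkey u.2)%N -> ordT pkey t u.
Proof.
move=> h; apply/orP; left; rewrite /keyT -!muln2; move: h.
have := leq_b1 t.1; have := leq_b1 u.1; move: (pkey _) (pkey _) => a b; lia.
Qed.

End RootOrder.

(** * The ordered monomials in the F_ij form a basis *)

Section PBW.
Variables (K : fieldType) (N : nat).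
Hypothesis char0 : (2%:R : K) != 0.
Local Notation P := ('I_N * 'I_N)%type.
Local Notation T := (bool * P)%type.
Local Notation S := (spoly K P).
Local Notation U := (UqN K N).
Local Notation n := #|{: P}|.
Local Notation sg p q := ((-1) ^+ (p && q) : K).

Local Notation key := (@pkey N).
Local Notation normal := (normal key).
Local Notation Phi := (@Phi K N key (@pkey_inj N)).

Definition idxT (t : T) : idx N * idx N :=
  (pos t.2.1, if t.1 then neg t.2.2 else pos t.2.2).
Definition FT (t : T) : U := FU K (idxT t).1 (idxT t).2.

Definition tneg : pred T := fun t => (t.2.2 < t.2.1)%N.
Definition tdiag : pred T := fun t => t.2.1 == t.2.2.
Definition tpos : pred T := fun t => (t.2.1 < t.2.2)%N.

Lemma par2_idxT t : par2 (idxT t) = t.1.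
Proof. by case: t => [[] p]. Qed.
Lemma abs2_idxT t : abs2 (idxT t) = t.2.
Proof. by case: t => [[] [i j]]. Qed.
Lemma zT_zvar t : zT K key t = zvar K key (idxT t).
Proof. by rewrite /zT /zvar par2_idxT abs2_idxT. Qed.

Lemma FU_opp (i j : idx N) : FU K (opp i) (opp j) = FU K i j.
Proof. by rewrite /FU; congr Defs.iota; apply: val_inj; rewrite /= Fmx_opp. Qed.

Lemma FU_FT (i j : idx N) : FU K i j = FT (par i (+) par j, abs2 (i, j)).
Proof.
case: i j => [i|i] [j|j]; [by []|by []| |].
  exact: (FU_opp (pos i) (neg j)).
exact: (FU_opp (pos i) (pos j)).
Qed.

Lemma FT_bracket t u : FT t * FT u - sg t.1 u.1 *: (FT u * FT t)
  = (t.2.2 == u.2.1)%:R *: FT (t.1 (+) u.1, (t.2.1, u.2.2))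
    - sg t.1 u.1 *: ((u.2.2 == t.2.1)%:R *: FT (t.1 (+) u.1, (u.2.1, t.2.2))).
Proof.
case: t u => [b [i j]] [c [k l]] /=.
have := FU_bracket K (pos i) (idxT (b, (i, j))).2 (pos k) (idxT (c, (k, l))).2.
rewrite -[FU K (pos i) _]/(FT (b, (i, j))) -[FU K (pos k) _]/(FT (c, (k, l))).
have -> : (par (pos i) (+) par (idxT (b, (i, j))).2) = b by case: b.
have -> : (par (pos k) (+) par (idxT (c, (k, l))).2) = c by case: c.
move=> ->; rewrite /DF !FU_FT; move: (FT) => f.
case: b; case: c; rewrite /= /abs2 /= ?scale0r ?add0r ?addr0 //.
Qed.

Lemma FT_comm (i k : 'I_N) :
  FT (false, (i, i)) * FT (false, (k, k)) = FT (false, (k, k)) * FT (false, (i, i)).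
Proof.
apply/eqP; rewrite -subr_eq0; have := FT_bracket (false, (i, i)) (false, (k, k)).
rewrite /= !scale1r => ->; apply/eqP.
by case: (eqVneq i k) => [->|_]; rewrite ?subrr // !scale0r subrr.
Qed.

Lemma br_closed_tneg : br_closed FT tneg.
Proof.
move=> t u; rewrite /tneg => ht hu; rewrite FT_bracket; apply: lspan_add.
  case: eqP => [e|_]; rewrite ?scale1r ?scale0r; last exact: lspan_nil.
  apply: lspan_in; eexists; last by []; split=> //=.
  by apply: ltn_trans hu _; rewrite -e.
apply/lspan_opp/lspan_scale; case: eqP => [e|_]; rewrite ?scale1r ?scale0r; last exact: lspan_nil.
apply: lspan_in; eexists; last by []; split=> //=.
by apply: ltn_trans ht _; rewrite -e.
Qed.

Lemma br_closed_tpos : br_closed FT tpos.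
Proof.
move=> t u; rewrite /tpos => ht hu; rewrite FT_bracket; apply: lspan_add.
  case: eqP => [e|_]; rewrite ?scale1r ?scale0r; last exact: lspan_nil.
  apply: lspan_in; eexists; last by []; split=> //=.
  by apply: ltn_trans hu; rewrite -e.
apply/lspan_opp/lspan_scale; case: eqP => [e|_]; rewrite ?scale1r ?scale0r; last exact: lspan_nil.
apply: lspan_in; eexists; last by []; split=> //=.
by apply: ltn_trans ht; rewrite -e.
Qed.

Lemma br_closed_tdiag : br_closed FT tdiag.
Proof.
move=> t u; rewrite /tdiag => /eqP ht /eqP hu; rewrite FT_bracket; apply: lspan_add.
  case: eqP => [e|_]; rewrite ?scale1r ?scale0r; last exact: lspan_nil.
  by apply: lspan_in; eexists; last by []; split; rewrite //= ht e hu.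
apply/lspan_opp/lspan_scale; case: eqP => [e|_]; rewrite ?scale1r ?scale0r; last exact: lspan_nil.
by apply: lspan_in; eexists; last by []; split; rewrite //= hu e ht.
Qed.

Lemma br_closed_all : br_closed FT predT.
Proof.
move=> t u _ _; rewrite FT_bracket; apply: lspan_add; last apply: lspan_opp.
  by apply/lspan_scale/lspan_in; eexists; last by [].
by do 2 apply/lspan_scale; apply/lspan_in; eexists; last by [].
Qed.

Definition is_word (p : bool) (v : U) := exists2 w, v = wprod FT w & wpar w = p.

Lemma word_mulF p v t : lspan (is_word p) v -> lspan (is_word (t.1 (+) p)) (FT t * v).
Proof.
move=> hv; apply: (lspan_map (f := fun x => FT t * x)) hv _.
  by move=> a x y; rewrite mulrDr scalerAr.
by move=> _ [w -> <-]; apply: lspan_in; exists (t :: w); rewrite ?wprod_cons.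
Qed.

Lemma homog_words p u : U_homog p u -> lspan (is_word p) u.
Proof.
elim=> {p u} [|p q x u hx _ IH|p|p a u v _ IHu _ IHv].
- by apply: lspan_in; exists [::]; rewrite /wprod ?big_nil.
- rewrite iota_expand mulr_suml; apply: lspan_sum => k _.
  rewrite mulr_suml; apply: lspan_sum => j _; rewrite -scalerAl.
  have [->|/hx pj] := eqVneq (ent (vsval x) (pos k) j) 0.
    by rewrite scale0r; apply: lspan_nil.
  rewrite FU_FT -pj; apply: lspan_scale.
  exact: (word_mulF (_, _) IH).
- exact: lspan_nil.
- by apply: lspan_add => //; apply: lspan_scale.
Qed.

Lemma U_words u : lspan (fun v => exists w, v = wprod FT w) u.
Proof.
elim/U_ind: u => [|x u IH|a u v IHu IHv].
- by apply: lspan_in; exists [::]; rewrite /wprod big_nil.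
- rewrite iota_expand mulr_suml; apply: lspan_sum => k _.
  rewrite mulr_suml; apply: lspan_sum => j _; rewrite -scalerAl FU_FT.
  apply: lspan_scale; apply: (lspan_map (f := fun x => FT _ * x)) IH _.
    by move=> a y z; rewrite mulrDr scalerAr.
  by move=> _ [w ->]; apply: lspan_in; eexists (_ :: w); rewrite wprod_cons.
- by apply: lspan_add => //; apply: lspan_scale.
Qed.

(* The ordered monomials, inverse to Phi up to terms of lower degree (Phi_Psi). *)
Definition Psi (s : S) : U := mono_map (fun m B => wprod FT (mword key m B)) s.

Lemma Psi_linear a x y : Psi (a *: x + y) = a *: Psi x + Psi y.
Proof. exact: mono_map_linear. Qed.
Lemma PsiD x y : Psi (x + y) = Psi x + Psi y.
Proof. by rewrite -[x in LHS]scale1r Psi_linear scale1r. Qed.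
Lemma Psi0 : Psi 0 = 0.
Proof. by apply: (addrI (Psi 0)); rewrite -PsiD !addr0. Qed.
Lemma PsiZ a x : Psi (a *: x) = a *: Psi x.
Proof. by rewrite -[_ *: x]addr0 Psi_linear Psi0 addr0. Qed.
Lemma PsiB x y : Psi (x - y) = Psi x - Psi y.
Proof. by rewrite PsiD -scaleN1r PsiZ scaleN1r. Qed.
Lemma Psi_smono m B : Psi (smono K m B) = wprod FT (mword key m B).
Proof. exact: mono_map_smono. Qed.
Lemma Psi_word w : normal w -> Psi (smono K (mset w) (oset w)) = wprod FT w.
Proof. by move=> nw; rewrite Psi_smono (mwordK (@pkey_inj N)). Qed.

(** Each letter acts as multiplication by its variable plus a derivation that does not raise the
    degree, so the leading part of a word is the product of its variables. *)
Lemma Phi_wprod w : deg_lt (size w).+1 (Phi (wprod FT w)) /\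
  deg_lt (size w) (Phi (wprod FT w) - (\prod_(t <- w) zT K key t : lend S) sone).
Proof.
elim: w => [|t w [IH1 IH2]].
  rewrite /wprod !big_nil /Phi Act1 lend1 subrr; split; last exact: deg_lt0.
  move=> B m; rewrite ffunE; case: eqP => [->|_]; last by rewrite mcoeff0.
  rewrite cards0 addn0 mcoeff1; case: eqP => // ->.
  by rewrite mdeg0.
rewrite wprod_cons PhiFl big_cons lendM zT_zvar -surjective_pairing; split.
  apply: deg_ltD; first exact: deg_lt_zvar.
  by apply: deg_ltW (deg_lt_lder _ _ _ IH1).
rewrite addrAC -linearB; apply: deg_ltD; first exact: deg_lt_zvar.
exact: deg_lt_lder.
Qed.

Lemma smono_expand (s : S) :
  s = \sum_(B : {set P}) \sum_(m <- msupp (s B)) (s B)@_m *: smono K m B.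
Proof.
apply: spolyP => B; rewrite spoly_sumE (bigD1 B) //= [X in _ + X]big1 => [|C CB].
  rewrite addr0 spoly_sumE [LHS]mpolyE; apply: eq_bigr => m _.
  by rewrite spolyZE ffunE eqxx.
rewrite spoly_sumE big1 // => m _; rewrite spolyZE ffunE eq_sym (negbTE CB).
by rewrite scaler0.
Qed.

Lemma Phi_Psi d s : deg_lt d.+1 s -> deg_lt d (Phi (Psi s) - s).
Proof.
move=> hs; rewrite {2}(smono_expand s) /Psi /mono_map Phi_sum -sumrB.
apply: deg_lt_sum => B _; rewrite Phi_sum -sumrB big_seq; apply: deg_lt_sum => m mB.
rewrite PhiZ -scalerBr; apply: deg_ltZ.
have nw := mword_normal (@pkey_inj N) m B; have [_] := Phi_wprod (mword key m B).
rewrite zword_mono // msetK osetK.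
rewrite (size_normal nw) msetK osetK; apply: deg_ltW.
rewrite -ltnS leqNgt; apply/negP => hd; move: mB; rewrite mcoeff_msupp.
by rewrite hs ?eqxx // ltnW.
Qed.

(** Linear independence of the ordered monomials: if [Psi] s vanishes, [Phi_Psi] improves any degree
    bound on s by one, down to 0. *)
Lemma Psi_inj s : Psi s = 0 -> s = 0.
Proof.
move=> s0; suff h d : deg_lt d s -> deg_lt 0 s.
  by have [d /h] := deg_lt_exists s; apply: deg_lt0P.
elim: d => // d IH /Phi_Psi; rewrite s0 Phi0 sub0r => /deg_ltN.
by rewrite opprK.
Qed.

Definition S_in (Q : 'X_{1..n} -> {set P} -> bool) (s : S) :=
  forall (B : {set P}) m, ~~ Q m B -> (s B)@_m = 0.
Definition normal_in (Q : 'X_{1..n} -> {set P} -> bool) (v : U) :=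
  exists w, [/\ v = wprod FT w, normal w & Q (mset w) (oset w)].

Lemma S_inD Q s t : S_in Q s -> S_in Q t -> S_in Q (s + t).
Proof. by move=> hs ht B m hQ; rewrite spolyDE mcoeffD hs // ht // addr0. Qed.
Lemma S_inZ Q a s : S_in Q s -> S_in Q (a *: s).
Proof. by move=> hs B m hQ; rewrite spolyZE mcoeffZ hs // mulr0. Qed.

Lemma span_Psi Q u : lspan (normal_in Q) u -> exists2 s, S_in Q s & Psi s = u.
Proof.
elim=> [|a v w [x [-> nx Qx]] _ [s hs <-]].
  by exists 0; rewrite ?Psi0 // => B m _; rewrite spoly0E mcoeff0.
exists (a *: smono K (mset x) (oset x) + s).
  apply: S_inD => //; apply: S_inZ => B m; rewrite smono_coef.
  by case: eqP => // ->; case: eqP => // <-; rewrite Qx.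
by rewrite Psi_linear Psi_word.
Qed.

Lemma Psi_span Q s : S_in Q s -> lspan (normal_in Q) (Psi s).
Proof.
move=> hs; apply: lspan_sum => B _; apply: lspan_sum => m _.
have [Qm|nQ] := boolP (Q m B); last by rewrite hs // scale0r; apply: lspan_nil.
apply/lspan_scale/lspan_in; exists (mword key m B); split=> //.
  exact: mword_normal (@pkey_inj N) m B.
by rewrite msetK osetK.
Qed.

Lemma words_Psi p u : lspan (is_word p) u ->
  exists2 s, S_in (fun _ B => odd #|B| == p) s & Psi s = u.
Proof.
move=> hu; apply: span_Psi; apply: lspan_bind hu _ => _ [w -> <-].
(* [straighten] excludes the empty word, which is already normal. *)
have [->|w0] := eqVneq w [::].
  apply: lspan_in; exists [::]; split=> //.
  by rewrite (_ : oset _ = set0) ?cards0 //; apply/setP => q; rewrite !inE.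
have := straighten (@pkey_inj N) char0 br_closed_all (all_predT w).
rewrite lt0n size_eq0 => /(_ w0) h; apply: lspan_mono h _ => v [x [-> nx _ px _]].
by exists x; split=> //; rewrite -(wpar_normal nx) px.
Qed.

Lemma Psi_surj u : exists s, Psi s = u.
Proof.
have [s _ <-] : exists2 s, S_in (fun _ _ => true) s & Psi s = u; last by exists s.
apply: span_Psi; apply: lspan_bind (U_words u) _ => _ [w ->].
have [|s _ <-] := @words_Psi (wpar w) (wprod FT w); last exact: Psi_span.
by apply: lspan_in; exists w.
Qed.

End PBW.

(** * The Harish-Chandra map *)

Section CommutingProducts.
Variables (R : pzRingType) (I : Type).

Lemma comm_prod (a : R) (b : I -> R) (r : seq I) : (forall i, a * b i = b i * a) ->
  a * \prod_(i <- r) b i = (\prod_(i <- r) b i) * a.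
Proof.
move=> h; elim: r => [|i r IH]; first by rewrite big_nil mulr1 mul1r.
by rewrite big_cons mulrA h -mulrA IH mulrA.
Qed.

Lemma prod_comm_split (a b : I -> R) (r : seq I) :
  (forall i j, b j * a i = a i * b j) ->
  \prod_(i <- r) (a i * b i) = (\prod_(i <- r) a i) * \prod_(i <- r) b i.
Proof.
move=> h; elim: r => [|i r IH]; first by rewrite !big_nil mulr1.
rewrite !big_cons IH -!mulrA; congr (_ * _); rewrite !mulrA; congr (_ * _).
exact: comm_prod.
Qed.

End CommutingProducts.

Section CartanEvaluation.
Variables (K : fieldType) (N : nat).
Local Notation U := (UqN K N).
Local Notation at_F := (@at_F K N).
Local Notation h := (fun k : 'I_N => FU K (pos k) (pos k)).

Lemma at_FE f : at_F f = mmap (in_alg U) h f.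
Proof. by []. Qed.
Lemma at_FD f g : at_F (f + g) = at_F f + at_F g.
Proof. by rewrite !at_FE raddfD. Qed.
Lemma at_FB f g : at_F (f - g) = at_F f - at_F g.
Proof. by rewrite !at_FE raddfB. Qed.
Lemma at_F0 : at_F 0 = 0.
Proof. by rewrite at_FE raddf0. Qed.
Lemma at_FZ a f : at_F (a *: f) = a *: at_F f.
Proof. by rewrite !at_FE mmapZ /= mulr_algl. Qed.
Lemma at_FX m : at_F 'X_[m] = \prod_i h i ^+ m i.
Proof. by rewrite at_FE mmapX. Qed.
Lemma at_F1 : at_F 1 = 1.
Proof. by rewrite -mpolyX0 at_FX big1 // => i _; rewrite mnm0E expr0. Qed.
Lemma at_FXU i : at_F 'X_i = h i.
Proof. by rewrite at_FE mmapX mmap1U. Qed.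
Lemma at_F_sum I (r : seq I) (Q : pred I) (f : I -> mpoly N K) :
  at_F (\sum_(i <- r | Q i) f i) = \sum_(i <- r | Q i) at_F (f i).
Proof. exact: (big_morph _ at_FD at_F0). Qed.

Lemma FU_diag_comm i k : h i * h k = h k * h i.
Proof. exact: FT_comm. Qed.

(** Multiplicativity into the noncommutative U(q_N) rests on the commutation of the F_ii with each
    other. *)
Lemma at_FM f g : at_F (f * g) = at_F f * at_F g.
Proof.
have XM m1 m2 : at_F ('X_[m1] * 'X_[m2]) = at_F 'X_[m1] * at_F 'X_[m2].
  rewrite -mpolyXD !at_FX -prod_comm_split => [|i j].
    by apply: eq_bigr => i _; rewrite mnmDE exprD.
  by apply/commrX/commr_sym/commrX/FU_diag_comm.
have XM' m q : at_F ('X_[m] * q) = at_F 'X_[m] * at_F q.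
  rewrite (mpolyE q) mulr_sumr !at_FE !raddf_sum mulr_sumr /=.
  apply: eq_bigr => k _; rewrite -!at_FE.
  by rewrite -scalerAr !at_FZ -scalerAr XM.
rewrite (mpolyE f) mulr_suml !at_FE !raddf_sum mulr_suml /=.
apply: eq_bigr => k _; rewrite -!at_FE.
by rewrite -scalerAl !at_FZ -scalerAl XM'.
Qed.

End CartanEvaluation.

(** * The space n_- U + U n_+ and its complement *)

Section HarishChandraNull.
Variables (K : fieldType) (N : nat).
Hypothesis char0 : (2%:R : K) != 0.
Local Notation P := ('I_N * 'I_N)%type.
Local Notation T := (bool * P)%type.
Local Notation U := (UqN K N).
Local Notation n := #|{: P}|.
Local Notation sg p q := ((-1) ^+ (p && q) : K).
Local Notation key := (@pkey N).
Local Notation normal := (normal key).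
Local Notation FT := (@FT K N).
Local Notation tneg := (@tneg N).
Local Notation tpos := (@tpos N).
Local Notation tdiag := (@tdiag N).

Definition null_gen (v : U) : Prop :=
  (exists t u, tneg t /\ v = FT t * u) \/ (exists t u, tpos t /\ v = u * FT t).
Definition null := lspan null_gen.

Lemma null_negM t u : tneg t -> null (FT t * u).
Proof. by move=> ht; apply: lspan_in; left; exists t, u. Qed.
Lemma null_Mpos t u : tpos t -> null (u * FT t).
Proof. by move=> ht; apply: lspan_in; right; exists t, u. Qed.

Lemma span_ent0 (s : seq 'M[K]_(N + N)) i j :
  (forall B, B \in s -> ent B i j = 0) -> forall M, M \in <<s>>%VS -> ent M i j = 0.
Proof.
move=> h M Ms; rewrite (coord_span (Ms : M \in span (in_tuple s))) /ent summxE.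
rewrite big1 // => k _; rewrite mxE; apply/eqP; rewrite mulf_eq0; apply/orP; right.
by apply/eqP; apply: h; rewrite mem_nth.
Qed.

Lemma nneg_ent M : M \in nneg K N -> forall (k : 'I_N) (j : idx N), (k <= absi j)%N -> ent M (pos k) j = 0.
Proof.
move=> /memv_addP[A hA [B hB ->]] k j kj; rewrite entD.
have entF0 (a b : 'I_N) (c : idx N) : absi c = b -> (b < a)%N ->
    ent (Fmx K (pos a) c) (pos k) j = 0.
  move=> cb ba; rewrite entF addr0; case: eqP => [[E]|//]; case: eqP => [E'|//].
  by move: kj; rewrite E E' cb leqNgt ba.
have -> : ent A (pos k) j = 0.
  apply: span_ent0 hA => C /mapP[[a b]]; rewrite mem_enum inE /= => ba ->.
  exact: entF0 ba.
have -> : ent B (pos k) j = 0; last by rewrite addr0.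
apply: span_ent0 hB => C /mapP[[a b]]; rewrite mem_enum inE /= => ba ->.
exact: entF0 ba.
Qed.

Lemma npos_ent M : M \in npos K N -> forall (k : 'I_N) (j : idx N), (absi j <= k)%N -> ent M (pos k) j = 0.
Proof.
move=> /memv_addP[A hA [B hB ->]] k j kj; rewrite entD.
have entF0 (a b : 'I_N) (c : idx N) : absi c = b -> (a < b)%N ->
    ent (Fmx K (pos a) c) (pos k) j = 0.
  move=> cb ba; rewrite entF addr0; case: eqP => [[E]|//]; case: eqP => [E'|//].
  by move: kj; rewrite E E' cb leqNgt ba.
have -> : ent A (pos k) j = 0.
  apply: span_ent0 hA => C /mapP[[a b]]; rewrite mem_enum inE /= => ba ->.
  exact: entF0 ba.
have -> : ent B (pos k) j = 0; last by rewrite addr0.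
apply: span_ent0 hB => C /mapP[[a b]]; rewrite mem_enum inE /= => ba ->.
exact: entF0 ba.
Qed.

Lemma HC_null_null u : HC_null u -> null u.
Proof.
elim=> {u} [y u hy|u x hx||u v _ IHu _ IHv].
- rewrite iota_expand mulr_suml; apply: lspan_sum => k _; rewrite mulr_suml.
  apply: lspan_sum => j _; rewrite -scalerAl; have [kj|jk] := leqP k (absi j).
    by rewrite (nneg_ent hy) // scale0r; apply: lspan_nil.
  by rewrite FU_FT; apply/lspan_scale/null_negM.
- rewrite iota_expand mulr_sumr; apply: lspan_sum => k _; rewrite mulr_sumr.
  apply: lspan_sum => j _; rewrite -scalerAr; have [kj|jk] := leqP (absi j) k.
    by rewrite (npos_ent hx) // scale0r; apply: lspan_nil.
  by rewrite FU_FT; apply/lspan_scale/null_Mpos.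
- exact: lspan_nil.
- exact: lspan_add.
Qed.

Lemma null_HC_null u : null u -> HC_null u.
Proof.
elim=> [|a v w [] [t [x [ht ->]]] _ IH]; first exact: HC_0.
- apply: HC_add => //; rewrite scalerAr; apply: HC_nneg; move: ht.
  case: t => [[] [i j]] ht; [apply: (subvP (addvSr _ _))|apply: (subvP (addvSl _ _))];
    by apply: memv_span; apply/mapP; exists (i, j); rewrite ?mem_enum ?inE.
- apply: HC_add => //; rewrite scalerAl; apply: HC_npos; move: ht.
  case: t => [[] [i j]] ht; [apply: (subvP (addvSr _ _))|apply: (subvP (addvSl _ _))];
    by apply: memv_span; apply/mapP; exists (i, j); rewrite ?mem_enum ?inE.
Qed.

Lemma null_mulr u v : (forall t, tpos t -> lspan (fun w => exists2 t', tpos t' & w = FT t')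
    (FT t * v - v * FT t)) -> null u -> null (u * v).
Proof.
move=> hv hu; apply: (lspan_map (f := fun x => x * v)) hu _.
  by move=> a x y; rewrite mulrDl scalerAl.
move=> _ [] [t [x [ht ->]]]; first by rewrite -mulrA; apply: null_negM.
rewrite -mulrA -[FT t * v](subrK (v * FT t)) mulrDr; apply: lspan_add.
  apply: (lspan_map (f := fun y => x * y)) (hv _ ht) _.
    by move=> a y z; rewrite mulrDr scalerAr.
  by move=> _ [t' ht' ->]; apply: null_Mpos.
by rewrite mulrA; apply: null_Mpos.
Qed.

(** The diagonal part normalizes n_-: moving a diagonal letter past a negative one produces another
    negative letter. [null_mul_diag] is the mirror image for n_+. *)
Lemma null_diag_mul t u : tdiag t -> null u -> null (FT t * u).
Proof.
move=> dt hu; apply: (lspan_map (f := fun x => FT t * x)) hu _.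
  by move=> a x y; rewrite mulrDr scalerAr.
move=> _ [] [s [x [hs ->]]]; last by rewrite mulrA; apply: null_Mpos.
rewrite mulrA -[FT t * FT s](subrK (sg t.1 s.1 *: (FT s * FT t))) mulrDl.
apply: lspan_add; last by rewrite -scalerAl -mulrA; apply/lspan_scale/null_negM.
rewrite FT_bracket mulrBl -!scalerAl; apply: lspan_add; last apply/lspan_opp/lspan_scale.
  case: eqP => [e|_]; rewrite ?scale0r; last exact: lspan_nil.
  apply/lspan_scale/null_negM; move: dt hs; rewrite /tdiag /tneg /= => /eqP ->.
  by rewrite e.
case: eqP => [e|_]; rewrite ?scale0r; last exact: lspan_nil.
apply/lspan_scale/null_negM; move: dt hs; rewrite /tdiag /tneg /= => /eqP <-.
by rewrite -e.
Qed.

Lemma null_mul_diag t u : tdiag t -> null u -> null (u * FT t).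
Proof.
move=> dt hu; apply: (lspan_map (f := fun x => x * FT t)) hu _.
  by move=> a x y; rewrite mulrDl scalerAl.
move=> _ [] [s [x [hs ->]]]; first by rewrite -mulrA; apply: null_negM.
rewrite -mulrA -[FT s * FT t](subrK (sg s.1 t.1 *: (FT t * FT s))) mulrDr.
apply: lspan_add; last by rewrite -scalerAr mulrA; apply/lspan_scale/null_Mpos.
rewrite FT_bracket mulrBr -!scalerAr; apply: lspan_add; last apply/lspan_opp/lspan_scale.
  case: eqP => [e|_]; rewrite ?scale0r; last exact: lspan_nil.
  apply/lspan_scale/null_Mpos; move: dt hs; rewrite /tdiag /tpos /= => /eqP <-.
  by rewrite e.
case: eqP => [e|_]; rewrite ?scale0r; last exact: lspan_nil.
apply/lspan_scale/null_Mpos; move: dt hs; rewrite /tdiag /tpos /= => /eqP ->.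
by rewrite e.
Qed.

Lemma tneg_key t : tneg t = (key t.2 < N * N)%N.
Proof. exact: pkey_neg. Qed.
Lemma tpos_key t : tpos t = (N.+1 * N <= key t.2)%N.
Proof. exact: pkey_pos. Qed.

Lemma normal_split (a : pred T) w : (forall t u, a u -> ordT key t u -> a t) ->
  normal w -> w = filter a w ++ filter (predC a) w.
Proof.
move=> ha; elim: w => //= t w IH /andP[tw nw].
case: ifP => at_ /=; first by rewrite -IH.
have hf u : u \in w -> a u = false.
  by move=> uw; apply/negbTE/negP => /ha/(_ (allP tw u uw)); rewrite at_.
rewrite (eq_in_filter (a2 := pred0)) ?filter_pred0 /=; last by move=> u /hf.
rewrite (eq_in_filter (a2 := predT)) ?filter_predT //.
by move=> u /hf /= ->.
Qed.

Lemma normal_cat w v : normal w -> normal v ->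
  (forall t u, t \in w -> u \in v -> ordT key t u) -> normal (w ++ v).
Proof.
move=> nw nv h; rewrite /normal pairwise_cat -/(normal w) -/(normal v) nw nv !andbT.
by apply/allrelP.
Qed.

Lemma normal_catl w v : normal (w ++ v) -> normal w.
Proof. by rewrite /normal pairwise_cat => /and3P[]. Qed.
Lemma normal_catr w v : normal (w ++ v) -> normal v.
Proof. by rewrite /normal pairwise_cat => /and3P[]. Qed.

Definition diag_supp (m : 'X_{1..n}) (B : {set P}) : bool := all tdiag (mword key m B).

Lemma diag_supp_word w : normal w -> diag_supp (mset w) (oset w) = all tdiag w.
Proof. by move=> nw; rewrite /diag_supp (mwordK (@pkey_inj N)). Qed.

(** A normal word consists of negative, then diagonal, then positive letters. A negative letter put
    in front joins the negative segment, which is straightened inside n_- and stays nonempty; the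
    rest is untouched, so the result is normal and not diagonal. Positive letters at the end are
    treated alike. *)
Lemma null_offdiag u : null u ->
  lspan (normal_in (fun m B => ~~ diag_supp m B)) u.
Proof.
have neg_down (t v : T) : tneg v -> ordT key t v -> tneg t.
  by rewrite !tneg_key => hu /ordT_key; move/leq_ltn_trans; apply.
have pos_down (t v : T) : ~~ tpos v -> ordT key t v -> ~~ tpos t.
  by rewrite !tpos_key -!ltnNge => hu /ordT_key; move/leq_ltn_trans; apply.
have neg_diag t : tneg t -> ~~ tdiag t.
  by rewrite /tneg /tdiag => h; rewrite eq_sym neq_ltn h.
have pos_diag t : tpos t -> ~~ tdiag t.
  by rewrite /tpos /tdiag => h; rewrite neq_ltn h.
move=> hu; apply: lspan_bind hu _ => _ [] [t [x [ht ->]]].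
- have [s <-] := Psi_surj char0 x.
  have hs : S_in (fun _ _ => true) s by move=> ? ?.
  apply: (lspan_map (f := fun y => FT t * y)) (Psi_span hs) _.
    by move=> a y z; rewrite mulrDr scalerAr.
  move=> _ [w [-> nw _]].
  rewrite (normal_split neg_down nw); set w1 := filter _ _; set w2 := filter _ _.
  have nw12 : normal (w1 ++ w2) by rewrite -normal_split.
  have w1neg : all tneg (t :: w1) by rewrite /= ht filter_all.
  rewrite wprod_cat mulrA -wprod_cons.
  have hst := straighten (@pkey_inj N) char0 (@br_closed_tneg K N) w1neg (ltn0Sn _).
  apply: (lspan_map (f := fun y => y * wprod FT w2)) hst _.
    by move=> a y z; rewrite mulrDl scalerAl.
  move=> _ [v [-> nv vneg _ /andP[v0 _]]]; rewrite -wprod_cat; apply: lspan_in.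
  have nvw : normal (v ++ w2).
    apply: normal_cat => //; first exact: normal_catr nw12.
    move=> y z yv; rewrite mem_filter => /andP[/= hz _]; apply: key_ordT.
    have := allP vneg y yv; rewrite !tneg_key in hz *.
    by move=> h; apply: leq_trans h _; rewrite leqNgt.
  exists (v ++ w2); split=> //; rewrite diag_supp_word //; apply/allPn.
  case: v v0 vneg {nv nvw} => [//|y v] _ /= /andP[hy _].
  by exists y; rewrite ?inE ?eqxx // neg_diag.
- have [s <-] := Psi_surj char0 x.
  have hs : S_in (fun _ _ => true) s by move=> ? ?.
  apply: (lspan_map (f := fun y => y * FT t)) (Psi_span hs) _.
    by move=> a y z; rewrite mulrDl scalerAl.
  move=> _ [w [-> nw _]].
  rewrite (normal_split pos_down nw); set w1 := filter _ _; set w2 := filter _ _.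
  have nw12 : normal (w1 ++ w2) by rewrite -(normal_split pos_down).
  have w2pos : all tpos (w2 ++ [:: t]).
    rewrite all_cat /= ht !andbT; apply/allP => y; rewrite mem_filter.
    by rewrite /= negbK => /andP[].
  have FTt : FT t = wprod FT [:: t] by rewrite /wprod big_seq1.
  rewrite wprod_cat -mulrA FTt -wprod_cat.
  have hst := straighten (@pkey_inj N) char0 (@br_closed_tpos K N) w2pos.
  rewrite size_cat addn1 in hst; have {}hst := hst (ltn0Sn _).
  apply: (lspan_map (f := fun y => wprod FT w1 * y)) hst _.
    by move=> a y z; rewrite mulrDr scalerAr.
  move=> _ [v [-> nv vpos _ /andP[v0 _]]]; rewrite -wprod_cat; apply: lspan_in.
  have nvw : normal (w1 ++ v).
    apply: normal_cat => //; first exact: normal_catl nw12.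
    move=> y z; rewrite mem_filter => /andP[/= hy _] zv; apply: key_ordT.
    have := allP vpos z zv; rewrite !tpos_key -ltnNge in hy *.
    exact: leq_trans.
  exists (w1 ++ v); split=> //; rewrite diag_supp_word //; apply/allPn.
  case: v v0 vpos {nv nvw} => [//|y v] _ /= /andP[hy _].
  by exists y; rewrite ?mem_cat ?inE ?eqxx ?orbT // pos_diag.
Qed.

(** A normal word with an off-diagonal letter begins with a negative letter or ends with a positive
    one. *)
Lemma offdiag_null s : S_in (fun m B => ~~ diag_supp m B) s -> null (Psi s).
Proof.
have neg_down (t v : T) : tneg v -> ordT key t v -> tneg t.
  by rewrite !tneg_key => hu /ordT_key; move/leq_ltn_trans; apply.
have pos_down (t v : T) : ~~ tpos v -> ordT key t v -> ~~ tpos t.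
  by rewrite !tpos_key -!ltnNge => hu /ordT_key; move/leq_ltn_trans; apply.
move/Psi_span => hs; apply: lspan_bind hs _ => _ [w [-> nw]].
rewrite diag_supp_word // => /allPn[t tw td].
have [tn|tn] := boolP (tneg t).
  rewrite (normal_split neg_down nw).
  have : t \in filter tneg w by rewrite mem_filter tn.
  have := filter_all tneg w; case: (filter tneg w) => //= y v /andP[hy _] _.
  by rewrite wprod_cons; apply: null_negM.
have tp : tpos t.
  by move: tn td; rewrite /tneg /tpos /tdiag -leqNgt leq_eqVlt val_eqE => /orP[->|].
rewrite (normal_split pos_down nw).
have : t \in filter (predC (fun u => ~~ tpos u)) w by rewrite mem_filter /= tp.
have := filter_all (predC (fun u => ~~ tpos u)) w.
case/lastP: (filter (predC _) w) => // v y; rewrite all_rcons /= negbK => /andP[hy _] _.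
rewrite -cats1 catA wprod_cat {2}/wprod big_seq1.
exact: null_Mpos.
Qed.

Lemma null_diag_unique s : S_in diag_supp s -> null (Psi s) -> s = 0.
Proof.
move=> hs /null_offdiag/span_Psi[t ht e].
have st : s = t.
  by apply/eqP; rewrite -subr_eq0; apply/eqP/Psi_inj; rewrite PsiB e subrr.
apply: spolyP => B; apply/mpolyP => m; rewrite spoly0E mcoeff0.
have [hd|hd] := boolP (diag_supp m B); last exact: hs.
by rewrite st ht ?negbK.
Qed.

End HarishChandraNull.

(** * Polynomials in the diagonal even variables *)

Section CartanPart.
Variables (K : fieldType) (N : nat).
Local Notation P := ('I_N * 'I_N)%type.
Local Notation T := (bool * P)%type.
Local Notation S := (spoly K P).
Local Notation n := #|{: P}|.
Local Notation rk i j := (enum_rank ((i, j) : P)).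

Definition dm (m : 'X_{1..N}) : 'X_{1..n} :=
  [multinom (if (enum_val i).1 == (enum_val i).2 then m (enum_val i).1 else 0%N) | i < n].
Definition dr (m : 'X_{1..n}) : 'X_{1..N} := [multinom m (rk i i) | i < N].
Definition diagm (m : 'X_{1..n}) : bool :=
  [forall p : P, (p.1 != p.2) ==> (m (enum_rank p) == 0%N)].

Lemma dmE m i j : dm m (rk i j) = if i == j then m i else 0%N.
Proof. by rewrite mnmE enum_rankK. Qed.
Lemma dmK m : dr (dm m) = m.
Proof. by apply/mnmP => i; rewrite mnmE dmE eqxx. Qed.
Lemma dm_diag m : diagm (dm m).
Proof.
by apply/forallP => -[i j]; apply/implyP => /= /negbTE ij; rewrite dmE ij.
Qed.
Lemma diagmP (m : 'X_{1..n}) : reflect (forall i j, i != j -> m (rk i j) = 0%N) (diagm m).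
Proof.
apply: (iffP forallP) => [h i j ij|h [i j]].
  by have := h (i, j); rewrite /= ij => /eqP.
by apply/implyP => /= ij; rewrite h.
Qed.
Lemma drK m : diagm m -> dm (dr m) = m.
Proof.
move=> /diagmP h; apply/mnmP => r; rewrite -(enum_valK r); case: (enum_val r) => i j.
rewrite dmE; case: (eqVneq i j) => [->|ij]; first by rewrite [dr m j]mnmE.
by rewrite h.
Qed.
Lemma dm_eq k m : (dm k == m) = diagm m && (dr m == k).
Proof.
apply/eqP/andP => [<-|[hm /eqP <-]]; first by rewrite dm_diag dmK eqxx.
exact: drK.
Qed.
Lemma mdeg_dm m : mdeg (dm m) = mdeg m.
Proof.
rewrite !mdegE (reindex (@enum_rank P)) /=; last first.
  by exists enum_val => ? _; rewrite ?enum_rankK ?enum_valK.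
transitivity (\sum_(i < N) \sum_(j < N) dm m (rk i j))%N.
  by rewrite pair_big /=; apply: eq_bigr => -[].
apply: eq_bigr => i _; rewrite (bigD1 i) //= dmE eqxx big1 ?addn0 // => j ij.
by rewrite dmE eq_sym (negbTE ij).
Qed.

Definition emb (f : mpoly N K) : S :=
  [ffun B => if B == set0 then \sum_(k <- msupp f) f@_k *: 'X_[dm k] else 0].

Lemma emb_coef f (B : {set P}) m :
  (emb f B)@_m = if (B == set0) && diagm m then f@_(dr m) else 0.
Proof.
rewrite ffunE; case: (B == set0); last exact: mcoeff0.
rewrite raddf_sum /=; case: ifP => hm; last first.
  by rewrite big1 // => k _; rewrite mcoeffZ mcoeffX dm_eq hm mulr0.
have [hr|hr] := boolP (dr m \in msupp f); last first.
  rewrite (memN_msupp_eq0 hr) big_seq big1 // => k hk.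
  rewrite mcoeffZ mcoeffX dm_eq hm /=; case: eqP => [e|]; last by rewrite mulr0.
  by rewrite e hk in hr.
rewrite (bigD1_seq (dr m)) ?msupp_uniq //= mcoeffZ mcoeffX dm_eq hm eqxx mulr1.
rewrite big1 ?addr0 // => k kd; rewrite mcoeffZ mcoeffX dm_eq hm /= eq_sym.
by rewrite (negbTE kd) mulr0.
Qed.

Lemma emb_linear a f g : emb (a *: f + g) = a *: emb f + emb g.
Proof.
apply: spolyP => B; apply/mpolyP => m; rewrite spolyDE spolyZE mcoeffD mcoeffZ !emb_coef.
by case: ifP; rewrite ?mcoeffD ?mcoeffZ ?mulr0 ?addr0.
Qed.

Lemma emb_eq0 f : emb f = 0 -> f = 0.
Proof.
move=> h; apply/mpolyP => m; have := congr1 (fun s : S => (s set0)@_(dm m)) h.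
by rewrite emb_coef spoly0E !mcoeff0 eqxx dm_diag dmK.
Qed.

Lemma embX m : emb 'X_[m] = smono K (dm m) set0.
Proof.
apply: spolyP => B; apply/mpolyP => k; rewrite emb_coef smono_coef mcoeffX dm_eq.
by case: (B == set0) => //=; case: (diagm k) => //=; rewrite eq_sym.
Qed.

(** Restriction of a polynomial function on matrices to diagonal matrices. *)
Definition res (p : {mpoly K[n]}) : mpoly N K :=
  p \mPo [tuple (if (enum_val i).1 == (enum_val i).2 then 'X_((enum_val i).1) else 0) | i < n].

Lemma res_X m : res 'X_[m] = if diagm m then 'X_[dr m] else 0.
Proof.
rewrite /res comp_mpolyX (reindex (@enum_rank P)) /=; last first.
  by exists enum_val => ? _; rewrite ?enum_rankK ?enum_valK.
under eq_bigr => p _ do rewrite tnth_mktuple enum_rankK.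
case: ifPn => [/diagmP h|/forallPn[[i j]]]; last first.
  rewrite negb_imply /= => /andP[/negbTE ij hm].
  rewrite (bigD1 ((i, j) : P)) //= ij expr0n (negbTE hm) mul0r.
  by [].
transitivity (\prod_(i < N) \prod_(j < N)
   (if i == j then 'X_i else 0 : mpoly N K) ^+ m (rk i j)).
  by rewrite pair_big /=; apply: eq_bigr => -[].
rewrite mpolyXE_id; apply: eq_bigr => i _; rewrite (bigD1 i) //= eqxx mnmE.
rewrite big1 ?mulr1 // => j ij; rewrite h ?expr0 // eq_sym.
exact: ij.
Qed.

Lemma res_coef p k : (res p)@_k = p@_(dm k).
Proof.
have resE : res p = \sum_(m <- msupp p) p@_m *: res 'X_[m].
  rewrite {1}(mpolyE p) /res raddf_sum; apply: eq_bigr => m _.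
  exact: comp_mpolyZ.
rewrite resE [in RHS](mpolyE p) !raddf_sum /=; apply: eq_bigr => m _.
rewrite !mcoeffZ res_X mcoeffX [m == _]eq_sym dm_eq.
by case: (diagm m); rewrite /= ?mcoeffX ?mcoeff0.
Qed.


Definition proj (Q : 'X_{1..n} -> {set P} -> bool) (s : S) : S :=
  [ffun B => \sum_(m <- msupp (s B) | Q m B) (s B)@_m *: 'X_[m]].

Lemma proj_coef Q s (B : {set P}) m : (proj Q s B)@_m = if Q m B then (s B)@_m else 0.
Proof.
rewrite ffunE raddf_sum /=.
have [hm|hm] := boolP (m \in msupp (s B)); last first.
  rewrite (memN_msupp_eq0 hm) if_same big_seq_cond big1 // => k /andP[hk _].
  rewrite mcoeffZ mcoeffX; case: eqP => [e|]; last by rewrite mulr0.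
  by rewrite e (negbTE hm) in hk.
rewrite big_mkcond (bigD1_seq m) ?msupp_uniq //= big1 ?addr0 => [|k km].
  by case: ifP; rewrite ?mcoeffZ ?mcoeffX ?eqxx ?mulr1.
by case: ifP => // _; rewrite mcoeffZ mcoeffX (negbTE km) mulr0.
Qed.

Lemma diag_supp_set0 m : diag_supp m set0 = diagm m.
Proof.
rewrite /diag_supp; apply/idP/diagmP => [/all_mword[h _] i j ij|h].
  by apply/eqP/negP => hm; have /negP := ij; apply; exact: (h (i, j) (introN idP hm)).
apply/all_mword; split=> [[i j]|p]; last by rewrite inE.
by rewrite /tdiag /=; apply: contraR => ij; rewrite h.
Qed.

Lemma diag_suppP (m : 'X_{1..n}) (B : {set P}) : reflect
  ((forall i j, i != j -> m (rk i j) = 0%N) /\ (forall i j, (i, j) \in B -> i = j))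
  (diag_supp m B).
Proof.
apply: (iffP idP) => [/all_mword[h1 h2]|[h1 h2]].
  split=> i j.
    by move=> ij; apply/eqP/negP => hm; have /negP := ij; apply; exact: (h1 (i, j) (introN idP hm)).
  by move=> hB; apply/eqP/(h2 (i, j)).
apply/all_mword; split=> [[i j]|[i j] hB].
  by rewrite /tdiag /=; apply: contraR => ij; rewrite h1.
by rewrite /tdiag /= (h2 i j).
Qed.

Lemma wprod_diag (w : seq T) : all (fun t => ~~ t.1 && tdiag t) w ->
  wprod (@FT K N) w = at_F ('X_[[multinom count_mem (false, (i, i)) w | i < N]] : mpoly N K).
Proof.
elim: w => [_|[b [i j]] w IH].
  have -> : [multinom count_mem (false, (i, i)) ([::] : seq T) | i < N] = 0%MM.
    by apply/mnmP => i; rewrite !mnmE.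
  by rewrite /wprod big_nil mpolyX0 at_F1.
rewrite /= {1}/tdiag /= => /andP[/andP[hb /eqP ij] hw]; rewrite -{j}ij.
rewrite wprod_cons IH // (negbTE hb) -[FT _ _]/(FU K (pos i) (pos i)) -(at_FXU K i) -at_FM.
rewrite -mpolyXD; congr (at_F 'X_[_]); apply/mnmP => k.
rewrite mnmDE !mnmE; congr (_ + _)%N; congr nat_of_bool.
by rewrite !xpair_eqE andbb.
Qed.

(** The F_ii commute, so the order in which a normal word lists them is immaterial. *)
Lemma at_F_Psi f : at_F f = Psi (emb f) :> UqN K N.
Proof.
rewrite (mpolyE f) at_FE raddf_sum /=.
have embD g h : emb (g + h) = emb g + emb h.
  by rewrite -[g in LHS]scale1r emb_linear scale1r.
have emb0 : emb 0 = 0 by apply: (addrI (emb 0)); rewrite -embD !addr0.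
rewrite (big_morph _ embD emb0) (big_morph _ (@PsiD K N) (@Psi0 K N)).
apply: eq_bigr => m _; rewrite -at_FE at_FZ -[_ *: 'X_[_] in RHS]addr0 emb_linear emb0 addr0.
rewrite PsiZ embX Psi_smono; congr (_ *: _); rewrite wprod_diag.
  by congr (at_F 'X_[_]); apply/mnmP => i; rewrite mnmE count_mword_even ?dmE ?eqxx //; exact: pkey_inj.
apply/all_mword; split=> [[i j]|p]; last by rewrite inE.
by rewrite dmE /tdiag /=; case: (i == j).
Qed.

End CartanPart.

Section ZmodIdentities.
Variable V : zmodType.
Lemma sub_sub_sub (a b u : V) : a - b = (u - b) - (u - a).
Proof. by rewrite opprB [RHS]addrC addrA subrK. Qed.
End ZmodIdentities.

Lemma lspan_subsub (F : fieldType) (V : lmodType F) (Q : V -> Prop) (a b u : V) :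
  lspan Q (u - a) -> lspan Q (u - b) -> lspan Q (a - b).
Proof. by move=> ha hb; rewrite (sub_sub_sub a b u); apply/lspan_add/lspan_opp. Qed.

Lemma comm_defect (V : pzRingType) (h u v : V) : u * h = h * u ->
  v * h - h * v = h * (u - v) - (u - v) * h.
Proof.
by move=> c; rewrite mulrBr mulrBl c opprB [RHS]addrC addrA subrK.
Qed.

(** * Existence, uniqueness and multiplicativity of the Harish-Chandra image *)

Section HarishChandraMap.
Variables (K : fieldType) (N : nat).
Hypothesis char0 : forall k, (k.+1%:R : K) != 0.
Local Notation P := ('I_N * 'I_N)%type.
Local Notation T := (bool * P)%type.
Local Notation S := (spoly K P).
Local Notation U := (UqN K N).
Local Notation rk i j := (enum_rank ((i, j) : P)).
Local Notation key := (@pkey N).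
Local Notation Phi := (@Phi K N key (@pkey_inj N)).
Local Notation FT := (@FT K N).
Local Notation lder := (@lder K N key).
Local Notation rder := (@rder K N key).
Local Notation xm i j := (@ev_mul K _ (((i : 'I_N), (j : 'I_N)) : P)).
Local Notation xd i j := (@ev_der K _ (((i : 'I_N), (j : 'I_N)) : P)).
Local Notation om i j := (@odd_mul K _ key (((i : 'I_N), (j : 'I_N)) : P)).
Local Notation od i j := (@odd_der K _ key (((i : 'I_N), (j : 'I_N)) : P)).
Local Notation diag_supp := (@diag_supp N).
Let char2 : (2%:R : K) != 0 := char0 1.

Lemma lder_even i j s : lder (pos i) (pos j) s =
  \sum_k xm i k (xd j k s) + \sum_k om i k (od j k s).
Proof. by rewrite /lder /left_der lend_sum big_sumType. Qed.
Lemma lder_odd i j s : lder (pos i) (neg j) s =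
  \sum_k xm i k (od j k s) + \sum_k om i k (xd j k s).
Proof. by rewrite /lder /left_der lend_sum big_sumType. Qed.
Lemma rder_even i j s : rder (pos i) (pos j) s =
  \sum_k xm k j (xd k i s) + \sum_k om k j (od k i s).
Proof.
rewrite /rder /right_der lend_sum big_sumType; congr (_ + _);
  by apply: eq_bigr => k _; rewrite lendZ andbF expr0 scale1r.
Qed.
Lemma rder_odd i j s : rder (pos i) (neg j) s =
  \sum_k om k j (xd k i s) - \sum_k xm k j (od k i s).
Proof.
rewrite /rder /right_der lend_sum big_sumType -sumrN; congr (_ + _);
  by apply: eq_bigr => k _; rewrite lendZ /= ?expr0 ?expr1 ?scale1r ?scaleN1r.
Qed.

Lemma HC_unique (u : U) f g : HC_null (u - at_F f) -> HC_null (u - at_F g) -> f = g.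
Proof.
move=> /HC_null_null hf /HC_null_null hg; apply/eqP; rewrite -subr_eq0; apply/eqP.
apply: (@emb_eq0 K); apply: (null_diag_unique char2) => [B m|].
  rewrite emb_coef; case: eqP => //= ->; rewrite diag_supp_set0.
  by move=> /negbTE ->.
rewrite -at_F_Psi at_FB.
exact: lspan_subsub hf hg.
Qed.

(** For an even element supercommutation carries no sign, and commuting with the generators F_ij is
    enough ([comm_homog]). *)
Definition ecentral (u : U) := U_homog false u /\ forall i j, u * FU K i j = FU K i j * u.

Lemma ecentral_FT u t : ecentral u -> u * FT t = FT t * u.
Proof. by case=> _; apply. Qed.

Lemma at_F_null f (u : U) : null u -> null (at_F f * u).
Proof.
move=> hu; rewrite at_FE /mmap mulr_suml; apply: lspan_sum => m _.
rewrite /= mulr_algl -scalerAl; apply: lspan_scale; rewrite /mmap1.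
elim/big_rec: _ => [|i v _ IH]; first by rewrite mul1r.
rewrite -mulrA; elim: (m i) => [|k IHk]; first by rewrite expr0 mul1r.
rewrite exprS -mulrA; apply: (null_diag_mul (t := (false, (i, i)))) IHk.
exact: eqxx.
Qed.

(** u w - fg = (u - f) w + f (w - g) in U(q_N). The null space is stable under right multiplication
    by the central w, which passes through n_+, and under left multiplication by polynomials in the
    F_ii, which normalize n_-. *)
Lemma HC_mul (u w : U) f g : ecentral w -> HC_null (u - at_F f) -> HC_null (w - at_F g) ->
  HC_null (u * w - at_F (f * g)).
Proof.
move=> cw /HC_null_null hu /HC_null_null hw; apply: null_HC_null; rewrite at_FM.
rewrite (_ : _ - _ = (u - at_F f) * w + at_F f * (w - at_F g)).
  apply: lspan_add; last exact: at_F_null.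
  apply: null_mulr hu => t _; rewrite (ecentral_FT t cw) subrr; exact: lspan_nil.
by rewrite mulrBl mulrBr addrA subrK.
Qed.

Lemma HC_lin a (u w : U) f g : HC_null (u - at_F f) -> HC_null (w - at_F g) ->
  HC_null (a *: u + w - at_F (a *: f + g)).
Proof.
move=> /HC_null_null hu /HC_null_null hw; apply: null_HC_null.
rewrite at_FD at_FZ opprD addrACA -scalerBr; move: hu hw.
move: (u - _) (w - _) => x y hx hy.
exact: lspan_add (lspan_scale a hx) hy.
Qed.


Lemma ecentral_lin a u w : ecentral u -> ecentral w -> ecentral (a *: u + w).
Proof.
move=> [hu cu] [hw cw]; split; first exact: UH_lin.
by move=> i j; rewrite mulrDl mulrDr -scalerAl -scalerAr cu cw.
Qed.
Lemma ecentral_mul u w : ecentral u -> ecentral w -> ecentral (u * w).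
Proof.
move=> [hu cu] [hw cw]; split; first exact: (U_homogM hu hw).
by move=> i j; rewrite -mulrA cw !mulrA cu.
Qed.
Lemma ecentral1 : ecentral 1.
Proof. by split=> [|i j]; [exact: UH_one|rewrite mul1r mulr1]. Qed.

Lemma word_homog w : U_homog (wpar w) (wprod FT w).
Proof.
elim: w => [|t w IH]; first by rewrite /wprod big_nil; exact: UH_one.
rewrite wprod_cons; apply: UH_mul IH => /=.
by have h := @gl_homogF K N (idxT t).1 (idxT t).2;
  rewrite -[par _ (+) par _]/(par2 (idxT t)) par2_idxT in h; exact: h.
Qed.

Lemma Psi_homog p s : S_in (fun _ B => odd #|B| == p) s -> U_homog p (Psi s : U).
Proof.
move/Psi_span; elim=> [|a v w [x [-> nx /eqP px]] _ IH]; first exact: UH_zero.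
by apply: UH_lin => //; rewrite -px -(wpar_normal nx); apply: word_homog.
Qed.

Lemma lder_noxi i j (s : S) : (forall B, B != set0 -> s B = 0) ->
  forall B, B != set0 -> lder (pos i) (pos j) s B = 0.
Proof.
move=> hs B B0; rewrite lder_even spolyDE !spoly_sumE !big1 ?addr0 // => k _.
  have -> : od j k s = 0.
    apply: spolyP => C; rewrite odd_derE spoly0E; case: ifP => // _.
    by rewrite hs ?scaler0 //; apply/set0Pn; exists (j, k); rewrite setU11.
  by rewrite linear0 spoly0E.
by rewrite ev_mulE ev_derE hs // mderiv0 mulr0.
Qed.

Lemma Phi_at_F_noxi f (B : {set P}) : B != set0 -> Phi (at_F f) B = 0.
Proof.
rewrite at_F_Psi => B0.
rewrite /Psi /mono_map Phi_sum spoly_sumE big1 // => C _.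
rewrite Phi_sum spoly_sumE big1 // => m _; rewrite PhiZ spolyZE.
have [->|cm] := eqVneq (emb f C)@_m 0; first by rewrite scale0r.
have /andP[/eqP C0 dmm] : (C == set0) && diagm m.
  by move: cm; rewrite emb_coef; case: ifP; rewrite ?eqxx.
rewrite C0; apply/eqP; rewrite scaler_eq0; apply/orP; right; apply/eqP.
have : all (fun t => ~~ t.1 && tdiag t) (mword key m set0).
  apply/all_mword; split=> [[i j]|p]; last by rewrite inE.
  by rewrite /tdiag /=; apply: contraR => ij; rewrite (diagmP _ dmm).
move: B B0; elim: (mword _ _ _) => [|[b [i j]] w IH] B B0.
  by rewrite /wprod big_nil /Phi Act1 lend1 ffunE (negbTE B0).
rewrite /= {1}/tdiag /= => /andP[/andP[/negbTE-> _] hw].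
rewrite wprod_cons PhiFl spolyDE lder_noxi ?addr0 //; last by move=> C' hC'; apply: IH.
by rewrite /zvar /= ev_mulE IH ?mulr0.
Qed.

(* Invariance under the odd F_{i,-i} kills the terms xi_ii: modulo the
   off-diagonal variables, the adjoint action of F_{i,-i} is 2 x_ii d/dxi_ii. *)
Lemma ad_odd_diag (s : S) i : lder (pos i) (neg i) s = rder (pos i) (neg i) s ->
  forall (B : {set P}) m, diag_supp m B -> (i, i) \in B -> (s B)@_m = 0.
Proof.
move=> hs B m /diag_suppP[dm dB] iB.
pose M := (m + U_(rk i i))%MM; pose B' := B :\ ((i, i) : P).
have MU k l : M (rk k l) == 0%N = false -> k = l.
  move=> h; apply/eqP/negP => /negP kl; move: h.
  rewrite mnmDE dm // mnm1E (inj_eq enum_rank_inj) xpair_eqE.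
  case: (eqVneq i k) => [ik|//] /=; case: (eqVneq i l) => // il _.
  by rewrite -ik -il eqxx in kl.
have BB : (i, i) \notin B' by rewrite !inE eqxx.
have main (k l : 'I_N) : k == i -> l == i -> (xm k l (od k l s) B')@_M = koszul K key (i, i) B' * (s B)@_m.
  move=> /eqP-> /eqP->; rewrite ev_mul_coef mnmDE mnm1E eqxx addn1 /= addmK.
  by rewrite odd_derE (negbTE BB) mcoeffZ setD1K.
have om0 (k l a b : 'I_N) : (om k l (xd a b s) B')@_M = 0 \/ (k = l /\ k != i).
  rewrite odd_mulE; case: ifP => [klB|]; last by rewrite mcoeff0; left.
  right; move: klB; rewrite !inE xpair_eqE => /andP[h1 /dB kl].
  by split=> //; move: h1; rewrite -kl andbb.
have oml k : (om i k (xd i k s) B')@_M = 0.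
  by case: (om0 i k i k) => // -[_]; rewrite eqxx.
have omr k : (om k i (xd k i s) B')@_M = 0.
  by case: (om0 k i k i) => // -[->]; rewrite eqxx.
have xl k : k != i -> (xm i k (od i k s) B')@_M = 0.
  move=> ki; rewrite ev_mul_coef; case: ifP => // /MU ik.
  by rewrite ik eqxx in ki.
have xr k : k != i -> (xm k i (od k i s) B')@_M = 0.
  move=> ki; rewrite ev_mul_coef; case: ifP => // /MU ik.
  by rewrite ik eqxx in ki.
have := congr1 (fun s : S => (s B')@_M) hs.
rewrite lder_odd rder_odd spolyDE spolyBE !spoly_sumE mcoeffD mcoeffB.
rewrite !(raddf_sum (mcoeff M)).
have -> : \sum_k (om i k (xd i k s) B')@_M = 0 by apply: big1.
have -> : \sum_k (om k i (xd k i s) B')@_M = 0 by apply: big1.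
have -> : \sum_k (xm i k (od i k s) B')@_M = koszul K key (i, i) B' * (s B)@_m.
  by rewrite (bigD1 i) //= big1 ?addr0 ?main.
have -> : \sum_k (xm k i (od k i s) B')@_M = koszul K key (i, i) B' * (s B)@_m.
  by rewrite (bigD1 i) //= big1 ?addr0 ?main.
rewrite addr0 sub0r.
move/eqP; rewrite -subr_eq0 opprK -mulr2n -mulr_natl mulf_eq0 (negbTE char2) /= mulf_eq0 => /orP[].
  by move/eqP/(congr1 (fun x => koszul K key (i, i) B' * x)); rewrite koszulK mulr0 => /eqP; rewrite oner_eq0.
by move/eqP.
Qed.

(** Modulo n_- U + U n_+, u is a combination v of ordered monomials in the F_ii and the odd
    F_(i,-i). It has to be shown that no odd factor occurs, and this comes from the commutation of v
    with the F_(i,-i). *)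
Lemma HC_exists u : ecentral u -> exists f, HC_null (u - at_F f).
Proof.
move=> cu; have [hu cu'] := cu.
have [t ht tu] := words_Psi char2 (homog_words hu).
pose td := proj diag_supp t; pose v : U := Psi td.
have htd : S_in diag_supp td by move=> B m h; rewrite proj_coef (negbTE h).
have hv : U_homog false v.
  apply: Psi_homog => B m h; rewrite proj_coef.
  by case: ifP => // _; apply: ht.
have nuv : null (u - v).
  rewrite -tu /v -PsiB; apply: (offdiag_null) => B m; rewrite negbK => h.
  by rewrite spolyBE mcoeffB proj_coef h subrr.
(* The commutator of v with the diagonal letter h is again a combination of diagonal monomials. As u
   commutes with h, it equals h (u - v) - (u - v) h, which is null; but only 0 is both diagonal and
   null. *)
have cv i : v * FT (true, (i, i)) = FT (true, (i, i)) * v.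
  set h := FT _; have di : tdiag ((true, (i, i)) : T) by apply: eqxx.
  have hspan x : lspan (normal_in (fun m B => diag_supp m B)) x ->
      exists2 s, S_in diag_supp s & Psi s = x := @span_Psi K N _ x.
  have diagw w : (0 < size w)%N -> all (@tdiag N) w ->
      lspan (normal_in diag_supp) (wprod FT w).
    move=> w0 dw; have := straighten (@pkey_inj N) char2 (@br_closed_tdiag K N) dw w0.
    move=> hs; apply: lspan_mono hs _ => _ [x [-> nx dx _ _]].
    by exists x; split; rewrite ?diag_supp_word.
  have [s hs sE] : exists2 s, S_in diag_supp s & Psi s = v * h - h * v.
    apply: span_Psi.
    apply: (lspan_map (f := fun x => x * h - h * x)) (Psi_span htd) _.
      move=> a x y; rewrite mulrDl mulrDr -scalerAl -scalerAr opprD addrACA.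
      by rewrite scalerBr.
    move=> _ [w [-> nw]]; rewrite diag_supp_word // => dw.
    rewrite -wprod_cons; have -> : wprod FT w * h = wprod FT (w ++ [:: (true, (i, i))]).
      by rewrite wprod_cat {3}/wprod big_seq1.
    by apply: lspan_add; last apply: lspan_opp; apply: diagw; rewrite ?size_cat ?addn1 //= ?all_cat dw /= ?andbT.
  have : null (Psi s).
    rewrite sE (_ : _ - _ = h * (u - v) - (u - v) * h).
      by apply: lspan_add; last apply: lspan_opp; [apply: null_diag_mul|apply: null_mul_diag].
    exact: comm_defect (ecentral_FT _ cu).
  move/(null_diag_unique char2 hs) => s0; move: sE; rewrite s0 Psi0.
  by move/esym/eqP; rewrite subr_eq0 => /eqP.
have PhiV (B : {set P}) m : diag_supp m B -> B != set0 -> (Phi v B)@_m = 0.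
  move=> dBm /set0Pn[[i j] ijB]; have [_ hB] := diag_suppP _ _ dBm.
  have ij := hB i j ijB; rewrite -{j}ij in ijB.
  apply: (ad_odd_diag (i := i)) => //; apply: Phi_central => //.
  exact: (cv i).
pose t0 : S := emb (res (td set0)); pose t1 := td - t0.
have t0E (B : {set P}) m : (t0 B)@_m = if B == set0 then (td B)@_m else 0.
  rewrite emb_coef; case: eqP => [->|//] /=; case: ifPn => hm; first by rewrite res_coef drK.
  by rewrite htd // diag_supp_set0.
have t1E (B : {set P}) m : (t1 B)@_m = if B == set0 then 0 else (td B)@_m.
  by rewrite spolyBE mcoeffB t0E; case: ifP; rewrite ?subrr ?subr0.
(* [t1] collects the diagonal monomials with odd factors. Its leading part is that of [Phi v] minus
   [Phi] of a polynomial in the F_ii; neither has diagonal terms with odd factors, so the degree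
   bound on [t1] drops until [t1] is 0. *)
have t10 : t1 = 0.
  suff h d : deg_lt d t1 -> deg_lt 0 t1.
    by have [d /h] := deg_lt_exists t1; apply: deg_lt0P.
  elim: d => // d IH hd; apply: IH => B m dle.
  rewrite t1E; case: ifPn => // B0.
  have [dBm|/htd //] := boolP (diag_supp m B).
  have := Phi_Psi hd dle; rewrite spolyBE mcoeffB t1E (negbTE B0).
  have -> : Phi (Psi t1) = Phi v - Phi (at_F (res (td set0))).
    by rewrite at_F_Psi /v -PhiB -PsiB.
  rewrite spolyBE mcoeffB PhiV // Phi_at_F_noxi // mcoeff0.
  by rewrite subr0 sub0r => /eqP; rewrite oppr_eq0 => /eqP.
exists (res (td set0)); apply: null_HC_null; rewrite at_F_Psi -/t0.
have -> : t0 = td by apply/eqP; rewrite eq_sym -subr_eq0 -/t1 t10.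
exact: nuv.
Qed.

End HarishChandraMap.

(** * Injectivity of the Harish-Chandra map *)

Section Chevalley.
Variables (K : fieldType) (N : nat).
Hypothesis char0 : forall k, (k.+1%:R : K) != 0.
Local Notation P := ('I_N * 'I_N)%type.
Local Notation S := (spoly K P).
Local Notation n := #|{: P}|.
Local Notation rk t := (enum_rank (t : P)).
Local Notation key := (@pkey N).
Local Notation lder := (@lder K N key).
Local Notation rder := (@rder K N key).

Definition off (t : P) : nat := t.1 != t.2.
(** The induction measure is [offdeg m + #|B|]: odd variables count even when they are diagonal,
    since they too must disappear. *)
Definition offdeg (m : 'X_{1..n}) : nat := (\sum_t off t * m (rk t))%N.

Lemma offdegD m m' : offdeg (m + m')%MM = (offdeg m + offdeg m')%N.
Proof. by rewrite -big_split; apply: eq_bigr => t _; rewrite mnmDE mulnDr. Qed.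
Lemma offdegU t : offdeg U_(rk t)%MM = off t.
Proof.
rewrite /offdeg (bigD1 t) //= mnm1E eqxx muln1 big1 ?addn0 // => u ut.
by rewrite mnm1E (inj_eq enum_rank_inj) eq_sym (negbTE ut) muln0.
Qed.

Section Invariant.
Variables (s : S) (e : nat).
Hypothesis evenI : forall i j, lder (pos i) (pos j) s = rder (pos i) (pos j) s.
Hypothesis oddI : forall i j, lder (pos i) (neg j) s = rder (pos i) (neg j) s.
Hypothesis diag0 : forall m, diagm m -> mdeg m = e -> (s set0)@_m = 0.

Section Step.
Variable y : nat.
Hypothesis IH : forall (B : {set P}) m,
  (mdeg m + #|B|)%N = e -> (offdeg m + #|B| < y)%N -> (s B)@_m = 0.
Variables (B : {set P}) (m : 'X_{1..n}).
Hypothesis deg_e : (mdeg m + #|B|)%N = e.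

Lemma mnm_sub1 t : m (rk t) != 0%N -> exists m', m = (m' + U_(rk t))%MM.
Proof. by move=> mt; exists (m - U_(rk t))%MM; rewrite submK // lep1mP. Qed.

(** The coefficient at (m, B) comes from the monomial of s in which the factor t is replaced by u.
    Total degree is preserved, and the hypothesis says that the measure falls below y. The next
    three lemmas treat the other parities of t and u, with 1 in place of [off] for an odd
    variable. *)
Lemma low_xx (t u : P) : (offdeg m + #|B| + off u < y + off t)%N ->
  (ev_mul t (ev_der u s) B)@_m = 0.
Proof.
move=> lt; rewrite ev_mul_coef; case: ifPn => // /mnm_sub1[m' E].
rewrite ev_der_coef IH ?mul0rn //; move: deg_e lt; rewrite E addmK !mdegD !mdeg1 !offdegD !offdegU; lia.
Qed.
Lemma low_oo (t u : P) : (offdeg m + #|B| < y)%N ->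
  (odd_mul key t (odd_der key u s) B)@_m = 0.
Proof.
move=> lt; rewrite odd_mulE; case: ifP => tB; last by rewrite mcoeff0.
rewrite mcoeffZ odd_derE; case: ifPn => [|uB]; first by rewrite mcoeff0 mulr0.
have Bu : #|u |: B :\ t| = #|B| by rewrite cardsU1 uB (cardsD1 t B) tB.
by rewrite mcoeffZ IH ?mulr0 ?Bu.
Qed.
Lemma low_xo (t u : P) : (offdeg m + #|B| + 1 < y + off t)%N ->
  (ev_mul t (odd_der key u s) B)@_m = 0.
Proof.
move=> lt; rewrite ev_mul_coef; case: ifPn => // /mnm_sub1[m' E].
rewrite odd_derE; case: ifPn => [|uB]; first by rewrite mcoeff0.
rewrite mcoeffZ IH ?mulr0 // cardsU1 uB; move: deg_e lt;
  rewrite E addmK !mdegD !mdeg1 !offdegD !offdegU; lia.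
Qed.
Lemma low_ox (t u : P) : (offdeg m + #|B| + off u < y + 1)%N ->
  (odd_mul key t (ev_der u s) B)@_m = 0.
Proof.
move=> lt; rewrite odd_mulE; case: ifP => tB; last by rewrite mcoeff0.
have cB : #|B| = #|B :\ t|.+1 by rewrite (cardsD1 t B) tB.
have h1 : (mdeg (m + U_(rk u))%MM + #|B :\ t|)%N = e.
  by rewrite -deg_e cB mdegD mdeg1 addn1 addnS addSn.
have h2 : (offdeg (m + U_(rk u))%MM + #|B :\ t| < y)%N.
  by move: lt; rewrite cB offdegD offdegU addnS addSn addn1 ltnS addnAC.
by rewrite mcoeffZ ev_der_coef (IH h1 h2) mul0rn mulr0.
Qed.

End Step.

Section Reduction.
Variable y : nat.
Hypothesis IH : forall (B : {set P}) m,
  (mdeg m + #|B|)%N = e -> (offdeg m + #|B| < y)%N -> (s B)@_m = 0.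

Lemma even_step (i j : 'I_N) (B : {set P}) k (m : 'X_{1..n}) : i != j -> (m (rk (j, j)) < k)%N ->
  m (rk (j, i)) != 0%N -> (mdeg m + #|B|)%N = e -> (offdeg m + #|B|)%N = y ->
  (s B)@_m = 0.
Proof.
move=> ij; elim: k m => // k IHk m; rewrite ltnS => mk mji me my.
have [m1 mE] := mnm_sub1 mji.
pose M := (m1 + U_(rk (i, i)))%MM.
have U1 t u : (U_(rk t) : 'X_{1..n})%MM (rk u) = (t == u).
  by rewrite mnm1E (inj_eq enum_rank_inj).
have oji : off (j, i) = 1%N by rewrite /off /= eq_sym ij.
have oii k' : off (k', k') = 0%N by rewrite /off /= eqxx.
have ME : (mdeg M + #|B|)%N = e by move: me; rewrite mE /M !mdegD !mdeg1.
have My : (offdeg M + #|B|).+1 = y.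
  by move: my; rewrite mE /M !offdegD !offdegU oji oii; lia.
have := congr1 (fun s : S => (s B)@_M) (evenI i j).
rewrite lder_even rder_even !spolyDE !spoly_sumE !mcoeffD !(raddf_sum (mcoeff M)).
have z1 : \sum_k0 (odd_mul key (i, k0) (odd_der key (j, k0) s) B)@_M = 0.
  by apply: big1 => k0 _; apply: (low_oo IH) => //; rewrite -My.
have z2 : \sum_k0 (odd_mul key (k0, j) (odd_der key (k0, i) s) B)@_M = 0.
  by apply: big1 => k0 _; apply: (low_oo IH) => //; rewrite -My.
have z3 : \sum_k0 (ev_mul (k0, j) (ev_der (k0, i) s) B)@_M = 0.
  rewrite (bigD1 j) //= big1 => [|k0 kj].
    rewrite addr0 ev_mul_coef; case: ifPn => // /mnm_sub1[m2 E2].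
    rewrite ev_der_coef E2 addmK.
    have Ejj : (m2 (rk (j, j))).+1 = m1 (rk (j, j)).
      have := congr1 (fun m : 'X_{1..n} => m (rk (j, j))) E2.
      by rewrite /M !mnmDE !U1 !xpair_eqE !eqxx (negbTE ij) /= addn0 addn1 => <-.
    rewrite IHk ?mul0rn //.
    - have jiE : ((j, i) == (j, j)) = false by rewrite xpair_eqE eqxx (negbTE ij).
      by rewrite mnmDE U1 jiE addn0 Ejj; apply: leq_trans mk; rewrite mE mnmDE U1 jiE addn0.
    - by rewrite mnmDE U1 eqxx addn1.
    - by move: ME; rewrite E2 !mdegD !mdeg1.
    - by rewrite -My E2 !offdegD !offdegU oji oii; lia.
  apply: (low_xx IH) => //; rewrite -My {2}/off /= kj /off; case: (_ != _) => /=; lia.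
have z4 : \sum_k0 (ev_mul (i, k0) (ev_der (j, k0) s) B)@_M = (s B)@_m *+ m (rk (j, i)).
  rewrite (bigD1 i) //= big1 => [|k0 ki].
    rewrite addr0 ev_mul_coef mnmDE U1 eqxx addn1 /= addmK ev_der_coef -mE; congr (_ *+ _).
    by rewrite mE mnmDE U1 eqxx addn1.
  apply: (low_xx IH) => //; rewrite -My {2}/off /= eq_sym ki /off; case: (_ != _) => /=; lia.
rewrite z1 z2 z3 z4 !addr0 -mulr_natl => /eqP; rewrite mulf_eq0.
by case: (m _) mji => // k1 _; rewrite (negbTE (char0 _)) => /eqP.
Qed.

Lemma odd_step (i j : 'I_N) (B : {set P}) k (m : 'X_{1..n}) : (m (rk (j, j)) < k)%N ->
  (j, i) \in B -> (mdeg m + #|B|)%N = e -> (offdeg m + #|B|)%N = y ->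
  (s B)@_m = 0.
Proof.
elim: k m => // k IHk m; rewrite ltnS => mk jiB me my.
pose M := (m + U_(rk (i, i)))%MM; pose B' := B :\ ((j, i) : P).
have U1 t u : (U_(rk t) : 'X_{1..n})%MM (rk u) = (t == u).
  by rewrite mnm1E (inj_eq enum_rank_inj).
have oii k' : off (k', k') = 0%N by rewrite /off /= eqxx.
have cB : #|B| = #|B'|.+1 by rewrite (cardsD1 (j, i)) jiB.
have ME : (mdeg M + #|B'|)%N = e by move: me; rewrite /M !mdegD !mdeg1 cB; lia.
have My : (offdeg M + #|B'|).+1 = y.
  by move: my; rewrite /M !offdegD !offdegU oii cB; lia.
have jiB' : (j, i) \notin B' by rewrite !inE eqxx.
have key1 : koszul K key (j, i) B' != 0.
  apply/eqP => k0; have := koszulK K key (j, i) B'.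
  by rewrite k0 mul0r => /esym/eqP; rewrite oner_eq0.
have := congr1 (fun s : S => (s B')@_M) (oddI i j).
rewrite lder_odd rder_odd spolyDE spolyBE !spoly_sumE mcoeffD mcoeffB !(raddf_sum (mcoeff M)).
have z1 : \sum_k0 (odd_mul key (i, k0) (ev_der (j, k0) s) B')@_M = 0.
  apply: big1 => k0 _; apply: (low_ox IH) => //; rewrite -My /off.
  by case: (_ != _) => /=; lia.
have z2 : \sum_k0 (odd_mul key (k0, j) (ev_der (k0, i) s) B')@_M = 0.
  apply: big1 => k0 _; apply: (low_ox IH) => //; rewrite -My /off.
  by case: (_ != _) => /=; lia.
have main t : (odd_der key (j, i) s B')@_t = koszul K key (j, i) B' * (s B)@_t.
  by rewrite odd_derE (negbTE jiB') mcoeffZ setD1K.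
have z4 : \sum_k0 (ev_mul (i, k0) (odd_der key (j, k0) s) B')@_M = koszul K key (j, i) B' * (s B)@_m.
  rewrite (bigD1 i) //= big1 => [|k0 ki].
    by rewrite addr0 ev_mul_coef mnmDE U1 eqxx addn1 /= addmK main.
  by apply: (low_xo IH) => //; rewrite -My /off /= eq_sym ki /=; lia.
(* For i = j the right adjoint term repeats the left one with the opposite sign, which gives the
   factor 1 + b = 2 below. For i <> j the term k0 = j has a smaller exponent of x_jj and vanishes by
   the inner induction. *)
have z3 : exists b : bool, \sum_k0 (ev_mul (k0, j) (odd_der key (k0, i) s) B')@_M
    = b%:R * (koszul K key (j, i) B' * (s B)@_m).
  exists (i == j); rewrite (bigD1 j) //= big1 => [|k0 kj]; last first.
    by apply: (low_xo IH) => //; rewrite -My /off /= kj /=; lia.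
  rewrite addr0 ev_mul_coef; have [E|ij] := eqVneq i j.
    have -> : M = (m + U_(rk (j, j)))%MM by rewrite /M E.
    by rewrite mnmDE U1 eqxx addn1 addmK main mul1r.
  case: ifPn => [_|/mnm_sub1[m2 E2]]; first by rewrite mul0r.
  rewrite main E2 addmK mul0r IHk ?mulr0 //.
  - have := congr1 (fun m : 'X_{1..n} => m (rk (j, j))) E2.
    by rewrite /M !mnmDE !U1 !xpair_eqE !eqxx (negbTE ij) /= addn0 addn1 => E; rewrite -ltnS -E.
  - by move: ME; rewrite E2 !mdegD !mdeg1 cB; lia.
  - by rewrite -My E2 !offdegD !offdegU oii cB; lia.
have [b z3'] := z3.
rewrite z1 z2 z4 z3' addr0 sub0r => /eqP; rewrite -subr_eq0 opprK.
have -> : koszul K key (j, i) B' * (s B)@_m + b%:R * (koszul K key (j, i) B' * (s B)@_m)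
   = (1 + b%:R) * (koszul K key (j, i) B' * (s B)@_m) by rewrite mulrDl mul1r.
rewrite mulf_eq0 mulf_eq0 (negbTE key1) => /orP[|/eqP//].
by case: b {z3'}; rewrite ?addr0 ?oner_eq0 // -(natrD _ 1 1) (negbTE (char0 1)).
Qed.

End Reduction.

(* Induction on the number y of off-diagonal or odd factors.  If x_ji (i <> j)
   or xi_ji divides a monomial, apply the invariance under F_ij, resp.
   F_{i,-j}, and look at the coefficient of the monomial in which that factor is
   replaced by x_ii, resp. multiplied by x_ii and deprived of xi_ji: up to
   smaller y, it involves only the given monomial and one with a smaller
   exponent of x_jj. *)
Lemma chevalley (B : {set P}) m : (mdeg m + #|B|)%N = e -> (s B)@_m = 0.
Proof.
suff h y : forall (B : {set P}) m,
    (mdeg m + #|B|)%N = e -> (offdeg m + #|B| < y)%N -> (s B)@_m = 0.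
  by move=> me; apply: (h _ B m me (leqnn _)).
elim: y => // y IH {}B {}m me; rewrite ltnS leq_eqVlt => /orP[/eqP my|/(IH _ _ me)//].
have [B0|/set0Pn[[j i] jiB]] := eqVneq B set0; last exact: (odd_step IH (leqnn _) jiB).
have [dm|/diagmP ndm] := boolP (diagm m).
  by rewrite B0 diag0 // -me B0 cards0 addn0.
have [ji /andP[ji1 ji2]] : exists t : P, (t.1 != t.2) && (m (rk t) != 0%N).
  apply/existsP; rewrite -[X in is_true X]negbK; apply/negP => /existsPn h; apply: ndm => i j ij.
  by have := h (i, j); rewrite /= ij negbK => /eqP.
case: ji ji1 ji2 => j i /= ji1 ji2.
by apply: (even_step IH _ (leqnn _) ji2) => //; rewrite eq_sym.
Qed.

End Invariant.
End Chevalley.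

Lemma msize_deg (K : nzRingType) (N : nat) d (f : mpoly N K) : (msize f <= d)%N <-> (forall m, (d <= mdeg m)%N -> f@_m = 0).
Proof.
split=> [fd m dm|h]; first by apply: memN_msupp_eq0; apply/negP => /msize_mdeg_lt; lia.
rewrite msizeE; apply/bigmax_leqP_seq => m mf _; rewrite ltnNge; apply/negP => /h/eqP.
by rewrite mcoeff_eq0 mf.
Qed.

Section HCInjective.
Variables (K : fieldType) (N : nat).
Hypothesis char0 : forall k, (k.+1%:R : K) != 0.
Local Notation P := ('I_N * 'I_N)%type.
Local Notation S := (spoly K P).
Local Notation U := (UqN K N).
Local Notation key := (@pkey N).
Local Notation Phi := (@Phi K N key (@pkey_inj N)).
Let char2 : (2%:R : K) != 0 := char0 1.

(* The leading parts of z, of Phi z and of HC z agree on the diagonal. *)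
Lemma HC_lead d (u : U) f t : ecentral u -> HC_null (u - at_F f) -> u = Psi t ->
  deg_lt d.+1 t -> (forall m, mdeg m = d -> f@_m = 0) -> deg_lt d t.
Proof.
move=> cu hf ut dt fd.
have [s hs sE] : exists2 s : S, S_in (fun m B => ~~ diag_supp m B) s & Psi s = u - at_F f.
  exact/span_Psi/(null_offdiag char2)/HC_null_null.
have tE : t = s + emb f.
  by apply/eqP; rewrite -subr_eq0; apply/eqP; apply: (@Psi_inj K N); rewrite PsiB PsiD sE -at_F_Psi subrK -ut subrr.
have dPhi : deg_lt d (Phi u - t) by rewrite ut; apply: Phi_Psi.
suff h : forall (B : {set P}) m, (mdeg m + #|B|)%N = d -> (Phi u B)@_m = 0.
  move=> B m; rewrite leq_eqVlt => /orP[/eqP dE|/dt//].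
  have := dPhi B m; rewrite -dE leqnn spolyBE mcoeffB h // => /(_ isT) /eqP.
  by rewrite sub0r oppr_eq0 => /eqP.
have [hu cu'] := cu.
apply: chevalley => // [i j|i j|m dm md].
- exact: Phi_central.
- exact: Phi_central.
have := dPhi set0 m; rewrite cards0 addn0 md leqnn spolyBE mcoeffB => /(_ isT)/eqP.
rewrite subr_eq0 => /eqP ->; rewrite tE spolyDE mcoeffD emb_coef eqxx dm /= fd ?addr0.
  by apply: hs; rewrite negbK diag_supp_set0.
by rewrite -md -[in RHS](drK dm) mdeg_dm.
Qed.

(** [HC_lead] is iterated downwards from an arbitrary bound. The case f = 0, d = 0 is injectivity;
    in general it allows the leading parts to be compared in [HC_top]. *)
Lemma HC_deg d (u : U) f t : ecentral u -> HC_null (u - at_F f) -> u = Psi t ->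
  (msize f <= d)%N -> deg_lt d t.
Proof.
move=> cu hf ut /msize_deg fd.
have [e] := deg_lt_exists t; elim: e => [|e IH] te; first exact: deg_ltW te.
have [ed|de] := leqP e.+1 d; first exact: deg_ltW te.
by apply/IH/(HC_lead cu hf ut te) => m me; apply: fd; rewrite me.
Qed.

Lemma HC_inj (u : U) : ecentral u -> HC_null (u - at_F 0) -> u = 0.
Proof.
move=> cu hf; have [t _ tu] := words_Psi char2 (homog_words cu.1).
have := HC_deg (d := 0) cu hf (esym tu); rewrite msize0 => /(_ isT) /deg_lt0P t0.
by rewrite -tu t0 Psi0.
Qed.

Lemma HC_top d (u : U) f : ecentral u -> HC_null (u - at_F f) -> (msize f <= d.+1)%N ->
  (msize (f - res (Phi u set0)) <= d)%N.
Proof.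
move=> cu hf fd; have [t _ tu] := words_Psi char2 (homog_words cu.1).
have dt := HC_deg cu hf (esym tu) fd.
have [s hs sE] : exists2 s : S, S_in (fun m B => ~~ diag_supp m B) s & Psi s = u - at_F f.
  exact/span_Psi/(null_offdiag char2)/HC_null_null.
have tE : t = s + emb f.
  by apply/eqP; rewrite -subr_eq0; apply/eqP; apply: (@Psi_inj K N); rewrite PsiB PsiD sE -at_F_Psi subrK tu subrr.
apply/msize_deg => m dM; rewrite mcoeffB res_coef.
have := Phi_Psi dt (B := set0) (m := dm m).
rewrite cards0 addn0 mdeg_dm tu spolyBE mcoeffB => /(_ dM)/eqP.
rewrite subr_eq0 => /eqP ->; rewrite tE spolyDE mcoeffD emb_coef eqxx dm_diag /= dmK.
by rewrite hs ?add0r ?subrr // negbK diag_supp_set0 dm_diag.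
Qed.

End HCInjective.

(** * Symmetry of the leading part *)

Section ChainRule.
Variables (n : nat) (K R : comNzRingType) (c : {rmorphism K -> R}) (h : 'I_n -> {poly R}).
Local Notation ev := (mmap (polyC \o c) h).

Lemma deriv_mmap (p : {mpoly K[n]}) : (ev p)^`() = \sum_i ev p^`M(i) * (h i)^`().
Proof.
move: p; pose good p := (ev p)^`() = \sum_i ev p^`M(i) * (h i)^`().
have good0 : good 0 by rewrite /good mmap0 deriv0 big1 // => i _; rewrite mderiv0 mmap0 mul0r.
have goodD p q : good p -> good q -> good (p + q).
  rewrite /good mmapD derivD => -> ->; rewrite -big_split; apply: eq_bigr => i _ /=.
  by rewrite mderivD mmapD mulrDl.
have goodM p q : good p -> good q -> good (p * q).
  rewrite /good rmorphM derivM => -> ->; rewrite mulr_suml mulr_sumr -big_split.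
  apply: eq_bigr => i _ /=; rewrite mderivM mmapD !rmorphM mulrDl mulrAC.
  by rewrite [X in _ + X]mulrA.
have goodC a : good a%:MP.
  rewrite /good mmapC /= derivC big1 // => i _; rewrite mderivC mmap0 mul0r.
  by [].
have goodX i : good 'X_i.
  rewrite /good mmapX mmap1U (bigD1 i) //= big1 => [|j ji]; last first.
    by rewrite mderivX mnm1E eq_sym (negbTE ji) scale0r mmap0 mul0r.
  rewrite mderivX mnm1E eqxx scale1r mmapX addr0.
  have -> : (U_(i) - U_(i))%MM = 0%MM :> 'X_{1..n} by apply/mnmP => k; rewrite mnmBE subnn mnm0E.
  by rewrite mmap11 mul1r.
elim/mpolyind => // a m p _ _ IH; apply: (goodD) => //; rewrite -mul_mpolyC.
apply: (goodM) => //; rewrite mpolyXE_id; elim/big_rec: _ => [|i q _]; first exact: (goodC 1).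
by apply: (goodM); elim: (m i) => [|k]; [exact: (goodC 1)|rewrite exprS; apply: (goodM)].
Qed.

Lemma horner_mmap (p : {mpoly K[n]}) a : (ev p).[a] = mmap c (fun i => (h i).[a]) p.
Proof.
rewrite /mmap horner_sum; apply: eq_bigr => m _; rewrite hornerM /= hornerC; congr (_ * _).
by rewrite /mmap1 horner_prod; apply: eq_bigr => i _; rewrite horner_exp.
Qed.

End ChainRule.

Section AdjointInvariance.
Variables (K : comNzRingType) (N : nat).
Local Notation P := ('I_N * 'I_N)%type.
Local Notation n := #|{: P}|.
Local Notation rk i j := (enum_rank ((i, j) : P)).
Variable p : {mpoly K[n]}.
Hypothesis p_inv : forall i j, i != j ->
  \sum_k 'X_(rk i k) * p^`M(rk j k) = \sum_k 'X_(rk k j) * p^`M(rk k i).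

Variables (R : comNzRingType) (c : {rmorphism K -> R}).
Hypothesis char0 : forall k (x : R), x *+ k.+1 = 0 -> x = 0.

Definition mev (M : 'M[R]_N) : R := mmap c (fun t => M (enum_val t).1 (enum_val t).2) p.

(** With E = [delta_mx i j], E^2 = 0, the curve Q(t) = (1 + t E) M (1 - t E) satisfies Q' = E Q - Q
    E. By the chain rule and [p_inv], p(Q(t)) has derivative 0 and is constant, since the ring is
    torsion free. Compare t = a with t = 0. *)
Lemma mev_conj (i j : 'I_N) (a : R) (M : 'M[R]_N) : i != j ->
  mev ((1%:M + a *: delta_mx i j) *m M *m (1%:M - a *: delta_mx i j)) = mev M.
Proof.
move=> ij; pose E : 'M[{poly R}]_N := delta_mx i j.
pose Q := (1%:M + 'X *: E) *m map_mx polyC M *m (1%:M - 'X *: E).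
pose q := mmap (polyC \o c) (fun t => Q (enum_val t).1 (enum_val t).2) p.
have EE : E *m E = 0 by rewrite mul_delta_mx_0 // eq_sym.
have Qa b : map_mx (horner_eval b) Q = (1%:M + b *: delta_mx i j) *m M *m (1%:M - b *: delta_mx i j).
  rewrite /Q !map_mxM map_mxB map_mxD !map_mx1 !map_mxZ map_delta_mx.
  rewrite -map_mx_comp /= /horner_eval hornerX; congr (_ *m _ *m _).
  by apply/matrixP => k l; rewrite !mxE /= hornerC.
have qa b : q.[b] = mev ((1%:M + b *: delta_mx i j) *m M *m (1%:M - b *: delta_mx i j)).
  rewrite horner_mmap -Qa /mev /mmap; apply: eq_bigr => m _; congr (_ * _).
  by apply: mmap1_eq => t; rewrite [RHS]mxE.
have dQ : map_mx (@deriv _) Q = E *m Q - Q *m E.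
  have -> : E *m Q = E *m map_mx polyC M *m (1%:M - 'X *: E).
    by rewrite /Q !mulmxA mulmxDr mulmx1 -scalemxAr EE scaler0 addr0.
  have -> : Q *m E = (1%:M + 'X *: E) *m map_mx polyC M *m E.
    by rewrite /Q -mulmxA mulmxBl mul1mx -scalemxAl EE scaler0 subr0.
  pose C := map_mx polyC M.
  have dlin (A B G : 'M[R]_N) : map_mx (@deriv _) (map_mx polyC A + 'X *: map_mx polyC B + 'X^2 *: map_mx polyC G)
      = map_mx polyC B + ('X *+ 2) *: map_mx polyC G.
    apply/matrixP => k l; rewrite !mxE expr2 !(derivD, derivM, derivC, derivX); ring.
  pose D := delta_mx i j : 'M[R]_N.
  have ED : E = map_mx polyC D by rewrite map_delta_mx.
  have E1 : map_mx polyC (D *m M - M *m D) = E *m C - C *m E.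
    by rewrite map_mxB !map_mxM -ED.
  have E2 : map_mx polyC (- (D *m M *m D)) = - (E *m C *m E).
    by rewrite map_mxN !map_mxM -ED.
  have -> : Q = map_mx polyC M + 'X *: map_mx polyC (D *m M - M *m D)
     + 'X^2 *: map_mx polyC (- (D *m M *m D)).
    rewrite E1 E2 /Q -/C mulmxBr mulmx1 mulmxDl mul1mx -!scalemxAl -!scalemxAr mulmxDl -!scalemxAl.
    move: (E *m C *m E) (E *m C) (C *m E) => A B G.
    by apply/matrixP => k l; rewrite !mxE; ring.
  rewrite dlin E1 E2 mulmxBr mulmx1 !mulmxDl mul1mx -!scalemxAl -!scalemxAr -/C.
  move: (E *m C *m E) (E *m C) (C *m E) => A B G.
  by apply/matrixP => k l; rewrite !mxE; ring.
have dq : q^`() = 0.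
  rewrite deriv_mmap (reindex (@enum_rank P)) /=; last first.
    by exists enum_val => ? _; rewrite ?enum_rankK ?enum_valK.
  pose ev := @mmap n _ _ (polyC \o c) (fun t => Q (enum_val t).1 (enum_val t).2).
  have evX k l : ev 'X_(rk k l) = Q k l by rewrite /ev mmapX mmap1U enum_rankK.
  have dQE k l : (Q k l)^`() = (k == i)%:R * Q j l - Q k i * (l == j)%:R.
    have := congr1 (fun A : 'M_N => A k l) dQ; rewrite !mxE => ->; congr (_ - _).
      rewrite (bigD1 j) //= big1 => [|r rj]; first by rewrite !mxE eqxx andbT addr0.
      by rewrite !mxE (negbTE rj) andbF mul0r.
    rewrite (bigD1 i) //= big1 => [|r ri]; first by rewrite !mxE eqxx addr0.
    by rewrite !mxE (negbTE ri) mulr0.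
  transitivity (\sum_k \sum_l ev p^`M(rk k l) * ((k == i)%:R * Q j l - Q k i * (l == j)%:R)).
    by rewrite pair_big; apply: eq_bigr => -[k l] _; rewrite enum_rankK dQE.
  have -> : \sum_k \sum_l ev p^`M(rk k l) * ((k == i)%:R * Q j l - Q k i * (l == j)%:R)
     = \sum_l ev p^`M(rk i l) * Q j l - \sum_k ev p^`M(rk k j) * Q k i.
    have -> : \sum_l ev p^`M(rk i l) * Q j l = \sum_k \sum_l ev p^`M(rk k l) * ((k == i)%:R * Q j l).
      rewrite [in RHS](bigD1 i) //= [X in _ = _ + X]big1 => [|k ki]; last first.
        by rewrite big1 // => l _; rewrite (negbTE ki) mul0r mulr0.
      by rewrite addr0; apply: eq_bigr => l _; rewrite eqxx mul1r.
    rewrite -sumrB; apply: eq_bigr => k _.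
    have -> : ev p^`M(rk k j) * Q k i = \sum_l ev p^`M(rk k l) * (Q k i * (l == j)%:R).
      rewrite (bigD1 j) //= big1 => [|l lj]; first by rewrite eqxx mulr1 addr0.
      by rewrite (negbTE lj) !mulr0.
    by rewrite -sumrB; apply: eq_bigr => l _; rewrite mulrBr.
  have := congr1 ev (p_inv (i := j) (j := i) _); rewrite eq_sym ij /ev !rmorph_sum => /(_ isT) h.
  apply/eqP; rewrite subr_eq0; apply/eqP; etransitivity; [etransitivity; last exact: h|].
    by apply: eq_bigr => l _; rewrite rmorphM /= -/ev evX mulrC.
  by apply: eq_bigr => l _; rewrite rmorphM /= -/ev evX mulrC.
have q0 k : q`_k.+1 = 0.
  by apply: (char0 (k := k)); rewrite -coef_deriv dq coef0.
have qE b : q.[b] = q`_0.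
  have -> : q = (q`_0)%:P by apply/polyP => -[|k]; rewrite coefC.
  by rewrite hornerC coefC.
rewrite -qa qE -(qE 0) qa.
by rewrite scale0r addr0 subr0 mul1mx mulmx1.
Qed.

(* w = u_ij(1) u_ji(-1) u_ij(1) is a signed permutation matrix exchanging i and
   j, hence conjugation by w swaps two diagonal entries. *)
Lemma mev_swap (i j : 'I_N) (d : 'rV[R]_N) : i != j ->
  mev (diag_mx (\row_k d 0 (tperm i j k))) = mev (diag_mx d).
Proof.
move=> ij.
pose u (a : R) (i j : 'I_N) : 'M[R]_N := 1%:M + a *: delta_mx i j.
pose u' (a : R) (i j : 'I_N) : 'M[R]_N := 1%:M - a *: delta_mx i j.
have ji : j != i by rewrite eq_sym.
have dd k l k' l' : (delta_mx k l : 'M[R]_N) *m delta_mx k' l' = (l == k')%:R *: delta_mx k l'.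
  by rewrite mul_delta_mx_cond -scaler_nat.
have uu a k l : k != l -> u a k l *m u' a k l = 1%:M.
  move=> kl; rewrite /u /u' mulmxBr mulmx1 mulmxDl mul1mx -scalemxAl -scalemxAr dd.
  by rewrite eq_sym (negbTE kl) scale0r !scaler0 addr0 addrK.
have ef : delta_mx i j *m delta_mx j i = delta_mx i i :> 'M[R]_N by rewrite mul_delta_mx.
have fe : delta_mx j i *m delta_mx i j = delta_mx j j :> 'M[R]_N by rewrite mul_delta_mx.
have pe : delta_mx i i *m delta_mx i j = delta_mx i j :> 'M[R]_N by rewrite mul_delta_mx.
have ee : delta_mx i j *m delta_mx i j = 0 :> 'M[R]_N by rewrite mul_delta_mx_0.
pose w := u 1 i j *m u (-1) j i *m u 1 i j.
pose w' := u' 1 i j *m u' (-1) j i *m u' 1 i j.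
have ww' : w *m w' = 1%:M.
  rewrite /w /w' -!mulmxA (mulmxA (u 1 i j) (u' 1 i j)) uu // mul1mx.
  by rewrite (mulmxA (u (-1) j i)) uu // mul1mx uu.
have wE : w = 1%:M + delta_mx i j - delta_mx j i - delta_mx i i - delta_mx j j.
  rewrite /w /u !scale1r scaleN1r.
  rewrite !(mulmxDl, mulmxDr, mulmxN, mulNmx, mul1mx, mulmx1) !(ee, ef, fe, pe).
  by apply/matrixP => r s; rewrite !mxE; ring.
have DE k l : diag_mx d *m delta_mx k l = d 0 k *: delta_mx k l.
  apply/matrixP => r s; rewrite mul_diag_mx !mxE; case: eqP => [->//|].
  by rewrite /= !mulr0.
have ED k l : delta_mx k l *m diag_mx d = d 0 l *: delta_mx k l.
  apply/matrixP => r s; rewrite mul_mx_diag !mxE mulrC; case: (s =P l) => [->//|].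
  by rewrite andbF !mulr0.
pose D' : 'M[R]_N := diag_mx (\row_k d 0 (tperm i j k)).
have D'E : D' = diag_mx d + (d 0 j - d 0 i) *: (delta_mx i i - delta_mx j j).
  apply/matrixP => r s; rewrite !mxE; case: (r =P s) => [<-|rs]; last first.
    rewrite !mulr0n add0r; case: (r =P i) => [E|]; case: (r =P j) => [E'|]; rewrite ?subr0 ?mulr0 //=.
    - by rewrite -E' E eqxx in ij.
    - by case: eqP => [E2|]; rewrite ?subr0 ?mulr0 //; case: rs; rewrite E2.
    - by case: eqP => [E2|]; rewrite ?subr0 ?mulr0 //; case: rs; rewrite E2.
  rewrite !mulr1n; case: tpermP => [->|->|/eqP ri /eqP rj].
  - by rewrite eqxx (negbTE ij) subr0 mulr1 addrC subrK.
  - by rewrite eqxx (negbTE ji) sub0r mulrN1 opprB addrC subrK.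
  - by rewrite (negbTE ri) (negbTE rj) subr0 mulr0 addr0.
have D'w : w *m diag_mx d = D' *m w.
  rewrite D'E wE.
  have p1 : (delta_mx i i - delta_mx j j) *m (1%:M + delta_mx i j - delta_mx j i - delta_mx i i - delta_mx j j)
     = delta_mx i j + delta_mx j i :> 'M[R]_N.
    rewrite !(mulmxBl, mulmxDr, mulmxN, mulmx1) !mul_delta_mx.
    rewrite !mul_delta_mx_0 //.
    by apply/matrixP => r s; rewrite !mxE; ring.
  rewrite [RHS]mulmxDl -scalemxAl p1.
  rewrite !(mulmxBl, mulmxDl, mulNmx, mulmxN, mulmxDr, mul1mx, mulmx1, DE, ED).
  by apply/matrixP => r s; rewrite !mxE; ring.
rewrite -/D'; have -> : D' = u 1 i j *m (u (-1) j i *m (u 1 i j *m diag_mx d *m u' 1 i j) *m u' (-1) j i) *m u' 1 i j.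
  rewrite -[LHS]mulmx1 -ww' mulmxA -D'w /w /w' !mulmxA.
  by [].
by rewrite !mev_conj.
Qed.

End AdjointInvariance.

Lemma symmetric_tperm (K : comNzRingType) N (f : {mpoly K[N]}) :
  (forall i j, i != j -> msym (tperm i j) f = f) -> f \is symmetric.
Proof.
move=> h; apply/issymP => s; have [ts -> dts] := prod_tpermP s.
elim: ts dts => [|[i j] ts IH] /=; first by rewrite big_nil msym1m.
by case/andP => ij /IH; rewrite big_cons msymMm h.
Qed.

Section TopSymmetric.
Variables (K : fieldType) (N : nat).
Hypothesis char0 : forall k, (k.+1%:R : K) != 0.
Local Notation P := ('I_N * 'I_N)%type.
Local Notation n := #|{: P}|.
Local Notation rk i j := (enum_rank ((i, j) : P)).
Local Notation key := (@pkey N).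
Local Notation Phi := (@Phi K N key (@pkey_inj N)).

Lemma msym_mmap (s : 'S_N) (h : 'I_n -> mpoly N K) (p : {mpoly K[n]}) :
  msym s (mmap (@mpolyC N K) h p) = mmap (@mpolyC N K) (fun t => msym s (h t)) p.
Proof.
rewrite /mmap raddf_sum; apply: eq_bigr => m _ /=; rewrite msymM /mmap1 rmorph_prod.
congr (_ * _); first by rewrite /msym mmapC.
by apply: eq_bigr => i _; rewrite rmorphXn.
Qed.

(** [res p] is the value of p at the generic diagonal matrix over the polynomial ring itself, so
    permuting its variables amounts to permuting diagonal entries. *)
Lemma res_symmetric (p : {mpoly K[n]}) : (forall i j, i != j ->
  \sum_k 'X_(rk i k) * p^`M(rk j k) = \sum_k 'X_(rk k j) * p^`M(rk k i)) ->
  res p \is symmetric.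
Proof.
move=> hp; apply: symmetric_tperm => i j ij.
have resE : res p = mev p (@mpolyC N K) (diag_mx (\row_k 'X_k)).
  rewrite /res /comp_mpoly /mev /mmap; apply: eq_bigr => m _; congr (_ * _).
  by apply: mmap1_eq => t; rewrite tnth_mktuple !mxE; case: eqP.
have char0' k (x : mpoly N K) : x *+ k.+1 = 0 -> x = 0.
  rewrite -scaler_nat => /eqP; rewrite scaler_eq0 (negbTE (char0 k)) => /eqP.
  by [].
rewrite resE -[RHS](mev_swap hp _ char0' _ ij) /mev msym_mmap /mmap.
apply: eq_bigr => m _; congr (_ * _); apply: mmap1_eq => t.
by rewrite !mxE raddfMn /= /msym mmapX mmap1U.
Qed.

Lemma res_Phi_symmetric u : ecentral u -> res (Phi u set0) \is symmetric.
Proof.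
move=> [hu cu]; apply: res_symmetric => i j ij.
have := congr1 (fun s : spoly K P => s set0) (Phi_central (@pkey_inj N) hu (cu (pos i) (pos j))).
rewrite lder_even rder_even !spolyDE !spoly_sumE.
have om0 (t : P) (s : spoly K P) : odd_mul key t s set0 = 0 by rewrite odd_mulE inE.
have z (a b c d : 'I_N -> 'I_N) : \sum_k odd_mul key (a k, b k) (odd_der key (c k, d k) (Phi u)) set0 = 0.
  by apply: big1 => k _; apply: om0.
rewrite (z (fun=> i) id (fun=> j) id) (z id (fun=> j) id (fun=> i)) !addr0 => h.
transitivity (\sum_k ev_mul (i, k) (ev_der (j, k) (Phi u)) set0).
  by apply: eq_bigr => k _; rewrite ev_mulE ev_derE.
by rewrite h; apply: eq_bigr => k _; rewrite ev_mulE ev_derE.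
Qed.

Lemma HC_top_symmetric d (u : UqN K N) f : ecentral u -> HC_null (u - at_F f) -> (msize f <= d.+1)%N ->
  exists2 g, g \is symmetric & (msize (f - g) <= d)%N.
Proof.
move=> cu hf fd; exists (res (Phi u set0)); first exact: res_Phi_symmetric.
exact: HC_top.
Qed.

End TopSymmetric.

(** * Moments and Hankel determinants *)

Section MomentFunctional.
Variable R : comNzRingType.
Implicit Types (b : nat -> R) (g p : {poly R}).

(** The functional taking X^m to b_m, that is, the coefficient of u^(-1) in g(u) sum_m b_m
    u^(-m-1). *)
Definition moment b g : R := \sum_(m < size g) g`_m * b m.

Lemma momentE b g d : (size g <= d)%N -> moment b g = \sum_(m < d) g`_m * b m.
Proof.
move=> gd; rewrite /moment (big_ord_widen _ (fun m => g`_m * b m) gd) big_mkcond /=.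
apply: eq_bigr => m _; case: ltnP => // gm; rewrite nth_default ?mul0r //.
Qed.

Fact moment_linear b : scalar (moment b).
Proof.
move=> a g p; pose d := maxn (size g) (size p).
rewrite !(@momentE b _ d) ?leq_maxl ?leq_maxr //; last first.
  by rewrite (leq_trans (size_polyD _ _)) // geq_max leq_maxr (leq_trans (size_scale_leq _ _)) ?leq_maxl.
rewrite mulr_sumr -big_split /=; apply: eq_bigr => m _.
by rewrite coefD coefZ mulrDl mulrA.
Qed.
HB.instance Definition _ b := GRing.isLinear.Build R {poly R} R *%R (moment b) (moment_linear b).

Lemma momentZ b a g : moment b (a *: g) = a * moment b g.
Proof. exact: linearZ. Qed.
Lemma momentX b n : moment b 'X^n = b n.
Proof.
rewrite (@momentE b _ n.+1) ?size_polyXn // big_ord_recr /= coefXn eqxx mul1r big1 ?add0r // => i _.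
by rewrite coefXn (ltn_eqF (ltn_ord i)) mul0r.
Qed.
Lemma momentC b a : moment b a%:P = a * b 0%N.
Proof. by rewrite -[a%:P]mulr1 mul_polyC momentZ -(expr0 'X) momentX. Qed.


(* [bmom s m] is the Harish-Chandra image of c_(2m+1), where s lists the
   lambda_i. *)
Fixpoint amom (h : R) (b : nat -> R) (m : nat) : R :=
  if m is m'.+1 then h * (h - 1) * amom h b m' - h * b m' else h.
Fixpoint bmom (s : seq R) : nat -> R :=
  if s is h :: s' then fun m => 2%:R * amom h (bmom s') m + bmom s' m else fun=> 0.

Definition xr (h : R) := h * (h - 1).
Definition yr (h : R) := h * (h + 1).
Definition Pol (s : seq R) : {poly R} := \prod_(h <- s) ('X - (xr h)%:P).
Definition Qol (s : seq R) : {poly R} := \prod_(h <- s) ('X - (yr h)%:P).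

(* With x = h (h - 1) and y = h (h + 1): adjoining h to the list multiplies the
   generating function 1 - Qol/Pol of the moments accordingly. *)
Lemma bmom_cons h s g :
  moment (bmom (h :: s)) (('X - (xr h)%:P) * g) = moment (bmom s) (('X - (yr h)%:P) * g).
Proof.
have mX b m c : moment b (('X - c%:P) * 'X^m) = b m.+1 - c * b m.
  by rewrite mulrBl -exprS mul_polyC linearB /= momentZ !momentX.
rewrite -(coefK g) poly_def !mulr_sumr !linear_sum /=; apply: eq_bigr => m _.
rewrite -!scalerAr !momentZ !mX /= /xr /yr; congr (_ * _); ring.
Qed.

Lemma moment_Pol s g : moment (bmom s) (Pol s * g) = 0.
Proof.
elim: s g => [|h s IH] g.
  by rewrite /moment big1 // => m _; rewrite /= mulr0.
by rewrite /Pol big_cons -mulrA bmom_cons mulrCA IH.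
Qed.

Lemma drop_polyXB c p l :
  drop_poly l.+1 (('X - c%:P) * p) = drop_poly l p - c *: drop_poly l.+1 p.
Proof.
apply/polyP => i; rewrite coef_drop_poly coefB coefZ !coef_drop_poly mulrBl coefB coefXM mul_polyC coefZ.
by rewrite addnS.
Qed.

(** Synthetic division: the successive truncations of p, weighted by powers of a, telescope to the
    quotient of p by X - a. *)
Lemma drop_poly_tel p g a M : p = ('X - a%:P) * g ->
  \sum_(l < M) a ^+ l *: drop_poly l.+1 p = g - a ^+ M *: drop_poly M g.
Proof.
move=> E; elim: M => [|M IH]; first by rewrite big_ord0 drop_poly0l expr0 scale1r subrr.
by rewrite big_ord_recr /= IH E drop_polyXB scalerBr scalerA -exprSr addrA subrK.
Qed.

Lemma drop_polyS p l : 'X * drop_poly l.+1 p = drop_poly l p - (p`_l)%:P.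
Proof.
apply/polyP => -[|i]; rewrite coefXM coefB coefC !coef_drop_poly /= ?subrr ?subr0 //.
by rewrite addnS.
Qed.

(** This is the coefficient of u^l, l >= 0, in P(u) sum_m b_m u^(-m-1) = P(u) - Q(u); [moment_Pol]
    says that the negative powers of u vanish. *)
Lemma moment_drop s l : moment (bmom s) (drop_poly l.+1 (Pol s)) = (Pol s)`_l - (Qol s)`_l.
Proof.
elim: s l => [|h s IH] l.
  by rewrite /Pol /Qol !big_nil subrr /moment big1 // => m _; rewrite /= mulr0.
have PE : Pol (h :: s) = ('X - (xr h)%:P) * Pol s by rewrite /Pol big_cons.
have QE : Qol (h :: s) = ('X - (yr h)%:P) * Qol s by rewrite /Qol big_cons.
have -> : drop_poly l.+1 (Pol (h :: s)) = ('X - (xr h)%:P) * drop_poly l.+1 (Pol s) + ((Pol s)`_l)%:P.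
  by rewrite PE drop_polyXB mulrBl drop_polyS mul_polyC addrAC subrK.
rewrite linearD /= bmom_cons momentC mulrBl drop_polyS !linearB /= momentC mul_polyC momentZ IH.
rewrite PE QE !mulrBl !coefB !mul_polyC !coefZ !coefXM.
case: l => [|l]; last by rewrite IH /= /xr /yr; ring.
have -> : drop_poly 0 (Pol s) = Pol s * 1 by rewrite drop_poly0l mulr1.
by rewrite moment_Pol /= /xr /yr; ring.
Qed.

(** By [drop_poly_tel], g is the sum of the truncations of [Pol s] with weights a^l, so by
    [moment_drop] its moment is P(a) - Q(a), where P(a) = 0. *)
Lemma moment_root s a g : Pol s = ('X - a%:P) * g -> moment (bmom s) g = - (Qol s).[a].
Proof.
move=> E; pose d := maxn (size (Pol s)) (maxn (size (Qol s)) (size g)).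
have := congr1 (moment (bmom s)) (drop_poly_tel d E).
rewrite drop_poly_eq0 ?leq_max ?leqnn ?orbT // scaler0 subr0 => <-.
rewrite linear_sum /=.
have -> : - (Qol s).[a] = (Pol s).[a] - (Qol s).[a].
  by rewrite E hornerM hornerXsubC subrr mul0r sub0r.
rewrite !(@horner_coef_wide _ d) ?leq_max ?leqnn ?orbT // -sumrB.
by apply: eq_bigr => l _; rewrite momentZ moment_drop -mulrBl mulrC.
Qed.

Section Hankel.
Variables (N : nat) (h : 'I_N -> R).
Local Notation s := (codom h).
Local Notation b := (bmom s).
Definition hankel := \matrix_(i < N, j < N) b (i + j)%N.

Let lo (i : nat) : {poly R} := \prod_(k < N | (k < i)%N) ('X - (xr (h k))%:P).
Let hi (j : nat) : {poly R} := \prod_(k < N | (j < k)%N) ('X - (xr (h k))%:P).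

Lemma PolE : Pol s = \prod_(k < N) ('X - (xr (h k))%:P).
Proof. by rewrite /Pol big_map big_enum. Qed.
Lemma QolE : Qol s = \prod_(k < N) ('X - (yr (h k))%:P).
Proof. by rewrite /Qol big_map big_enum. Qed.

Lemma size_prod_cond (Q : pred 'I_N) (f : 'I_N -> R) :
  size (\prod_(k | Q k) ('X - (f k)%:P)) = (\sum_(k | Q k) 1).+1.
Proof. by rewrite -big_filter size_prod_XsubC -sum1_size big_filter. Qed.
Lemma size_lo i : (i <= N)%N -> size (lo i) = i.+1.
Proof.
move=> iN; rewrite size_prod_cond; congr _.+1.
by rewrite -(big_ord_widen N (fun=> 1%N)) // sum1_card card_ord.
Qed.
Lemma size_hi j : (j < N)%N -> size (hi j) = (N - j)%N.
Proof.
move=> jN; rewrite size_prod_cond.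
have : (\sum_(k < N | (k < j.+1)%N) 1 + \sum_(k < N | ~~ (k < j.+1)%N) 1 = N)%N.
  by rewrite -(bigID (fun k : 'I_N => (k < j.+1)%N) predT (fun=> 1%N)) sum1_card card_ord.
rewrite -(big_ord_widen N (fun=> 1%N)) // sum1_card card_ord => E.
rewrite (eq_bigl (fun k : 'I_N => ~~ (k < j.+1)%N)) => [|k]; last by rewrite -leqNgt.
by apply/eqP; rewrite -(eqn_add2l j) subnKC ?addnS 1?ltnW // -addSn E.
Qed.

(** The moment of a product is a bilinear form whose Gram matrix on the powers of X is Hankel. *)
Lemma momentM (b' : nat -> R) (p q : {poly R}) d : (size p <= d)%N -> (size q <= d)%N ->
  moment b' (p * q) = \sum_(m < d) \sum_(l < d) p`_m * b' (m + l)%N * q`_l.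
Proof.
have E (r : {poly R}) : (size r <= d)%N -> r = \sum_(m < d) r`_m *: 'X^m.
  move=> rd; apply/polyP => k; rewrite -poly_def coef_poly; case: ltnP => // dk.
  by rewrite nth_default // (leq_trans rd).
move=> /E {1}-> /E {1}->; rewrite mulr_suml linear_sum; apply: eq_bigr => m _.
rewrite mulr_sumr linear_sum; apply: eq_bigr => l _.
rewrite -scalerAl -scalerAr -exprD /= !momentZ momentX; ring.
Qed.

Lemma det_unitrig (A : 'M[R]_N) : (forall i j : 'I_N, (i < j)%N -> A i j = 0) ->
  (forall i, A i i = 1) -> \det A = 1.
Proof.
by move=> h0 h1; rewrite det_trig ?big1 //; apply/is_trig_mxP => i j; apply: h0.
Qed.

(* In the bases prod_(k > i) (X - x_k) and prod_(k < j) (X - x_k) the Hankel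
   form is triangular, because moments of multiples of Pol vanish. *)
Lemma det_hankel : exists e : bool,
  \det hankel = (-1) ^+ e * \prod_k (Qol s).[xr (h k)].
Proof.
pose V := \matrix_(i < N, m < N) (lo i)`_m.
pose W := \matrix_(j < N, m < N) (hi j)`_m.
have VHW : W *m hankel *m V^T = \matrix_(i, j) moment b (hi i * lo j).
  apply/matrixP => i j; rewrite !mxE (@momentM _ _ _ N).
  - rewrite exchange_big; apply: eq_bigr => l _; rewrite !mxE mulr_suml.
    by apply: eq_bigr => m _; rewrite !mxE.
  - by rewrite size_hi // leq_subr.
  - by rewrite size_lo // ltnW.
have lo_monic i : lo i \is monic by apply: monic_prod => k _; apply: monicXsubC.
have hi_monic i : hi i \is monic by apply: monic_prod => k _; apply: monicXsubC.
have detV : \det V = 1.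
  apply: det_unitrig => [i j ij|i]; rewrite mxE.
    by rewrite nth_default // size_lo // ltnW.
  by have /monicP := lo_monic i; rewrite lead_coefE size_lo // ltnW.
(* [hi j] has degree N - 1 - j, so its coefficient matrix is unitriangular only after the rows are
   reversed; this contributes to the sign of the determinant. *)
pose r := perm (@rev_ord_inj N).
have detW : \det (row_perm r W) = 1.
  apply: det_unitrig => [i j ij|i]; rewrite !mxE permE.
    rewrite nth_default // size_hi /=; first by move: (ltn_ord i); lia.
    by move: (ltn_ord i); lia.
  have /monicP := hi_monic (rev_ord i); rewrite lead_coefE size_hi ?ltn_ord // => E.
  by rewrite -[RHS]E /=; congr (_`_ _); move: (ltn_ord i); lia.
have {}detW : \det W = (-1) ^+ r.
  move: detW; rewrite row_permE det_mulmx det_perm => /(congr1 (fun x => (-1) ^+ r * x)).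
  by rewrite signrMK mulr1.
have detP : \det (W *m hankel *m V^T) = \prod_k - (Qol s).[xr (h k)].
  rewrite VHW det_trig; last first.
    apply/is_trig_mxP => i j ij; rewrite mxE.
    rewrite (_ : _ * _ = Pol s * \prod_(k < N | (i < k < j)%N) ('X - (xr (h k))%:P)).
      exact: moment_Pol.
    pose f k := 'X - (xr (h k))%:P.
    rewrite PolE (big_mkcond (fun k : 'I_N => i < k < j)%N) -big_split /hi /lo.
    rewrite (big_mkcond (fun k : 'I_N => i < k)%N) (big_mkcond (fun k : 'I_N => k < j)%N) -big_split.
    apply: eq_bigr => k _ /=; case: ltnP => ik /=; case: ltnP => kj; rewrite ?mulr1 ?mul1r //.
    by have := leq_ltn_trans ik (leq_trans ij kj); rewrite ltnn.
  apply: eq_bigr => k _; rewrite mxE; apply: moment_root.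
  rewrite PolE (bigD1 k) //=; congr (_ * _).
  rewrite /hi /lo big_mkcond [X in X * _]big_mkcond [X in _ * X]big_mkcond -big_split.
  by apply: eq_bigr => l _ /=; rewrite -val_eqE /=; case: ltngtP; rewrite ?mulr1 ?mul1r.
move: detP; rewrite !det_mulmx det_tr detV mulr1 detW => /(congr1 (fun x => (-1) ^+ r * x)).
rewrite mulrA -signr_addb addbb mul1r => ->; rewrite prodrN mulrA.
by exists (r (+) odd #|'I_N|); rewrite signr_addb signr_odd.
Qed.

End Hankel.
End MomentFunctional.

(** * Harish-Chandra images of the cyclic elements *)

Section ZmodIdentities2.
Variable V : zmodType.
Implicit Types a b c d p q r t : V.
Lemma subrBB a b c d : a - b - (c - d) = (a - c) - (b - d).
Proof. by rewrite !opprB [d - c]addrC [d - b]addrC addrACA. Qed.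
Lemma subr_step a b p q r t :
  a + b - (p - r - t) = (a - (p - q - t)) + (b - (q - r)).
Proof.
rewrite addrACA -opprD; congr (_ - _).
by rewrite [p - q - t]addrAC addrA subrK addrAC.
Qed.
End ZmodIdentities2.

Section CyclicElementsModNull.
Variables (K : fieldType) (N : nat) (A : algType K) (f : idx N -> idx N -> A).
Local Notation sg i j k l :=
  ((-1) ^+ ((par i (+) par j) && (par k (+) par l)) : K).
Hypothesis fR : forall i j k l,
  f i j * f k l - sg i j k l *: (f k l * f i j) = DF f i j k l.
Hypothesis f_opp : forall i j, f (opp i) (opp j) = f i j.
Hypothesis char2 : (2%:R : K) != 0.
Local Notation absi := (@absi N).

Variable nul : A -> Prop.
Hypothesis nul0 : nul 0.
Hypothesis nul_lin : forall a u v, nul u -> nul v -> nul (a *: u + v).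
Hypothesis nul_neg : forall (i : 'I_N) j u, (absi j < i)%N -> nul (f (pos i) j * u).
Hypothesis nul_pos : forall (i : 'I_N) j u, (i < absi j)%N -> nul (u * f (pos i) j).
Hypothesis nul_diag : forall (i : 'I_N) j u, absi j = i -> nul u -> nul (f (pos i) j * u).

Local Notation X n i := (xs f n (pos i) (pos i)).
Local Notation Y n i := (xs f n (pos i) (neg i)).
Local Notation h i := (f (pos i) (pos i)).
Local Notation eta i := (f (pos i) (neg i)).

Lemma nulD u v : nul u -> nul v -> nul (u + v).
Proof. by move=> hu hv; rewrite -[u]scale1r; apply: nul_lin. Qed.
Lemma nulZ a u : nul u -> nul (a *: u).
Proof. by move=> hu; rewrite -[_ *: _]addr0; apply: nul_lin. Qed.
Lemma nulB u v : nul u -> nul v -> nul (u - v).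
Proof. by move=> hu hv; rewrite addrC -scaleN1r; apply: nul_lin. Qed.
Lemma nul_sum I (r : seq I) (Q : pred I) F :
  (forall i, Q i -> nul (F i)) -> nul (\sum_(i <- r | Q i) F i).
Proof. by move=> hF; elim/big_ind: _ => //; apply: nulD. Qed.
Lemma nul_trans u v w : nul (u - v) -> nul (v - w) -> nul (u - w).
Proof. by move=> huv hvw; rewrite -(subrKA v); apply: nulD. Qed.

(** For even n the terms k and -k of the trace therefore agree, which explains the factor 2 in
    [bmom]; for odd n they cancel. *)
Lemma xs_opp n k l : xs f n (opp k) (opp l) = (-1) ^+ n *: xs f n k l.
Proof.
elim: n k l => [|n IH] k l /=; first by rewrite scale1r f_opp.
rewrite (reindex_inj (inv_inj (@oppK N))) scaler_sumr; apply: eq_bigr => m _ /=.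
rewrite f_opp IH par_opp -scalerAr !scalerA exprS; congr (_ *: _).
by case: (par m); rewrite ?expr0 ?expr1; ring.
Qed.
Lemma xs_neg n k l : xs f n (neg k) (neg l) = (-1) ^+ n *: xs f n (pos k) (pos l).
Proof. exact: (xs_opp n (pos k) (pos l)). Qed.
Lemma xs_negpos n k l : xs f n (neg k) (pos l) = (-1) ^+ n *: xs f n (pos k) (neg l).
Proof. exact: (xs_opp n (pos k) (neg l)). Qed.

(** The superbracket of the odd F_(i,-i) with itself is twice its square and equals 2 F_ii. *)
Lemma eta_sqr i : eta i * eta i = h i.
Proof.
have := fR (pos i) (neg i) (pos i) (neg i).
rewrite /DF /= !eqxx expr1 !scaleN1r !opprK !scale0r !scale1r !add0r.
rewrite (f_opp (pos i) (pos i)) -!mulr2n -!scaler_nat => /(congr1 (fun x => 2%:R^-1 *: x)).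
by rewrite !scalerA mulVf // !scale1r.
Qed.
Lemma h_eta i : h i * eta i = eta i * h i.
Proof.
have := fR (pos i) (pos i) (pos i) (neg i).
rewrite /DF /= !eqxx expr0 !scale1r !scale0r !addr0 add0r subrr => /eqP.
by rewrite subr_eq0 => /eqP.
Qed.

Lemma xs_pos n (i : 'I_N) (j k l : idx N) : (i < absi j)%N ->
  nul (f (pos i) j * xs f n k l - DF (xs f n) (pos i) j k l).
Proof. by move=> ij; rewrite (xs_comm fR) addrK; apply/nulZ/nul_pos. Qed.

(** Expand by the first factor F_im. For |m| < i it is negative and the term is null; for |m| = i it
    gives the two diagonal terms; for |m| > i it is positive, so it can be moved to the right end
    and only the bracket [DF] survives. *)
Lemma xs_step n (i : 'I_N) (l : idx N) (v : 'I_N -> A) :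
  (forall j : 'I_N, (i < j)%N ->
     DF (xs f n) (pos i) (pos j) (pos j) l - DF (xs f n) (pos i) (neg j) (neg j) l = v j) ->
  nul (xs f n.+1 (pos i) l -
    (h i * xs f n (pos i) l - eta i * xs f n (neg i) l + \sum_(j < N | (i < j)%N) v j)).
Proof.
move=> hv; rewrite /= big_sumType /= -big_split (bigD1 i) //=.
rewrite expr0 expr1 scale1r scaleN1r opprD addrACA subrr add0r.
have big_neq (F : 'I_N -> A) : \sum_(j < N | j != i) F j =
    \sum_(j < N | (i < j)%N) F j + \sum_(j < N | (j < i)%N) F j.
  rewrite (bigID (fun j : 'I_N => (i < j)%N)) /=; congr (_ + _); apply: eq_bigl => j;
  by rewrite -val_eqE /=; case: ltngtP.
rewrite big_neq addrAC -sumrB; apply: nulD; apply: nul_sum => j ij; rewrite scale1r scaleN1r.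
  rewrite -(hv j ij) subrBB.
  by apply: nulB; apply: xs_pos.
by apply: nulB; apply: nul_neg.
Qed.

Lemma X_step n i : nul (X n.+1 i -
  (h i * X n i - (-1) ^+ n *: (eta i * Y n i) - (1 + (-1) ^+ n) *: \sum_(j < N | (i < j)%N) X n j)).
Proof.
have := @xs_step n i (pos i) (fun j => - ((1 + (-1) ^+ n) *: X n j)).
rewrite sumrN -scaler_sumr xs_negpos -scalerAr; apply => j ij.
rewrite /DF /= !eqxx expr0 expr1 !scale1r !scale0r !addr0 !scaleN1r opprK xs_neg.
by rewrite scalerDl scale1r opprD opprD addrACA subrr add0r.
Qed.

Lemma Y_step n i : nul (Y n.+1 i -
  (h i * Y n i - (-1) ^+ n *: (eta i * X n i) - (1 - (-1) ^+ n) *: \sum_(j < N | (i < j)%N) Y n j)).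
Proof.
have := @xs_step n i (neg i) (fun j => - ((1 - (-1) ^+ n) *: Y n j)).
rewrite sumrN -scaler_sumr xs_neg -scalerAr; apply => j ij.
rewrite /DF /= !eqxx expr0 !scale1r !scale0r !addr0 !add0r xs_negpos.
by rewrite scalerBl scale1r !opprB addrC addrA subrK.
Qed.

(** The coefficients 1 + (-1)^n and 1 - (-1)^n vanish alternately. Hence two steps involve only the
    sum over X, and the terms in Y cancel because F_(i,-i) commutes with F_ii; its square F_ii turns
    h^2 into h^2 - h. *)
Lemma X_step2 m i : nul (X m.*2.+2 i - ((h i * h i - h i) * X m.*2 i
   - 2%:R *: (h i * \sum_(j < N | (i < j)%N) X m.*2 j))).
Proof.
have sm : (-1) ^+ m.*2 = 1 :> K by rewrite -mul2n exprM sqrrN !expr1n.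
have hX := X_step m.*2.+1 i; have hX0 := X_step m.*2 i; have hY0 := Y_step m.*2 i.
rewrite exprS sm mulr1 subrr scale0r subr0 scaleN1r opprK in hX.
rewrite sm scale1r in hX0; rewrite sm subrr scale0r subr0 scale1r in hY0.
apply: nul_trans hX _.
have := nulD (nul_diag (i := i) (j := pos i) erefl hX0) (nul_diag (i := i) (j := neg i) erefl hY0).
rewrite !mulrBr !mulrA h_eta eta_sqr mulrBl -scalerAr.
set a := _ * X _.+1 i; set b := _ * Y _.+1 i.
move=> hh; rewrite (subr_step _ _ _ (eta i * h i * Y m.*2 i)); exact: hh.
Qed.

End CyclicElementsModNull.

(** Unfolds the recursion of [bmom] along the list, to match the sum over j > i in [X_step2]. *)
Lemma bmom_drop (R : comNzRingType) N (h : 'I_N -> R) k m : (k <= N)%N ->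
  bmom (drop k (codom h)) m =
  2%:R * \sum_(j < N | (k <= j)%N) amom (h j) (bmom (drop j.+1 (codom h))) m.
Proof.
have sz : size (codom h) = N by rewrite size_codom card_ord.
have [d] := ubnP (N - k); elim: d k => // d IH k; rewrite ltnS => kd kN.
have [Nk|{}kN] := leqP N k.
  rewrite drop_oversize ?sz // big1 ?mulr0 // => j kj.
  by have := leq_trans Nk kj; rewrite leqNgt ltn_ord.
rewrite (drop_nth 0) ?sz //= IH //; last by move: kd kN; clear; lia.
rewrite [in RHS](bigD1 (Ordinal kN)) //= mulrDr; congr (_ * amom _ _ _ + _ * _).
  rewrite (nth_map (Ordinal kN)) ?size_enum_ord //; congr h.
  by apply: val_inj; rewrite /= nth_enum_ord.
by apply: eq_bigl => j; rewrite -val_eqE /= andbC ltn_neqAle eq_sym.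
Qed.

Section HCofCyclic.
Variables (K : fieldType) (N : nat).
Hypothesis char2 : (2%:R : K) != 0.
Local Notation U := (UqN K N).
Local Notation F := (@FU K N).
Local Notation null := (@null K N).
Let lam : seq (mpoly N K) := codom (fun i : 'I_N => 'X_i : mpoly N K).
Local Notation X n i := (xs F n (pos i) (pos i)).
Local Notation h i := (F (pos i) (pos i)).

Let lin : forall a (u v : U), null u -> null v -> null (a *: u + v).
Proof. by move=> a u v hu hv; apply: lspan_add hv; apply: lspan_scale. Qed.
Let negM (i : 'I_N) j u : (absi j < i)%N -> null (F (pos i) j * u).
Proof. by move=> ij; rewrite FU_FT; apply: null_negM. Qed.
Let Mpos (i : 'I_N) j u : (i < absi j)%N -> null (u * F (pos i) j).
Proof. by move=> ij; rewrite FU_FT; apply: null_Mpos. Qed.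
Let diagM (i : 'I_N) j u : absi j = i -> null u -> null (F (pos i) j * u).
Proof. by move=> ij; rewrite FU_FT; apply: null_diag_mul; rewrite /tdiag /= ij eqxx. Qed.

Lemma HC_X m i : null (X m.*2 i - at_F (amom 'X_i (bmom (drop i.+1 lam)) m)).
Proof.
elim: m i => [|m IH] i; first by rewrite /= at_FXU subrr; exact: lspan_nil.
have hs := X_step2 (@FU_bracket K N) (@FU_opp K N) char2 (lspan_nil _) lin negM Mpos diagM m i.
apply: (nul_trans lin hs).
rewrite /= bmom_drop ?ltn_ord //.
rewrite -/lam; set a := amom _ _ m.
pose b := \sum_(j < N | (i < j)%N) amom 'X_j (bmom (drop j.+1 lam)) m; rewrite -/b.
have -> : at_F ('X_i * ('X_i - 1) * a - 'X_i * (2%:R * b)) =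
    (h i * h i - h i) * at_F a - 2%:R *: (h i * at_F b).
  rewrite at_FB mulrBr mulr1 !at_FM at_FB at_FM at_FXU; congr (_ - _).
  have -> : at_F (2%:R : mpoly N K) = 2%:R *: 1.
    by rewrite -[2%:R]/((1 : mpoly N K) *+ 2) -scaler_nat at_FZ at_F1.
  by rewrite -scalerAl mul1r -scalerAr.
have hb : null (\sum_(j < N | (i < j)%N) X m.*2 j - at_F b).
  rewrite /b at_F_sum -sumrB; apply: lspan_sum => j _; exact: IH.
have := nulB lin (nulB lin (diagM (i := i) (j := pos i) erefl (diagM (i := i) (j := pos i) erefl (IH i))) (diagM (i := i) (j := pos i) erefl (IH i))) (nulZ (lspan_nil _) lin 2%:R (diagM (i := i) (j := pos i) erefl hb)).
rewrite -/a; move: (at_F a) (at_F b) (X m.*2 i) (\sum_(j < N | _) X _ j) (h i) => x y z w t.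
suff -> : (t * t - t) * z - 2%:R *: (t * w) - ((t * t - t) * x - 2%:R *: (t * y)) =
  t * (t * (z - x)) - t * (z - x) - 2%:R *: (t * (w - y)) by [].
by rewrite subrBB -mulrBr -scalerBr -mulrBr mulrBl mulrA.
Qed.

Lemma HC_cyclic m : HC_null (c_U K N m.*2.+1 - at_F (bmom lam m)).
Proof.
apply: null_HC_null.
have -> : bmom lam m = 2%:R * \sum_(j < N) amom 'X_j (bmom (drop j.+1 lam)) m.
  by rewrite -[lam in LHS]drop0 bmom_drop.
rewrite /c_U csum_xs big_sumType /=.
have -> : \sum_i xs F m.*2 (inr i) (inr i) = \sum_i X m.*2 i.
  apply: eq_bigr => i _; rewrite (xs_neg (@FU_opp K N)).
  by rewrite -mul2n exprM sqrrN !expr1n scale1r.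
rewrite -mulr2n mulr_natl -[_ *+ 2]scaler_nat -[(\sum_(j < N) amom _ _ _) *+ 2]scaler_nat.
rewrite at_FZ -scalerBr at_F_sum -sumrB.
by apply/lspan_scale/lspan_sum => i _; apply: HC_X.
Qed.

End HCofCyclic.

(** * Symmetric polynomials from moments *)

Lemma deriv_prod_uniq (R : comNzRingType) (I : eqType) (r : seq I) (F : I -> {poly R}) : uniq r ->
  (\prod_(k <- r) F k)^`() = \sum_(k <- r) (F k)^`() * \prod_(l <- r | l != k) F l.
Proof.
elim: r => [|a r IH] /=; first by rewrite !big_nil derivC.
case/andP => ar ur; rewrite !big_cons derivM IH // eqxx; congr (_ * _ + _).
  by rewrite big_seq [RHS]big_seq_cond; apply: eq_bigl => l; case: eqVneq => [->|]; rewrite ?(negbTE ar) // andbT.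
rewrite mulr_sumr; apply: eq_big_seq => k kr.
rewrite big_cons; case: eqVneq => [E|_]; last by rewrite mulrCA.
by rewrite E kr in ar.
Qed.

(** * Newton's identities *)

Section Newton.
Variables (R : idomainType) (N : nat) (c : 'I_N -> R).
Definition rootpol : {poly R} := \prod_(k < N) ('X - (c k)%:P).
Definition psum (r : nat) : R := \sum_(k < N) c k ^+ r.

Lemma size_rootpol : size rootpol = N.+1.
Proof. by rewrite size_prod_XsubC /index_enum -enumT size_enum_ord. Qed.
Lemma rootpol_lead : rootpol`_N = 1.
Proof.
have /monicP : rootpol \is monic by apply: monic_prod => k _; apply: monicXsubC.
by rewrite lead_coefE size_rootpol.
Qed.
Lemma rootpol_root k : rootpol.[c k] = 0.
Proof. by rewrite /rootpol (bigD1 k) //= hornerM hornerXsubC subrr mul0r. Qed.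

Lemma newton_root r : \sum_(m < N.+1) rootpol`_m * psum (m + r) = 0.
Proof.
rewrite /psum; under eq_bigr => m _ do rewrite mulr_sumr.
rewrite exchange_big big1 // => k _ /=.
transitivity (c k ^+ r * rootpol.[c k]); last by rewrite rootpol_root mulr0.
rewrite (@horner_coef_wide _ N.+1) ?size_rootpol // mulr_sumr.
by apply: eq_bigr => m _; rewrite exprD; ring.
Qed.

(** The derivative of a product of linear factors is the sum of its quotients by them, and
    [drop_poly_tel] expands the quotient by X - c_k in powers of c_k. *)
Lemma newton_deriv j : rootpol`_j.+1 *+ j.+1 =
  \sum_(l < N.+1) psum l * rootpol`_(j + l.+1).
Proof.
rewrite -coef_deriv {1}/rootpol deriv_prod_uniq ?index_enum_uniq // coef_sum.
transitivity (\sum_k \sum_(l < N.+1) c k ^+ l * rootpol`_(j + l.+1)).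
  apply: eq_bigr => k _; rewrite derivXsubC mul1r.
  set g := \prod_(_ | _) _.
  have E : rootpol = ('X - (c k)%:P) * g by rewrite /rootpol (bigD1 k).
  have := drop_poly_tel N.+1 E; rewrite (drop_poly_eq0 (p := g)); last first.
    have g0 : g != 0 by apply: monic_neq0; apply: monic_prod => i _; apply: monicXsubC.
    have := size_rootpol; rewrite E size_Mmonic ?monicXsubC ?polyXsubC_eq0 //; last exact: monic_prod_XsubC.
    by rewrite size_XsubC add2n /= => -[<-].
  rewrite scaler0 subr0 => <-; rewrite coef_sum; apply: eq_bigr => l _.
  by rewrite coefZ coef_drop_poly.
rewrite exchange_big; apply: eq_bigr => l _ /=; rewrite /psum mulr_suml.
by [].
Qed.

End Newton.

Section SymmetricFromMoments.
Variables (K : fieldType) (N : nat).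
Hypothesis char0 : forall k, (k.+1%:R : K) != 0.
Local Notation S := (mpoly N K).
Let lamf : 'I_N -> S := fun i => 'X_i.
Local Notation lam := (codom lamf).
Local Notation H := (hankel lamf).
Local Notation delta := (\det H).
Local Notation beta := (bmom lam).

(** An abstract subalgebra containing the first 2N moments; it will be the set [agree] of images of
    central elements on which two characters coincide. *)
Variable good : S -> Prop.
Hypothesis good1 : good 1.
Hypothesis good_lin : forall a f g, good f -> good g -> good (a *: f + g).
Hypothesis goodM : forall f g, good f -> good g -> good (f * g).
Hypothesis good_beta : forall m, (m < 2 * N)%N -> good (beta m).

Lemma good0 : good 0.
Proof. by rewrite -[0](addNr 1) -scaleN1r; apply: good_lin. Qed.
Lemma goodZ a f : good f -> good (a *: f).
Proof. by move=> hf; rewrite -[_ *: _]addr0; apply: good_lin => //; apply: good0. Qed.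
Lemma goodD f g : good f -> good g -> good (f + g).
Proof. by move=> hf hg; rewrite -[f]scale1r; apply: good_lin. Qed.
Lemma good_sum I (r : seq I) (Q : pred I) F :
  (forall i, Q i -> good (F i)) -> good (\sum_(i <- r | Q i) F i).
Proof. by move=> hF; elim/big_ind: _ => //; [apply: good0|apply: goodD]. Qed.
Lemma good_prod I (r : seq I) (Q : pred I) F :
  (forall i, Q i -> good (F i)) -> good (\prod_(i <- r | Q i) F i).
Proof. by move=> hF; elim/big_ind: _. Qed.
Lemma good_sign b f : good f -> good ((-1) ^+ b * f).
Proof. by move=> hf; rewrite -signr_odd; case: odd; rewrite ?mul1r // mulN1r -scaleN1r; apply: goodZ. Qed.
Lemma good_det n (A : 'M[S]_n) : (forall i j, good (A i j)) -> good (\det A).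
Proof. by move=> hA; apply: good_sum => s _; apply/good_sign/good_prod. Qed.

(* Cramer's rule for the Hankel system gives the coefficients of Pol, hence those
   of Qol, up to a power of delta; Newton's identities then give all symmetric
   polynomials. *)
Definition dgood (f : S) := exists k, good (delta ^+ k * f).

Lemma good_hankel i j : good (H i j).
Proof. by rewrite mxE; apply: good_beta; move: (ltn_ord i) (ltn_ord j); lia. Qed.
Lemma good_delta : good delta.
Proof. apply: good_det => i j; exact: good_hankel. Qed.
Lemma good_deltaX k : good (delta ^+ k).
Proof. by elim: k => // k IH; rewrite exprS; apply: goodM => //; apply: good_delta. Qed.

Lemma dgoodW f : good f -> dgood f.
Proof. by exists 0%N; rewrite mul1r. Qed.
Lemma dgood_lin a f g : dgood f -> dgood g -> dgood (a *: f + g).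
Proof.
move=> [k hk] [l hl]; exists (k + l)%N; rewrite mulrDr -scalerAr; apply: good_lin.
  by rewrite exprD mulrAC mulrC; apply: goodM => //; apply: good_deltaX.
by rewrite exprD -mulrA; apply: goodM => //; apply: good_deltaX.
Qed.
Lemma dgoodM f g : dgood f -> dgood g -> dgood (f * g).
Proof. by move=> [k hk] [l hl]; exists (k + l)%N; rewrite exprD mulrACA; apply: goodM. Qed.
Lemma dgood1 : dgood 1. Proof. exact: dgoodW. Qed.
Lemma dgood0 : dgood 0. Proof. apply: dgoodW; exact: good0. Qed.
Lemma dgoodZ a f : dgood f -> dgood (a *: f).
Proof. by move=> hf; rewrite -[_ *: _]addr0; apply: dgood_lin => //; apply: dgood0. Qed.
Lemma dgoodD f g : dgood f -> dgood g -> dgood (f + g).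
Proof. by move=> hf hg; rewrite -[f]scale1r; apply: dgood_lin. Qed.
Lemma dgoodN f : dgood f -> dgood (- f).
Proof. by rewrite -scaleN1r; apply: dgoodZ. Qed.
Lemma dgoodMn f k : dgood f -> dgood (f *+ k).
Proof. by rewrite -scaler_nat; apply: dgoodZ. Qed.
Lemma dgoodMn_inv f k : (0 < k)%N -> dgood (f *+ k) -> dgood f.
Proof. by case: k => // k _; move=> /(dgoodZ (k.+1%:R^-1)); rewrite -scaler_nat scalerA mulVf ?scale1r. Qed.
Lemma dgood_sum I (r : seq I) (Q : pred I) F :
  (forall i, Q i -> dgood (F i)) -> dgood (\sum_(i <- r | Q i) F i).
Proof. by move=> hF; elim/big_ind: _ => //; [apply: dgood0|apply: dgoodD]. Qed.
Lemma dgood_prod I (r : seq I) (Q : pred I) F :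
  (forall i, Q i -> dgood (F i)) -> dgood (\prod_(i <- r | Q i) F i).
Proof. by move=> hF; elim/big_ind: _ => //; [apply: dgood1|apply: dgoodM]. Qed.
Lemma dgoodX f k : dgood f -> dgood (f ^+ k).
Proof. by move=> hf; elim: k => [|k IH]; [exact: dgood1|rewrite exprS; apply: dgoodM]. Qed.

Lemma PolrootE : Pol lam = rootpol (fun k => xr (lamf k)).
Proof. exact: PolE. Qed.
Lemma QolrootE : Qol lam = rootpol (fun k => yr (lamf k)).
Proof. exact: QolE. Qed.

Lemma dgood_rootpol_top (c : 'I_N -> S) : (forall m, (m < N)%N -> dgood (rootpol c)`_m) ->
  forall m, dgood (rootpol c)`_m.
Proof.
move=> h m; case: (ltngtP m N) => [/h//|Nm|->]; last by rewrite rootpol_lead; exact: dgood1.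
by rewrite nth_default ?size_rootpol //; exact: dgood0.
Qed.

Lemma dgood_Pol m : dgood (Pol lam)`_m.
Proof.
rewrite PolrootE; apply: dgood_rootpol_top => {}m mN; rewrite -PolrootE.
pose p := \col_(i < N) (Pol lam)`_i; pose b := \col_(i < N) beta (N + i)%N.
(* The moment of Pol * X^i vanishes; isolating the leading coefficient 1 gives a linear system for
   the remaining coefficients of Pol. The largest moment in it has index N + (N - 1). *)
have Hp : H *m p = - b.
  apply/matrixP => i j; rewrite !mxE.
  have := moment_Pol lam 'X^i; rewrite (@momentM _ _ _ _ N.+1); last first.
  - by rewrite size_polyXn ltnS ltnW.
  - by rewrite PolrootE size_rootpol.
  rewrite big_ord_recr /= => /eqP; rewrite addr_eq0 => /eqP E.
  have inner (k : nat) (a : S) : \sum_(l < N.+1) a * beta (k + l)%N * ('X^i : {poly S})`_l = a * beta (k + i)%N.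
    have iN : (i < N.+1)%N by rewrite ltnS ltnW.
    rewrite (bigD1 (Ordinal iN)) //= coefXn eqxx mulr1 big1 ?addr0 // => l li.
    by rewrite coefXn -[_ == _]/(l == Ordinal iN) (negbTE li) mulr0.
  move: E; rewrite inner PolrootE rootpol_lead mul1r => <-.
  apply: eq_bigr => k _; rewrite inner !mxE mulrC addnC.
  by rewrite PolrootE.
have := congr1 (fun A => (\adj H *m A) (Ordinal mN) 0) Hp.
rewrite mulmxA mul_adj_mx mul_scalar_mx !mxE => E; exists 1%N; rewrite expr1 E.
apply: good_sum => k _; rewrite !mxE mulrN -scaleN1r; apply/goodZ/goodM; last first.
  by apply: good_beta; move: (ltn_ord k); lia.
by apply/good_sign/good_det => i j; rewrite !mxE; apply: good_beta;
  move: (ltn_ord (lift k i)) (ltn_ord (lift (Ordinal mN) j)); lia.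
Qed.

Lemma dgood_Qol l : dgood (Qol lam)`_l.
Proof.
rewrite QolrootE; apply: dgood_rootpol_top => {}l lN; rewrite -QolrootE.
have -> : (Qol lam)`_l = (Pol lam)`_l - moment beta (drop_poly l.+1 (Pol lam)).
  by rewrite moment_drop opprB addrC subrK.
apply: dgoodD; first exact: dgood_Pol.
rewrite (@momentE _ _ _ N); last first.
  by rewrite size_drop_poly PolrootE size_rootpol leq_subLR addSn ltnS leq_addl.
apply/dgoodN/dgood_sum => m _; rewrite coef_drop_poly; apply: dgoodM; first exact: dgood_Pol.
by apply/dgoodW/good_beta; move: (ltn_ord m); lia.
Qed.

Lemma dgood_psum (c : 'I_N -> S) : (forall m, dgood (rootpol c)`_m) ->
  forall r, dgood (psum c r).
Proof.
move=> hc r; elim/ltn_ind: r => r IH; have [rN|Nr] := ltnP r N.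
  (* For this index the power sum of order r is multiplied by the leading coefficient 1, and those
     of higher order by coefficients beyond the degree. *)
  have := newton_deriv c (N - r.+1).
  rewrite (bigD1 (Ordinal (leqW rN))) //=.
  have -> : (N - r.+1 + r.+1)%N = N by rewrite subnK.
  rewrite rootpol_lead mulr1 => E.
  rewrite (_ : psum c r = (rootpol c)`_(N - r.+1).+1 *+ (N - r.+1).+1 -
    \sum_(i < N.+1 | i != Ordinal (leqW rN)) psum c i * (rootpol c)`_(N - r.+1 + i.+1)); last first.
    by rewrite E addrK.
  apply: dgoodD; first exact: dgoodMn.
  apply/dgoodN/dgood_sum => i; rewrite -val_eqE /=; case: (ltngtP i r) => // ir _.
    by apply: dgoodM; [apply: IH|].
  rewrite nth_default ?mulr0; first exact: dgood0.
  by rewrite size_rootpol -[in X in (X <= _)%N](subnK rN) -addnS leq_add2l ltnS.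
have := newton_root c (r - N); rewrite big_ord_recr /= rootpol_lead mul1r subnKC // => /eqP.
rewrite addrC addr_eq0 => /eqP ->; apply/dgoodN/dgood_sum => m _; apply: dgoodM => //.
by apply: IH; move: (ltn_ord m); lia.
Qed.

Lemma dgood_psum_top (D : {poly K}) m : (size D <= m.+1)%N -> D`_m != 0 ->
  (forall j, (j < m)%N -> dgood (psum lamf j)) ->
  dgood (\sum_i (map_poly (@mpolyC N K) D).['X_i]) -> dgood (psum lamf m).
Proof.
move=> sD Dm low hD.
have : \sum_i (map_poly (@mpolyC N K) D).['X_i] =
    D`_m *: psum lamf m + \sum_(j < m) D`_j *: psum lamf j.
  rewrite addrC -(big_ord_recr m (fun j => D`_j *: psum lamf j)) /psum.
  under [RHS]eq_bigr => j _ do rewrite scaler_sumr.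
  rewrite [RHS]exchange_big; apply: eq_bigr => i _ /=.
  rewrite (@horner_coef_wide _ m.+1) ?(leq_trans (size_poly _ _)) //.
  by apply: eq_bigr => j _; rewrite coef_map /= mul_mpolyC.
move=> /(congr1 (fun x => x - \sum_(j < m) D`_j *: psum lamf j)); rewrite addrK => E.
rewrite -[psum lamf m]scale1r -(mulVf Dm) -scalerA -E; apply/dgoodZ/dgoodD => //.
by apply/dgoodN/dgood_sum => j _; apply/dgoodZ/low.
Qed.

Let ax : {poly K} := 'X * ('X + 1%:P).
Let bx : {poly K} := 'X * ('X - 1%:P).

Lemma size_ax_bx i j : ax ^+ i * bx ^+ j \is monic /\ size (ax ^+ i * bx ^+ j) = (i + j).*2.+1.
Proof.
have ax_monic : ax \is monic by rewrite monicMl ?monicX // monicXaddC.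
have bx_monic : bx \is monic by rewrite monicMl ?monicX // monicXsubC.
have size_ax : size ax = 3.
  by rewrite /ax mulrC size_mulX ?size_XaddC // monic_neq0 ?monicXaddC.
have size_bx : size bx = 3.
  by rewrite /bx mulrC size_mulX ?size_XsubC // monic_neq0 ?monicXsubC.
have s0 (p : {poly K}) k : p \is monic -> size p = 3 -> size (p ^+ k) = k.*2.+1.
  move=> mp sp; rewrite -(prednK (n := size _)) ?size_exp ?sp ?mul2n //.
  by rewrite lt0n size_poly_eq0 monic_neq0 ?monic_exp.
split; first by rewrite monicMl monic_exp.
rewrite size_monicM ?monic_exp ?monic_neq0 ?monic_exp // !s0 // doubleD; lia.
Qed.

(** Pol and Qol give the power sums of l (l - 1) and of l (l + 1). The former reach the even orders
    2k. For order 2k + 1 take (l (l + 1))^(k+1) - (l (l - 1))^(k+1): as l (l + 1) - l (l - 1) = 2 l,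
    its degree is 2k + 1 and its leading coefficient 2 (k + 1). *)
Lemma dgood_psum_lam m : dgood (psum lamf m).
Proof.
elim/ltn_ind: m => m IH.
have hx k : dgood (\sum_i (map_poly (@mpolyC N K) (bx ^+ k)).['X_i]).
  suff -> : \sum_i (map_poly (@mpolyC N K) (bx ^+ k)).['X_i] = psum (fun i => xr (lamf i)) k.
    by apply: dgood_psum => j; rewrite -PolrootE; apply: dgood_Pol.
  apply: eq_bigr => i _; rewrite rmorphXn horner_exp rmorphM rmorphB /= map_polyX map_polyC.
  by rewrite hornerM hornerX hornerD hornerN hornerX hornerC /= mpolyC1.
have hy k : dgood (\sum_i (map_poly (@mpolyC N K) (ax ^+ k)).['X_i]).
  suff -> : \sum_i (map_poly (@mpolyC N K) (ax ^+ k)).['X_i] = psum (fun i => yr (lamf i)) k.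
    by apply: dgood_psum => j; rewrite -QolrootE; apply: dgood_Qol.
  apply: eq_bigr => i _; rewrite rmorphXn horner_exp rmorphM rmorphD /= map_polyX map_polyC.
  by rewrite hornerM hornerX hornerD hornerX hornerC /= mpolyC1.
have mono i j : (ax ^+ i * bx ^+ j)`_((i + j).*2) = 1.
  by have [/monicP + sE] := size_ax_bx i j; rewrite lead_coefE sE.
rewrite -(odd_double_half m) in IH *; move: (half m) (odd m) IH => k [] IH; last first.
  apply: (@dgood_psum_top (bx ^+ k)) => //.
    by have [_] := size_ax_bx 0 k; rewrite mul1r add0n => ->.
  by have := mono 0%N k; rewrite mul1r add0n => ->; rewrite oner_eq0.
have DE : ax ^+ k.+1 - bx ^+ k.+1 = 'X * (2%:R *: \sum_(i < k.+1) ax ^+ (k - i) * bx ^+ i).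
  rewrite subrXX scaler_nat -mulr_natl mulrA; congr (_ * _).
  by rewrite /ax /bx -mulrBr opprB addrC addrA -addrA addrC; ring.
apply: (@dgood_psum_top (ax ^+ k.+1 - bx ^+ k.+1)) => //.
- rewrite DE; apply/leq_sizeP => j hj; rewrite coefXM coefZ; case: j hj => //= j hj.
  rewrite coef_sum big1 ?mulr0 // => i _; rewrite nth_default // (size_ax_bx _ _).2 subnK -1?ltnS //.
- rewrite DE coefXM coefZ coef_sum /= (eq_bigr (fun=> 1)) => [|i _].
    by rewrite sumr_const card_ord mulf_neq0.
  by rewrite -[RHS](mono (k - i)%N i) subnK // -ltnS.
rewrite raddfB; under eq_bigr => i _ do rewrite /= hornerD hornerN.
rewrite sumrB; exact: dgoodD (hy _) (dgoodN (hx _)).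
Qed.

(** Newton's identities read from the top coefficient down: the coefficient of index m occurs with
    factor N - m, which is invertible, the other terms being power sums times higher
    coefficients. *)
Lemma dgood_rootpol_lam m : dgood (rootpol lamf)`_m.
Proof.
have [r] := ubnP (N - m); elim: r m => // r IH m; rewrite ltnS => Nmr.
have high k : (m < k)%N -> dgood (rootpol lamf)`_k.
  move=> mk; case: (ltngtP k N) => kN; last by rewrite kN rootpol_lead; exact: dgood1.
    by apply: IH; move: Nmr mk kN; clear; lia.
  by rewrite nth_default ?size_rootpol //; exact: dgood0.
have psum0 : psum lamf 0 = N%:R.
  by rewrite /psum (eq_bigr (fun=> 1)) ?sumr_const ?card_ord // => i _; rewrite expr0.
have [Nm|mN] := leqP N m.
  rewrite leq_eqVlt in Nm; case/orP: Nm => [/eqP<-|Nm]; first by rewrite rootpol_lead; exact: dgood1.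
  by rewrite nth_default ?size_rootpol //; exact: dgood0.
case: m Nmr high mN => [|m] Nmr high mN.
  have := newton_root lamf 0; rewrite big_ord_recl /= addn0 psum0 => /eqP.
  rewrite addr_eq0 mulr_natr => /eqP E.
  apply: (dgoodMn_inv mN); rewrite E.
  apply/dgoodN/dgood_sum => i _; rewrite /bump /= add1n; apply: dgoodM; first exact: high.
  exact: dgood_psum_lam.
have := newton_deriv lamf m; rewrite big_ord_recl /= psum0 addn1 mulr_natl => E.
apply: (@dgoodMn_inv _ (N - m.+1)); rewrite ?subn_gt0 // mulrnBr ?(ltnW mN) // E opprD addrA subrr sub0r.
apply/dgoodN/dgood_sum => i _; apply: dgoodM; first exact: dgood_psum_lam.
by apply: high; rewrite /bump leq0n add1n !addnS !ltnS leq_addr.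
Qed.

Lemma dgood_symmetric f : f \is symmetric -> dgood f.
Proof.
move=> /sym_fundamental[t [<- _]]; rewrite /comp_mpoly /mmap; apply: dgood_sum => m _.
rewrite mul_mpolyC; apply/dgoodZ/dgood_prod => i _; apply: dgoodX.
rewrite tnth_mktuple.
have E : (\prod_(c <- [tuple lamf k | k < N]) ('X - c%:P))`_(N - i.+1) = (-1) ^+ i.+1 * mesym N K i.+1.
  rewrite (mroots_coeff _ (lift ord0 i)) /= /mesym !raddf_sum /=; congr (_ * _).
  apply: eq_bigr => h _; rewrite !rmorph_prod; apply: eq_bigr => k _ /=.
  by rewrite mevalXU tnth_mktuple.
rewrite -[mesym _ _ _](signrMK i.+1) -E.
rewrite big_tuple (eq_bigr (fun k => 'X - (lamf k)%:P)) => [|k _]; last by rewrite tnth_mktuple.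
by rewrite -signr_odd; case: odd; rewrite ?mul1r ?mulN1r; try apply: dgoodN; exact: dgood_rootpol_lam.
Qed.

End SymmetricFromMoments.

(** * Central characters *)

Section CentralCharacters.
Variables (K : fieldType) (N : nat).
Hypothesis char0 : forall k, (k.+1%:R : K) != 0.
Local Notation S := (mpoly N K).
Local Notation Z := (ZN K N).
Let char2 : (2%:R : K) != 0 := char0 1.
Let lamf : 'I_N -> S := fun i => 'X_i.
Local Notation lam := (codom lamf).
Local Notation delta := (\det (hankel lamf)).

Lemma ZN_val_lin a (z w : Z) : ZN_val (a *: z + w) = a *: ZN_val z + ZN_val w.
Proof. exact: (linearP (\val : Z -> _)). Qed.
Lemma ZN_valM (z w : Z) : ZN_val (z * w) = ZN_val z * ZN_val w.
Proof. exact: (rmorphM (\val : Z -> _)). Qed.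
Lemma ZN_val1 : ZN_val (1 : Z) = 1.
Proof. exact: (rmorph1 (\val : Z -> _)). Qed.

(** A relation in place of the function [HC]: it is additive and multiplicative without any prior
    knowledge of existence, and it records that z is even. *)
Definition HCrel (z : Z) (f : S) := ecentral (ZN_val z) /\ HC_null (ZN_val z - at_F f).

Lemma HCrel_lin a z w f g : HCrel z f -> HCrel w g -> HCrel (a *: z + w) (a *: f + g).
Proof.
move=> [cz hz] [cw hw]; rewrite /HCrel ZN_val_lin.
by split; [exact: (ecentral_lin a cz cw)|exact: (HC_lin a hz hw)].
Qed.
Lemma HCrelM z w f g : HCrel z f -> HCrel w g -> HCrel (z * w) (f * g).
Proof.
move=> [cz hz] [cw hw]; rewrite /HCrel ZN_valM.
by split; [exact: (ecentral_mul cz cw)|exact: (HC_mul cw hz hw)].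
Qed.
Lemma HCrel1 : HCrel 1 1.
Proof.
rewrite /HCrel ZN_val1; split; first exact: ecentral1.
by rewrite at_F1 subrr; apply: HC_0.
Qed.
Lemma HCrel0 : HCrel 0 0.
Proof. by have := HCrel_lin (-1) HCrel1 HCrel1; rewrite !scaleN1r !addNr. Qed.
Lemma HCrelD z w f g : HCrel z f -> HCrel w g -> HCrel (z + w) (f + g).
Proof. by move=> hz; rewrite -[z]scale1r -[f]scale1r; apply: HCrel_lin. Qed.
Lemma HCrelZ a z f : HCrel z f -> HCrel (a *: z) (a *: f).
Proof. by move=> hz; have := HCrel_lin a hz HCrel0; rewrite !addr0. Qed.
Lemma HCrelX k z f : HCrel z f -> HCrel (z ^+ k) (f ^+ k).
Proof. by move=> hz; elim: k => [|k IH]; [exact: HCrel1|rewrite !exprS; apply: HCrelM]. Qed.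
Lemma HCrel_det n (A : 'M[Z]_n) (B : 'M[S]_n) : (forall i j, HCrel (A i j) (B i j)) ->
  HCrel (\det A) (\det B).
Proof.
move=> h; apply: (big_ind2 HCrel); [exact: HCrel0|by move=> *; apply: HCrelD|move=> s _].
apply: HCrelM.
  case: (odd_perm s); last by rewrite !expr0; exact: HCrel1.
  by rewrite !expr1 -(scaleN1r 1) -[X in HCrel _ X](scaleN1r 1); apply/HCrelZ/HCrel1.
apply: (big_ind2 HCrel) => [|*|i _]; [exact: HCrel1|exact: HCrelM|exact: h].
Qed.

Lemma addNr_eq (V : zmodType) (a b : V) : - b + a = 0 -> a = b.
Proof. by move/eqP; rewrite addrC subr_eq0 => /eqP. Qed.
Lemma HCrel_inj z w f : HCrel z f -> HCrel w f -> z = w.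
Proof.
move=> hz hw; have := HCrel_lin (-1) hw hz.
rewrite /HCrel ZN_val_lin [-1 *: ZN_val _]scaleN1r [-1 *: f]scaleN1r addNr => -[c h].
exact: val_inj (addNr_eq (HC_inj char0 c h)).
Qed.
Lemma HCrelE z f : HCrel z f -> HC z = f.
Proof.
move=> [_ hz]; have h : HC_null (ZN_val z - at_F (HC z)).
  apply: (@classical_sets.xgetPex _ 0 (fun f => HC_null (ZN_val z - at_F f))).
  by exists f.
exact: (HC_unique char0 h hz).
Qed.

Lemma ecentral_c r : ecentral (c_U K N r.+1).
Proof.
rewrite /c_U csum_xs; split=> [|i j]; last by rewrite (trace_xs_comm (@FU_bracket K N)).
apply: (big_ind (U_homog false)) => [|u v hu hv|k _]; first exact: UH_zero.
  by rewrite -[u]scale1r; apply: UH_lin.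
by rewrite -(addbb (par k)); apply: U_homog_xs.
Qed.

Lemma HCrel_c m : HCrel (c_ K N m.*2.+1) (bmom lam m).
Proof. by split; [exact: ecentral_c|exact: HC_cyclic]. Qed.
Lemma HCrel_b m : HCrel (b_ K N m.+1) (bmom lam m).
Proof.
have -> : b_ K N m.+1 = c_ K N m.*2.+1 by rewrite /b_ mul2n doubleS.
exact: HCrel_c.
Qed.
Lemma HCrel_Delta : HCrel (Delta K N) delta.
Proof. by apply: HCrel_det => i j; rewrite !mxE; apply: HCrel_b. Qed.

Lemma HCrel_DeltaM k z f : HCrel z f -> HCrel (Delta K N ^+ k * z) (delta ^+ k * f).
Proof. exact: HCrelM (HCrelX k HCrel_Delta). Qed.

Lemma deltaE : exists e : bool, delta = (-1) ^+ e *
  \prod_k \prod_l (('X_k + 'X_l) * ('X_k - 'X_l - 1)).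
Proof.
have [e ->] := det_hankel lamf; exists e; congr (_ * _); apply: eq_bigr => k _.
rewrite QolE horner_prod; apply: eq_bigr => l _.
rewrite hornerXsubC /xr /yr /lamf; ring.
Qed.

Lemma meval_delta v : (delta.@[v] != 0) <->
  (forall k l, v k + v l != 0) /\ (forall k l, v k - v l != 1).
Proof.
have [e ->] := deltaE; rewrite mevalM rmorphXn rmorphN1 mulf_eq0 signr_eq0 /=.
have E k l : (('X_k + 'X_l) * ('X_k - 'X_l - 1) : S).@[v] = (v k + v l) * (v k - v l - 1).
  by rewrite mevalM !mevalB mevalD !mevalXU meval1.
rewrite rmorph_prod; split=> [/prodf_neq0 h|[h1 h2]].
  have {}h k l : (v k + v l != 0) && (v k - v l - 1 != 0).
    have := h k isT; rewrite rmorph_prod => /prodf_neq0/(_ l isT) /=.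
    by rewrite E mulf_eq0 negb_or.
  by split=> k l; have := h k l; case/andP => //; rewrite subr_eq0.
apply/prodf_neq0 => k _; rewrite rmorph_prod; apply/prodf_neq0 => l _ /=.
by rewrite E mulf_neq0 // subr_eq0.
Qed.

Lemma delta_neq0 : delta != 0.
Proof.
(* At the point with all coordinates 1 the sums are 2 and the differences 0. *)
have /meval_delta : (forall k l : 'I_N, (1 : K) + 1 != 0) /\ (forall k l : 'I_N, (1 : K) - 1 != 1).
  by split=> _ _ //; rewrite subrr eq_sym oner_neq0.
by apply: contraNneq => ->; rewrite meval0.
Qed.

Lemma delta_symmetric : delta \is symmetric.
Proof.
have [e ->] := deltaE; apply/issymP => s; rewrite msymM rmorphXn rmorphN1; congr (_ * _).
have XE k : msym s ('X_k : S) = 'X_(s k) by rewrite /msym mmapX mmap1U.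
rewrite rmorph_prod [RHS](reindex_inj (@perm_inj _ s)); apply: eq_bigr => k _.
rewrite rmorph_prod [RHS](reindex_inj (@perm_inj _ s)); apply: eq_bigr => l _.
by rewrite /= msymM !msymB msymD msym1 !XE.
Qed.

Lemma msize_msym (s : 'S_N) (f : S) : msize (msym s f) = msize f.
Proof.
have h t g : (msize (msym t g : S) <= msize g)%N.
  apply/msize_deg => m mg; rewrite mcoeff_sym.
  have [h _] := msize_deg (msize g) g; apply: h => //.
  by rewrite mdeg_mperm.
apply/eqP; rewrite eqn_leq h /=.
by have := h (s^-1)%g (msym s f); rewrite -msymMm mulgV msym1m.
Qed.

Definition average (f : S) : S := (#|{: 'S_N}|%:R)^-1 *: \sum_(s : 'S_N) msym s f.

Lemma average_symmetric f : average f \is symmetric.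
Proof.
apply/issymP => t; rewrite /average msymZ; congr (_ *: _).
rewrite [RHS](reindex_inj (@mulIg _ t)); etransitivity; first exact: raddf_sum.
by apply: eq_bigr => s _; rewrite msymMm.
Qed.

Lemma succ_pred2 a b : (0 < a)%N -> (0 < b)%N -> (a + b).-1 = (a + b).-2.+1.
Proof. lia. Qed.
Lemma leq_from_pred2 a b c d : (0 < a)%N -> (0 < b)%N -> (0 < c)%N ->
  ((a + b).-1 <= (a + c).-2)%N -> (c <= d.+1)%N -> (b <= d)%N.
Proof. lia. Qed.

Lemma msizeB_le d (f g : S) : (msize f <= d)%N -> (msize g <= d)%N -> (msize (f - g) <= d)%N.
Proof.
move=> /msize_deg hf /msize_deg hg; apply/msize_deg => m dm.
by rewrite mcoeffB hf // hg // subrr.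
Qed.

Lemma msize_average d f : (forall s : 'S_N, (msize (msym s f - f) <= d)%N) ->
  (msize (f - average f) <= d)%N.
Proof.
move=> h; have n0 : (#|{: 'S_N}|%:R : K) != 0.
  have : (0 < #|{: 'S_N}|)%N by apply/card_gt0P; exists 1%g.
  by case: #|_|.
have -> : f - average f = - (#|{: 'S_N}|%:R)^-1 *: \sum_(s : 'S_N) (msym s f - f).
  rewrite sumrB sumr_const -cardsT cardsT scaleNr scalerBr opprB -scaler_nat scalerA.
  by rewrite mulVf // scale1r.
apply/msize_deg => m dm; rewrite mcoeffZ raddf_sum big1 ?mulr0 // => s _.
by have /msize_deg := h s; apply.
Qed.

Section OneCharacter.
Variable psi : {lrmorphism Z -> K | *%R}.
Lemma character_lin a z w : psi (a *: z + w) = a * psi z + psi w.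
Proof. exact: linearP. Qed.
Lemma characterD z w : psi (z + w) = psi z + psi w.
Proof. exact: rmorphD. Qed.
Lemma characterM z w : psi (z * w) = psi z * psi w.
Proof. exact: rmorphM. Qed.
Lemma characterX z k : psi (z ^+ k) = psi z ^+ k.
Proof. exact: rmorphXn. Qed.
End OneCharacter.

(** * Comparison of two characters *)

Section TwoCharacters.
Variables chi chi' : {lrmorphism Z -> K | *%R}.
Hypothesis chi_eq : forall r : nat, (1 <= r <= 2 * N)%N ->
  chi (c_ K N (2 * r - 1)) = chi' (c_ K N (2 * r - 1)).

(** The existence of a central preimage z matters as much as the equality of values:
    [HCrel_delta_symmetric] uses it to see symmetric polynomials as images up to a power of
    delta. *)
Definition agree (f : S) := exists2 z, HCrel z f & chi z = chi' z.

Lemma agree1 : agree 1.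
Proof. by exists 1; [exact: HCrel1|rewrite !rmorph1]. Qed.
Lemma agree_lin a f g : agree f -> agree g -> agree (a *: f + g).
Proof.
move=> [z hz ez] [w hw ew]; exists (a *: z + w); first exact: HCrel_lin.
by rewrite !character_lin ez ew.
Qed.
Lemma agreeM f g : agree f -> agree g -> agree (f * g).
Proof.
move=> [z hz ez] [w hw ew]; exists (z * w); first exact: HCrelM.
by rewrite !characterM ez ew.
Qed.
Lemma agree_bmom m : (m < 2 * N)%N -> agree (bmom lam m).
Proof.
move=> mN; exists (b_ K N m.+1); first exact: HCrel_b.
by apply: chi_eq.
Qed.

Lemma agree_symmetric f : f \is symmetric -> exists k, agree (delta ^+ k * f).
Proof. exact: (dgood_symmetric char0 agree1 agree_lin agreeM agree_bmom). Qed.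

(* f differs from its average by terms of lower degree (HC_top_symmetric), and
   the average is, up to a power of delta, the image of a central element. *)
Lemma HCrel_delta_symmetric d f k z : HCrel z (delta ^+ k * f) -> (msize f <= d)%N ->
  f \is symmetric.
Proof.
elim: d f k z => [|d IH] f k z hz fd.
  by move: fd; rewrite leqn0 msize_poly_eq0 => /eqP->; apply: rpred0.
have [->|f0] := eqVneq f 0; first exact: rpred0.
have dk0 : delta ^+ k != 0 by rewrite expf_neq0 // delta_neq0.
have dks s : msym s (delta ^+ k) = delta ^+ k.
  by rewrite rmorphXn /= (issymP _ delta_symmetric).
have pf : msize (delta ^+ k * f) = ((msize (delta ^+ k) + msize f).-2.+1)%N.
  by rewrite msizeM //; apply: succ_pred2; rewrite lt0n msize_poly_eq0.
have [cz hz'] := hz.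
have [g gs gd] := HC_top_symmetric char0 cz hz' (eq_leq pf).
(* delta^k f differs from the symmetric g in lower degree, and delta^k is symmetric. So delta^k (s f
   - f) has smaller degree than delta^k f, and degrees add in a domain. *)
have low s : (msize (msym s f - f) <= d)%N.
  have [->|h0] := eqVneq (msym s f - f) 0; first by rewrite msize0.
  have : (msize (delta ^+ k * (msym s f - f)) <= (msize (delta ^+ k) + msize f).-2)%N.
    have -> : delta ^+ k * (msym s f - f) =
        msym s (delta ^+ k * f - g) - (delta ^+ k * f - g).
      by rewrite msymB msymM dks (issymP _ gs) mulrBr opprB addrA subrK.
    by apply: msizeB_le => //; rewrite msize_msym.
  by rewrite msizeM // => le; apply: leq_from_pred2 le fd; rewrite lt0n msize_poly_eq0.
have [l [w hw _]] := agree_symmetric (average_symmetric f).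
have avg := average_symmetric f.
rewrite -(subrK (average f) f); apply: rpredD => //.
(* The difference of f and its average is again an image after multiplication by a power of delta,
   now k + l in place of k; the induction hypothesis allows this. *)
have E : delta ^+ (k + l) * (f - average f) =
    -1 *: (delta ^+ k * (delta ^+ l * average f)) + delta ^+ l * (delta ^+ k * f).
  by rewrite mulrBr exprD scaleN1r addrC -!mulrA [delta ^+ l * (_ * f)]mulrCA.
have hE := HCrel_lin (-1) (HCrel_DeltaM k hw) (HCrel_DeltaM l hz).
rewrite -E in hE; apply: IH hE _.
exact: msize_average.
Qed.

Hypothesis chi_Delta : chi (Delta K N) != 0.

Lemma chi_eq_ecentral z : ecentral (ZN_val z) -> chi z = chi' z.
Proof.
move=> cz; have [f hf] := HC_exists char0 cz.
have hz : HCrel z f by [].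
have fs : f \is symmetric.
  have hz0 : HCrel z (delta ^+ 0 * f) by rewrite expr0 mul1r.
  exact: HCrel_delta_symmetric hz0 (leqnn _).
have Deltas : chi (Delta K N) = chi' (Delta K N).
  have [w hw ew] := good_delta agree1 agree_lin agreeM agree_bmom.
  by rewrite (HCrel_inj HCrel_Delta hw).
have [k [w hw ew]] := agree_symmetric fs.
have wE : w = Delta K N ^+ k * z.
  exact: (HCrel_inj hw (HCrel_DeltaM k hz)).
move: ew; rewrite wE !characterM !characterX -Deltas => /mulfI; apply.
by rewrite expf_neq0.
Qed.

Lemma chi_eq_all z : chi z = chi' z.
Proof.
have [z0 [z1 [c0 c1 zE]]] := scentralP _ (ZN_valP z).
have in0 : z0 \in @scentralb K N.
  by apply/scentralP; exists z0, 0; rewrite addr0; split=> //; apply: scentral_homog0.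
have in1 : z1 \in @scentralb K N.
  by apply/scentralP; exists 0, z1; rewrite add0r; split=> //; apply: scentral_homog0.
have -> : z = MkZN in0 + MkZN in1 by apply: val_inj; rewrite rmorphD.
have nil : MkZN in1 * MkZN in1 = 0.
  apply: val_inj; rewrite rmorphM rmorph0 /=.
  have [h1 h2] := c1; have := h2 _ _ h1; rewrite expr1 scaleN1r => /eqP.
  rewrite -subr_eq0 opprK -mulr2n -scaler_nat scaler_eq0 (negbTE char2) => /eqP.
  by [].
have chi0 (psi : {lrmorphism Z -> K | *%R}) : psi (MkZN in1) = 0.
  have := congr1 psi nil; rewrite rmorphM rmorph0 => /eqP.
  by rewrite mulf_eq0 orbb => /eqP.
rewrite !characterD !chi0 !addr0; apply: chi_eq_ecentral; split; first by case: c0.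
move=> i j; have [_ h] := c0.
(* F_ij is the partial sum [xs] of length 0, whence its homogeneity. *)
by have := h _ _ (U_homog_xs K 0 i j); rewrite scale1r.
Qed.

End TwoCharacters.
End CentralCharacters.

Theorem corollary5p13 (R : realType) (N : nat) (N_ge1 : (1 <= N)%N) :
  (forall chi chi' : {lrmorphism ZN R[i] N -> R[i] | *%R},
     chi (Delta R[i] N) != 0 ->
     (forall r : nat, (1 <= r <= 2 * N)%N ->
        chi (c_ R[i] N (2 * r - 1)) = chi' (c_ R[i] N (2 * r - 1))) ->
     forall z : ZN R[i] N, chi z = chi' z) /\
  (forall lambda : 'I_N -> R[i],
     chi_ lambda (Delta R[i] N) != 0 <->
     strongly_typical lambda /\
     (forall i j : 'I_N, i != j -> lambda i - lambda j != 1)).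
Proof.
have char0 k : (k.+1%:R : R[i]) != 0 by rewrite pnatr_eq0.
split=> [chi chi' chi_Delta chi_eq|lambda]; first exact: chi_eq_all.
rewrite /chi_ (HCrelE char0 (HCrel_Delta N char0)) meval_delta //.
split=> -[typ sep]; split=> // i j.
by have [->|/sep//] := eqVneq i j; rewrite subrr eq_sym oner_neq0.
Qed.
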